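(* Let $\Bbbk$ be a field, let $d,e\ge0$ be integers with $d+e\ge3$, let $c=d+e-1$, and let $L$ be the ideal of $2\times 2$ minors of the $2\times(c+1)$ matrix $$\mathbf{L}=(\ell_{i,j})=\begin{pmatrix} y_{1,1}&\cdots&y_{1,d}&x_1&x_2&\cdots&x_{e-1}&x_e\\ y_{2,1}&\cdots&y_{2,d}&x_2&x_3&\cdots&x_e&0\end{pmatrix}$$ in $S=\Bbbk[y_{1,1},\dots,y_{2,d},x_1,\dots,x_e]$. Let $\pi_{\mathcal R}:P_{\mathcal R}=S[T_{\alpha,\beta}:1\le\alpha<\beta\le c+1]\to\mathcal{R}(L)$ be the presentation of the Rees algebra sending $T_{\alpha,\beta}$ to $\Delta_{\alpha,\beta}\tau$, where $\Delta_{\alpha,\beta}$ is the minor of $\mathbf{L}$ on columns $\alpha<\beta$. Then the upper and lower Eagon-Northcott relations, the Plücker relations and the Laplace relations form a Gröbner basis of the defining ideal $\ker(\pi_{\mathcal R})$ of $\mathcal{R}(L)$ with respect to the monomial order $\preceq$.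
   Context: The Rees algebra is $\mathcal{R}(L)=S[\Delta_{\alpha,\beta}\tau:1\le\alpha<\beta\le c+1]\subseteq S[\tau]$; $\pi_{\mathcal R}$ is the identity on $S$. Eagon-Northcott relations (upper and lower): for $1\le\alpha<\beta<\gamma\le c+1$, $$\mathrm{UEN}_{\alpha,\beta,\gamma}=\ell_{1,\alpha}T_{\beta,\gamma}-\ell_{1,\beta}T_{\alpha,\gamma}+\ell_{1,\gamma}T_{\alpha,\beta},\qquad \mathrm{LEN}_{\alpha,\beta,\gamma}=\ell_{2,\alpha}T_{\beta,\gamma}-\ell_{2,\beta}T_{\alpha,\gamma}+\ell_{2,\gamma}T_{\alpha,\beta}.$$ Plücker relations: for $1\le\alpha<\beta<\gamma<\delta\le c+1$, $\mathrm{PLU}_{\alpha,\beta,\gamma,\delta}=T_{\alpha,\beta}T_{\gamma,\delta}-T_{\alpha,\gamma}T_{\beta,\delta}+T_{\alpha,\delta}T_{\beta,\gamma}$. Laplace relations: for $d+1\le\alpha<\beta<\gamma<\delta\le c$, $$\mathrm{LAP}_{\alpha,\beta,\gamma,\delta}=T_{\alpha,\beta}T_{\gamma+1,\delta+1}-T_{\alpha,\gamma}T_{\beta+1,\delta+1}+T_{\alpha,\delta}T_{\beta+1,\gamma+1}+T_{\beta,\gamma}T_{\alpha+1,\delta+1}-T_{\beta,\delta}T_{\alpha+1,\gamma+1}+T_{\gamma,\delta}T_{\alpha+1,\beta+1},$$ and for $d+1\le\alpha<\beta<\gamma<\delta=c+1$, $\mathrm{LAP}_{\alpha,\beta,\gamma,c+1}=T_{\alpha,c+1}T_{\beta+1,\gamma+1}-T_{\beta,c+1}T_{\alpha+1,\gamma+1}+T_{\gamma,c+1}T_{\alpha+1,\beta+1}$.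 Monomial order $\preceq$ on $P_{\mathcal R}$: monomials are compared by the following rules, each used to break ties left by the previous ones. Let $\mathbf{e}_1,\dots,\mathbf{e}_{c+1}$ be the basis of $\mathbb{N}^{c+1}$. (1) Compare the factors in $\Bbbk[y_{2,1},\dots,y_{2,d}]$ by the lexicographic order induced by $y_{2,1}>\dots>y_{2,d}$. (2) Compare the multidegrees $\mathrm{mdeg}_1$, where $\mathrm{mdeg}_1(T_{\alpha,\beta})=\mathbf{e}_\alpha+\mathbf{e}_\beta$, $\mathrm{mdeg}_1(y_{1,\alpha})=\mathbf{e}_\alpha$, $\mathrm{mdeg}_1(y_{2,\alpha})=\mathbf{0}$, $\mathrm{mdeg}_1(x_\alpha)=\mathbf{e}_{\alpha+d}$, by the graded reverse-lexicographic order on $\mathbb{N}^{c+1}$ induced by $\mathbf{e}_{c+1}>\mathbf{e}_c>\dots>\mathbf{e}_1$. (3) Compare the multidegrees $\mathrm{mdeg}_2$, where $\mathrm{mdeg}_2(T_{\alpha,\beta})=\mathbf{e}_\alpha$ and $\mathrm{mdeg}_2(y_{1,\alpha})=\mathrm{mdeg}_2(y_{2,\alpha})=\mathrm{mdeg}_2(x_\alpha)=\mathbf{0}$, by the graded reverse-lexicographic order induced by $\mathbf{e}_1>\mathbf{e}_2>\dots>\mathbf{e}_{c+1}$. (4) Compare by the lexicographic order induced by $y_{2,1}>\dots>y_{2,d}>y_{1,1}>\dots>y_{1,d}>x_1>T_{\alpha,\beta}>x_2>\dots>x_e$ for all $\alpha,\beta$, where $T_{1,2}>T_{1,3}>\dots>T_{1,c+1}>T_{2,3}>\dots>T_{c,c+1}$.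 *)

(* Defs.v *)
From HB Require Import structures.
From mathcomp Require Import all_boot all_order all_algebra.
From mathcomp Require Import mpoly.

Set Implicit Arguments.
Unset Strict Implicit.
Unset Printing Implicit Defensive.

Import Order.TTheory GRing.Theory.
Local Open Scope ring_scope.

Section Groebner.
Variables (n : nat) (K : fieldType).
Implicit Types (lt : rel 'X_{1..n}) (A G I : {mpoly K[n]} -> Prop).

(* [lt] is the strict order *)
Definition monomial_order lt : Prop :=
  [/\ irreflexive lt, transitive lt,
      forall m1 m2, m1 != m2 -> lt m1 m2 || lt m2 m1,
      forall m m1 m2, lt m1 m2 -> lt (m1 + m)%MM (m2 + m)%MM
    & forall m, m != 0%MM -> lt 0%MM m].

Definition is_lead lt (p : {mpoly K[n]}) (m : 'X_{1..n}) : Prop :=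
  m \in msupp p /\ forall m', m' \in msupp p -> m' != m -> lt m' m.

Definition ideal_gen A (p : {mpoly K[n]}) : Prop :=
  exists s : seq ({mpoly K[n]} * {mpoly K[n]}),
    (forall qa, qa \in s -> A qa.2) /\ p = \sum_(qa <- s) qa.1 * qa.2.

Definition lead_monomials lt A (q : {mpoly K[n]}) : Prop :=
  exists f m, [/\ A f, is_lead lt f m & q = 'X_[m]].

Definition initial_ideal lt A := ideal_gen (lead_monomials lt A).

Definition groebner_basis lt G I : Prop :=
  (forall g, G g -> I g) /\
  (forall p, initial_ideal lt I p <-> initial_ideal lt G p).

End Groebner.

(* Indices are 0-based throughout: column [a : 'I_(d + e)] is the column of
   number [a + 1] of the matrix, so that c + 1 = d + e. *)

Section Rees.
Variables (K : fieldType) (d e : nat).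

Definition Svar : finType := ('I_d + 'I_d + 'I_e)%type.
Definition y1v (j : 'I_d) : Svar := inl (inl j).
Definition y2v (j : 'I_d) : Svar := inl (inr j).
Definition xv (j : 'I_e) : Svar := inr j.

Definition Tvar : finType :=
  {ab : 'I_(d + e) * 'I_(d + e) | (ab.1 < ab.2)%N}.

Definition Pvar : finType := (Svar + Tvar)%type.

Definition Sring := {mpoly K[#|Svar|]}.
Definition Pring := {mpoly K[#|Pvar|]}.

Definition varS (v : Svar) : Sring := 'X_(enum_rank v).
Definition varP (v : Pvar) : Pring := 'X_(enum_rank v).

(* the value 0 for [k >= e] is the last entry of the second row *)
Definition xS (k : nat) : Sring := oapp (varS \o xv) 0 (insub k).

Definition Lmx : 'M[Sring]_(2, d + e) :=
  \matrix_(i, j) match split j with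
                 | inl k => varS (if i == 0 then y1v k else y2v k)
                 | inr k => xS (i + k)%N
                 end.

Definition minorL (a b : 'I_(d + e)) : Sring :=
  \det (colsub (tnth [tuple a; b]) Lmx).

(* the variable of [{poly Sring}] is the Rees variable tau *)
Inductive rees_algebra : {poly Sring} -> Prop :=
| rees_const s : rees_algebra s%:P
| rees_gen (a b : 'I_(d + e)) : (a < b)%N -> rees_algebra (minorL a b *: 'X)
| rees_add p q : rees_algebra p -> rees_algebra q -> rees_algebra (p + q)
| rees_mul p q : rees_algebra p -> rees_algebra q -> rees_algebra (p * q).

Lemma rees_algebra_sum (I : Type) (r : seq I) (F : I -> {poly Sring}) :
  (forall i, rees_algebra (F i)) -> rees_algebra (\sum_(i <- r) F i).
Proof.
move=> hF; elim: r => [|i r IH]; rewrite ?big_nil ?big_cons.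
  by rewrite -polyC0; apply: rees_const.
exact: rees_add.
Qed.

Lemma rees_algebra_prod (I : Type) (r : seq I) (F : I -> {poly Sring}) :
  (forall i, rees_algebra (F i)) -> rees_algebra (\prod_(i <- r) F i).
Proof.
move=> hF; elim: r => [|i r IH]; rewrite ?big_nil ?big_cons.
  by rewrite -polyC1; apply: rees_const.
exact: rees_mul.
Qed.

Definition piR_var (v : Pvar) : {poly Sring} :=
  match v with
  | inl s => (varS s)%:P
  | inr t => minorL (val t).1 (val t).2 *: 'X
  end.

Definition piR : Pring -> {poly Sring} :=
  mmap (polyC \o @mpolyC #|Svar| K) (piR_var \o enum_val).

Definition ker_piR (p : Pring) : Prop := piR p = 0.

Definition SinP : Sring -> Pring :=
  mmap (@mpolyC #|Pvar| K) (fun i => varP (inl (enum_val i))).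

Lemma piR_SinP s : piR (SinP s) = s%:P.
Proof.
rewrite [RHS](_ : _ = polyC (\sum_(m <- msupp s) s@_m *: 'X_[m])); last first.
  by rewrite -mpolyE.
rewrite /piR /SinP [X in mmap _ _ X]/mmap !raddf_sum; apply: eq_bigr => m _ /=.
rewrite rmorphM /= mmapC /= -mul_mpolyC polyCM; congr (_ * _).
rewrite /mmap1 rmorph_prod /= mpolyXE_id rmorph_prod; apply: eq_bigr => i _.
rewrite !rmorphXn /=; congr (_ ^+ _).
by rewrite mmapX mmap1U /= enum_rankK /= /varS enum_valK.
Qed.

Lemma piR_T (a b : 'I_(d + e)) (ab : (a < b)%N) :
  piR (varP (inr (exist _ (a, b) ab))) = minorL a b *: 'X.
Proof. by rewrite /piR mmapX mmap1U /= enum_rankK. Qed.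

(* [piR] corestricts to a surjection onto the Rees algebra *)
Lemma piR_image q : rees_algebra q <-> exists p, piR p = q.
Proof.
split.
  elim=> {q} [s|a b ab|p q _ [p' <-] _ [q' <-]|p q _ [p' <-] _ [q' <-]].
  - by exists (SinP s); apply: piR_SinP.
  - by eexists; apply: (piR_T ab).
  - by exists (p' + q'); rewrite /piR raddfD.
  - by exists (p' * q'); rewrite /piR rmorphM.
case=> p <-; apply: rees_algebra_sum => m; apply: rees_mul.
  exact: rees_const.
apply: rees_algebra_prod => i; elim: (m i) => [|k IH].
  by rewrite expr0 -polyC1; apply: rees_const.
rewrite exprS; apply: rees_mul => //=.
by case: (enum_val i) => [s|[[a b] ab]] /=; [apply: rees_const|apply: rees_gen].
Qed.

(* only meaningful for [a < b] *)
Definition T (a b : 'I_(d + e)) : Pring := oapp (varP \o inr) 0 (insub (a, b)).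

Definition EN (i : 'I_2) (a b g : 'I_(d + e)) : Pring :=
  SinP (Lmx i a) * T b g - SinP (Lmx i b) * T a g + SinP (Lmx i g) * T a b.
Definition UEN := EN 0.
Definition LEN := EN 1.

Definition PLU (a b g h : 'I_(d + e)) : Pring :=
  T a b * T g h - T a g * T b h + T a h * T b g.

(* [ordS] is cyclic, but it is only applied below the last column *)
Definition LAP (a b g h : 'I_(d + e)) : Pring :=
  T a b * T (ordS g) (ordS h) - T a g * T (ordS b) (ordS h)
  + T a h * T (ordS b) (ordS g) + T b g * T (ordS a) (ordS h)
  - T b h * T (ordS a) (ordS g) + T g h * T (ordS a) (ordS b).

Definition LAP_last (a b g h : 'I_(d + e)) : Pring :=
  T a h * T (ordS b) (ordS g) - T b h * T (ordS a) (ordS g)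
  + T g h * T (ordS a) (ordS b).

Inductive rees_relation : Pring -> Prop :=
| rel_UEN (a b g : 'I_(d + e)) : (a < b < g)%N -> rees_relation (UEN a b g)
| rel_LEN (a b g : 'I_(d + e)) : (a < b < g)%N -> rees_relation (LEN a b g)
| rel_PLU (a b g h : 'I_(d + e)) :
    (a < b < g)%N -> (g < h)%N -> rees_relation (PLU a b g h)
| rel_LAP (a b g h : 'I_(d + e)) :
    (d <= a)%N -> (a < b < g)%N -> (g < h)%N -> (h.+1 < d + e)%N ->
    rees_relation (LAP a b g h)
| rel_LAP_last (a b g h : 'I_(d + e)) :
    (d <= a)%N -> (a < b < g)%N -> (g < h)%N -> h.+1 = (d + e)%N ->
    rees_relation (LAP_last a b g h).

(* Both orders compare exponent sequences of equal length, listed from the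
   largest to the smallest variable. *)
Definition lex_lt (s t : seq nat) : bool := ((s : seqlexi nat) < t)%O.
Definition grevlex_lt (s t : seq nat) : bool :=
  (sumn s < sumn t)%N || (sumn s == sumn t) && lex_lt (rev t) (rev s).

Implicit Type m : 'X_{1..#|Pvar|}.

Definition exps m (vs : seq Pvar) : seq nat := [seq m (enum_rank v) | v <- vs].

Definition y2_vars : seq Pvar := [seq inl (y2v j) | j <- enum 'I_d].
Definition y1_vars : seq Pvar := [seq inl (y1v j) | j <- enum 'I_d].
Definition x_vars : seq Pvar := [seq inl (xv j) | j <- enum 'I_e].
(* the pairs are listed row by row, and [insub] discards those with [b <= a] *)
Definition T_vars : seq Pvar :=
  [seq inr t | t <- pmap insub [seq (a, b) | a <- enum 'I_(d + e),
                                             b <- enum 'I_(d + e)]].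

Definition all_vars : seq Pvar :=
  y2_vars ++ y1_vars ++ take 1 x_vars ++ T_vars ++ drop 1 x_vars.

Definition wt1 (v : Pvar) (i : 'I_(d + e)) : nat :=
  match v with
  | inl (inl (inl j)) => i == lshift e j
  | inl (inl (inr j)) => 0%N
  | inl (inr j) => i == rshift d j
  | inr t => ((i == (val t).1) + (i == (val t).2))%N
  end.

Definition wt2 (v : Pvar) (i : 'I_(d + e)) : nat :=
  match v with
  | inl _ => 0%N
  | inr t => i == (val t).1
  end.

Definition multideg (wt : Pvar -> 'I_(d + e) -> nat) m : seq nat :=
  [seq (\sum_(v : Pvar) m (enum_rank v) * wt v i)%N | i <- enum 'I_(d + e)].
Definition mdeg1 := multideg wt1.
Definition mdeg2 := multideg wt2.

Definition mono_lt m m' : bool :=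
  if exps m y2_vars != exps m' y2_vars then
    lex_lt (exps m y2_vars) (exps m' y2_vars)
  else if mdeg1 m != mdeg1 m' then grevlex_lt (rev (mdeg1 m)) (rev (mdeg1 m'))
  else if mdeg2 m != mdeg2 m' then grevlex_lt (mdeg2 m) (mdeg2 m')
  else lex_lt (exps m all_vars) (exps m' all_vars).

Section LexKeys.
Variables (M : Type) (add : M -> M -> M) (I : Type) (g : I -> M -> nat).
Hypothesis gD : forall i a b, g i (add a b) = (g i a + g i b)%N.
Variables (z : M) (g0 : forall i, g i z = 0%N).
Let key s a := [seq g i a | i <- s].

Lemma lex_ltD s a b c :
  lex_lt (key s (add a c)) (key s (add b c)) = lex_lt (key s a) (key s b).
Proof.
elim: s => [|i s IH] //; move: IH; rewrite /lex_lt /= !ltxi_cons => ->.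
by rewrite !gD !leEnat !leq_add2r.
Qed.

Lemma keyD s a b c :
  (key s (add a c) == key s (add b c)) = (key s a == key s b).
Proof. by elim: s => [|i s IH] //=; rewrite !eqseq_cons IH !gD eqn_add2r. Qed.

Lemma sumn_keyD s a c :
  sumn (key s (add a c)) = (sumn (key s a) + sumn (key s c))%N.
Proof. by elim: s => [|i s IH] //=; rewrite IH gD addnACA. Qed.

Lemma grevlex_ltD s a b c :
  grevlex_lt (key s (add a c)) (key s (add b c))
    = grevlex_lt (key s a) (key s b).
Proof.
by rewrite /grevlex_lt !sumn_keyD ltn_add2r eqn_add2r -!map_rev lex_ltD.
Qed.

Lemma lex_lt0 s a : key s z != key s a -> lex_lt (key s z) (key s a).
Proof.
elim: s => [|i s IH] //; move: IH; rewrite /lex_lt /= ltxi_cons g0 eqseq_cons.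
by case: (g i a) => [|k] //= IH nz; rewrite lexx IH.
Qed.

Lemma sumn_key0 s : sumn (key s z) = 0%N.
Proof. by elim: s => //= i s ->; rewrite g0. Qed.

Lemma grevlex_lt0 s a : key s z != key s a -> grevlex_lt (key s z) (key s a).
Proof.
move=> nz; rewrite /grevlex_lt sumn_key0 lt0n.
suff -> : sumn (key s a) != 0%N by [].
apply: contraNneq nz => sa0; apply/eqP.
elim: s sa0 => //= i s IH /eqP; rewrite addn_eq0 => /andP[/eqP ga /eqP sa].
by rewrite g0 ga IH.
Qed.

End LexKeys.

Lemma lex_lt_irr : irreflexive lex_lt.
Proof. by move=> s; apply: ltxx. Qed.

Lemma lex_lt_trans : transitive lex_lt.
Proof. by move=> s t u; apply: lt_trans. Qed.

Lemma lex_lt_total s t : s != t -> lex_lt s t || lex_lt t s.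
Proof. by move=> st; rewrite /lex_lt -neq_lt. Qed.

Lemma grevlex_lt_irr : irreflexive grevlex_lt.
Proof. by move=> s; rewrite /grevlex_lt ltnn lex_lt_irr andbF. Qed.

Lemma grevlex_lt_trans : transitive grevlex_lt.
Proof.
move=> t s u /orP[st|/andP[/eqP st ts]] /orP[tu|/andP[/eqP tu ut]].
- by rewrite /grevlex_lt (ltn_trans st tu).
- by rewrite /grevlex_lt -tu st.
- by rewrite /grevlex_lt st tu.
- by rewrite /grevlex_lt st tu eqxx (lex_lt_trans ut ts) orbT.
Qed.

Lemma grevlex_lt_total s t : s != t -> grevlex_lt s t || grevlex_lt t s.
Proof.
move=> st; rewrite /grevlex_lt; case: (ltngtP (sumn s) (sumn t)) => //= _.
by apply: lex_lt_total; rewrite (inj_eq (can_inj revK)) eq_sym.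
Qed.

Lemma monomial_order_keyed n (f : 'X_{1..n} -> seq nat) (lt : rel (seq nat))
    (R : rel 'X_{1..n}) :
    irreflexive lt -> transitive lt ->
    (forall s t, s != t -> lt s t || lt t s) ->
    (forall a b c, lt (f (a + c)%MM) (f (b + c)%MM) = lt (f a) (f b)) ->
    (forall a b c, (f (a + c)%MM == f (b + c)%MM) = (f a == f b)) ->
    (forall a, f 0%MM != f a -> lt (f 0%MM) (f a)) ->
    monomial_order R ->
  monomial_order (fun a b => if f a != f b then lt (f a) (f b) else R a b).
Proof.
move=> irr tr tot ltD fD lt0 [Rirr Rtr Rtot RD R0]; split.
- by move=> a; rewrite eqxx Rirr.
- move=> b a c.
  have [->|ab] := eqVneq (f a) (f b); have [bc|bc] := eqVneq (f b) (f c) => //=.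
  + exact: Rtr.
  + by move: ab; rewrite bc => -> + _.
  + move=> ltab ltbc; have ltac := tr _ _ _ ltab ltbc.
    by case: eqP => // e1; rewrite e1 irr in ltac.
- move=> a b; rewrite [f b == _]eq_sym.
  by case: (eqVneq (f a) (f b)) => [_|fab _] /=; [apply: Rtot|apply: tot].
- by move=> c a b; rewrite fD ltD; case: eqVneq => // _; apply: RD.
- by move=> a nz; case: (eqVneq (f 0%MM) (f a)) => [_|]; [apply: R0|apply: lt0].
Qed.

Lemma mem_all_vars v : v \in all_vars.
Proof.
suff: v \in y2_vars ++ y1_vars ++ x_vars ++ T_vars.
  rewrite /all_vars -{1}(cat_take_drop 1 x_vars) !mem_cat.
  by case/or4P => [|->|/orP[]->|->] => [->|||| ]; rewrite ?orbT.
case: v => [[[j|j]|j]|t]; rewrite !mem_cat.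
- by apply/or4P/Or42; rewrite map_f // mem_enum.
- by apply/or4P/Or41; rewrite map_f // mem_enum.
- by apply/or4P/Or43; rewrite map_f // mem_enum.
- apply/or4P/Or44; rewrite map_f // mem_pmap_sub.
  case: t => [[a b] ab] /=; apply: allpairs_f; exact: mem_enum.
Qed.

Lemma mono_lt_monomial_order : monomial_order mono_lt.
Proof.
have expD (v : Pvar) m1 m2 : ((m1 + m2)%MM (enum_rank v)
    = m1 (enum_rank v) + m2 (enum_rank v))%N by rewrite mnmDE.
have exp0 (v : Pvar) : (0%MM : 'X_{1..#|Pvar|}) (enum_rank v) = 0%N.
  by rewrite mnm0E.
pose w (wt : Pvar -> 'I_(d + e) -> nat) i m := (\sum_(v : Pvar) m (enum_rank v) * wt v i)%N.
have wD wt (i : 'I_(d + e)) m1 m2 :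
    (w wt i (m1 + m2)%MM = w wt i m1 + w wt i m2)%N.
  by rewrite /w -big_split; apply: eq_bigr => v _; rewrite mnmDE mulnDl.
have w0 wt (i : 'I_(d + e)) : w wt i 0%MM = 0%N.
  by rewrite /w big1 // => v _; rewrite mnm0E.
have mdeg1E m : rev (mdeg1 m) = [seq w wt1 i m | i <- rev (enum 'I_(d + e))].
  by rewrite map_rev.
have := @monomial_order_keyed _ (fun m => rev (mdeg1 m)) grevlex_lt.
have := @monomial_order_keyed _ mdeg2 grevlex_lt.
have := @monomial_order_keyed _ (exps^~ y2_vars) lex_lt.
have revE m m' : (mdeg1 m != mdeg1 m') = (rev (mdeg1 m) != rev (mdeg1 m')).
  by rewrite (inj_eq (can_inj revK)).
have inj m m' : m != m' -> exps m all_vars != exps m' all_vars.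
  apply: contraNneq => /eq_in_map eqm; apply/eqP/mnmP => i.
  by have := eqm (enum_val i) (mem_all_vars _); rewrite enum_valK.
have lastP : monomial_order
    (fun m m' => lex_lt (exps m all_vars) (exps m' all_vars)).
  split.
  - by move=> m; apply: lex_lt_irr.
  - by move=> b a c; apply: lex_lt_trans.
  - by move=> a b /inj; apply: lex_lt_total.
  - move=> c a b.
    by rewrite /exps -(lex_ltD (g := fun v m => m (enum_rank v)) expD _ _ _ c).
  - move=> m; rewrite eq_sym => /inj.
    exact: (lex_lt0 (g := fun v m => m (enum_rank v)) exp0).
move=> H1 H3 H2.
have {}H3 := H3 _ grevlex_lt_irr grevlex_lt_trans grevlex_lt_total
  (grevlex_ltD (wD wt2) _) (keyD (wD wt2) _) (grevlex_lt0 (w0 wt2) (s := _)) lastP.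
have k1D a b c : grevlex_lt (rev (mdeg1 (a + c)%MM)) (rev (mdeg1 (b + c)%MM))
    = grevlex_lt (rev (mdeg1 a)) (rev (mdeg1 b)).
  by rewrite !mdeg1E (grevlex_ltD (wD wt1)).
have k1E a b c : (rev (mdeg1 (a + c)%MM) == rev (mdeg1 (b + c)%MM))
    = (rev (mdeg1 a) == rev (mdeg1 b)).
  by rewrite !mdeg1E (keyD (wD wt1)).
have k10 a : rev (mdeg1 0%MM) != rev (mdeg1 a) ->
    grevlex_lt (rev (mdeg1 0%MM)) (rev (mdeg1 a)).
  by rewrite !mdeg1E; apply: (grevlex_lt0 (w0 wt1)).
have {}H2 := H2 _ grevlex_lt_irr grevlex_lt_trans grevlex_lt_total
  k1D k1E k10 H3.
have {}H1 := H1 _ lex_lt_irr lex_lt_trans lex_lt_total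
  (lex_ltD (g := fun v m => m (enum_rank v)) expD _)
  (keyD (g := fun v m => m (enum_rank v)) expD _)
  (lex_lt0 (g := fun v m => m (enum_rank v)) exp0 (s := _)) H2.
case: H1 => irr tr tot ltD lt0.
split=> [m|b a c|a b|c a b|m]; rewrite /mono_lt ?revE.
- exact: irr.
- exact: tr.
- exact: tot.
- exact: ltD.
- exact: lt0.
Qed.

End Rees.

(* Main.v *)
Require Import Defs.
From mathcomp Require Import all_boot all_order all_algebra.
From mathcomp Require Import mpoly.
From mathcomp Require Import zify ring.
From Stdlib Require Import Classical.

(* Division by the listed leading monomials reduces the theorem to the linear
   independence of the images of the standard monomials, those divisible by no
   leading monomial.  The initial terms of these images are not distinct, so
   independence is obtained by counting.

   Prepending a column (y_{1,0}, y_{2,0}) to the matrix that no standard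
   monomial uses, and setting tau = 1 and y_{1,0} = 1, every T_{0,p} becomes,
   after the triangular substitution [eval], a single letter (a variable, or an
   element whose leading term is - y_{2,0}^e x_0).  Fix the degree k in the T
   variables and a bound on a weight for which all relations are homogeneous.
   The standard monomials free of y_{1,0} inject, preserving the weight, into
   the monomials in the letters containing at least k letters that are images
   of some T_{0,p} ([img_mnm]).  Each monomial of the latter kind is, up to
   terms of lower degree in x_0, the image of a polynomial of T-degree k, hence
   by division a combination of images of standard monomials.  So the images of
   the finitely many standard monomials span at least as many independent
   elements as there are standard monomials, and are independent. *)

(** The injection [img_mnm] rests on bookkeeping by weight. The weight of a monomial is that of its
    column content plus one unit for each y_{2,p} and each T_{a,b}, the unit of T_{a,b} being
    charged to column a. A unit may travel to later columns: meeting content of a y column p it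
    yields y_{2,p}, the letter of T_{0,p}; a unit that reaches the x columns either becomes a factor
    y_{2,0} or pays for moving x_i to x_{i+1}, the letter of T_{0,d+i}.

    The obstacle is to invert this. Noncrossing arcs are determined by the numbers of starts and
    ends in each column, and these by the total column content, because standardness puts the
    supports of the different contributions in a fixed order. But when arcs start in the x columns,
    several configurations have the same content beyond the first two x columns. Weight and degree
    then fix the exponents of those two columns in terms of that of y_{2,0}, which is thus the one
    free choice ([level]) and has to tell these configurations apart. *)

Set Implicit Arguments.
Unset Strict Implicit.
Unset Printing Implicit Defensive.

(** * Reconstruction from marginals *)

Lemma ord_sum_gt0 n (f : nat -> nat) :
  0 < \sum_(c < n) f c -> exists2 c, c < n & 0 < f c.
Proof.
rewrite lt0n sum_nat_eq0 negb_forall => /existsP[c]; rewrite implyTb -lt0n => fc.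
by exists c.
Qed.

Lemma ord_sum_ge n (f : nat -> nat) c : c < n -> f c <= \sum_(c < n) f c.
Proof. by move=> cn; rewrite (bigD1 (Ordinal cn)) //= leq_addr. Qed.

Lemma ord_sum_eq0 n (f : nat -> nat) :
  (forall c, c < n -> f c = 0) -> \sum_(c < n) f c = 0.
Proof. by move=> f0; rewrite big1 // => c _; apply: f0. Qed.

(** The order condition makes [A] the initial part of [A + B], cut off where the total of [A] is
    reached, so nothing is left to choose. *)
Lemma sections_unique n (A B A' B' : nat -> nat) :
    (forall c, c < n -> A c + B c = A' c + B' c) ->
    \sum_(c < n) A c = \sum_(c < n) A' c ->
    (forall x y, 0 < A x -> 0 < B y -> x <= y) ->
    (forall x y, 0 < A' x -> 0 < B' y -> x <= y) ->
  forall c, c < n -> A c = A' c.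
Proof.
move=> AB sA oA oA'.
have wit (F F' : nat -> nat) : \sum_(c < n) F c = \sum_(c < n) F' c ->
    forall c, c < n -> F c < F' c -> exists2 c', c' < n & F' c' < F c'.
  move=> sF c cn ltF.
  case: (boolP [exists c' : 'I_n, F' c' < F c']) => [/existsP[c' ?]|].
    by exists c'.
  rewrite negb_exists => /forallP le.
  suff: \sum_(c < n) F c < \sum_(c < n) F' c by rewrite sF ltnn.
  rewrite (bigD1 (Ordinal cn)) //= [X in _ < X](bigD1 (Ordinal cn)) //=.
  rewrite -addSn leq_add // leq_sum // => i _; rewrite leqNgt; exact: le.
have absurd (F G F' G' : nat -> nat) :
    (forall c, c < n -> F c + G c = F' c + G' c) ->
    \sum_(c < n) F c = \sum_(c < n) F' c ->
    (forall x y, 0 < F x -> 0 < G y -> x <= y) ->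
    (forall x y, 0 < F' x -> 0 < G' y -> x <= y) ->
    forall c, c < n -> F' c <= F c.
  (* A column where [F] is too small forces, by equal totals, one where it is too large; the two
     order conditions then place each of these columns weakly before the other. *)
  move=> FG sF oF oF' c cn; rewrite leqNgt; apply/negP => lt.
  have [c' c'n lt'] := wit _ _ sF _ cn lt.
  have e1 := FG _ cn; have e2 := FG _ c'n.
  have h1 : c' <= c by apply: oF; lia.
  have h2 : c <= c' by apply: oF'; lia.
  by have E : c = c' by [lia]; subst c'; lia.
move=> c cn; apply/eqP; rewrite eqn_leq; apply/andP; split.
  by apply: (absurd A' B' A B) => // c' c'n; rewrite AB.
exact: (absurd A B A' B').
Qed.

Definition noncrossing (t : nat -> nat -> nat) :=
  forall a b g h, a < b -> b < g -> g < h -> 0 < t a g -> t b h = 0.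

Definition arcs_on N (t : nat -> nat -> nat) :=
  forall a b, ~~ (a < b < N) -> t a b = 0.

(** This is bracket matching: the last start must be joined to the nearest possible end. That arc is
    common to [t] and [t']; remove one copy and induct on the number of arcs. *)
Lemma noncrossing_unique N (t t' : nat -> nat -> nat) :
    arcs_on N t -> arcs_on N t' -> noncrossing t -> noncrossing t' ->
    (forall a, a < N -> \sum_(b < N) t a b = \sum_(b < N) t' a b) ->
    (forall b, b < N -> \sum_(a < N) t a b = \sum_(a < N) t' a b) ->
  forall a b, t a b = t' a b.
Proof.
move: {2}(\sum_(a < N) \sum_(b < N) t a b).+1 (ltnSn (\sum_(a < N) \sum_(b < N) t a b)) => s.
elim: s t t' => // s IH t t' les on on' nc nc' rows cols.
have pos (u : nat -> nat -> nat) a b : arcs_on N u -> 0 < u a b -> a < b < N.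
  by move=> onu; case: (boolP (a < b < N)) => // /onu ->.
have [[a0 ta0]|noa] : (exists a, 0 < \sum_(b < N) t a b) \/ forall a, \sum_(b < N) t a b = 0.
  case: (boolP [exists a : 'I_N, 0 < \sum_(b < N) t a b]) => [/existsP[a]|]; first by left; exists a.
  rewrite negb_exists => /forallP h; right=> a.
  case: (ltnP a N) => aN; first by apply/eqP; have := h (Ordinal aN); rewrite -leqNgt leqn0.
  by apply: ord_sum_eq0 => b bN; apply: on; lia.
  2: { have z (u : nat -> nat -> nat) : (forall a, \sum_(b < N) u a b = 0) -> arcs_on N u ->
      forall a b, u a b = 0.
      move=> u0 onu a b; case: (ltnP b N) => bN; last by apply: onu; lia.
      by apply/eqP; rewrite -leqn0 -(u0 a) (ord_sum_ge (u a)).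
    have z' a : \sum_(b < N) t' a b = 0.
      case: (ltnP a N) => aN; first by rewrite -rows // noa.
      by apply: ord_sum_eq0 => b bN; apply: on'; lia.
    by move=> a b; rewrite (z t) // (z t'). }
have rowN (u : nat -> nat -> nat) a : arcs_on N u -> 0 < \sum_(b < N) u a b -> a < N.
  by move=> onu /ord_sum_gt0[b _ /(pos _ _ _ onu)]; lia.
have exa : exists a, 0 < \sum_(b < N) t a b by exists a0.
have ubnd a : 0 < \sum_(b < N) t a b -> a <= N by move/(rowN _ _ on); lia.
case: (ex_maxnP exa ubnd) => a ta amax {a0 ta0 exa}.
have aN := rowN _ _ on ta.
have amax' a1 b1 : 0 < t' a1 b1 -> a1 <= a.
  move=> h; have /andP[h1 h2] := pos _ _ _ on' h; apply: amax; rewrite rows //; last lia.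
  by apply: leq_trans h _; apply: (ord_sum_ge (t' a1)).
have {}amax a1 b1 : 0 < t a1 b1 -> a1 <= a.
  move=> h; have /andP[h1 h2] := pos _ _ _ on h; apply: amax.
  by apply: leq_trans h _; apply: (ord_sum_ge (t a1)).
have ta' : 0 < \sum_(b < N) t' a b by rewrite -rows.
have mn (u : nat -> nat -> nat) : 0 < \sum_(b < N) u a b ->
    exists2 b, 0 < u a b & forall b', 0 < u a b' -> b <= b'.
  move=> /ord_sum_gt0[b _ ub]; have ex : exists b, 0 < u a b by exists b.
  by case: (ex_minnP ex) => b' ? h; exists b'.
have [b tb bmin] := mn _ ta; have [b' tb' bmin'] := mn _ ta'.
(* If [c < c'], the column sum at [c] gives [u'] an arc ending at [c]. It starts before [a], because
   [a] is the last start and [c'] its nearest end, and so it crosses the arc from [a] to [c']. *)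
have step (u u' : nat -> nat -> nat) (c c' : nat) : arcs_on N u -> arcs_on N u' -> noncrossing u' ->
   (forall b, b < N -> \sum_(a < N) u a b = \sum_(a < N) u' a b) ->
   (forall a1 b1, 0 < u' a1 b1 -> a1 <= a) ->
   0 < u a c -> 0 < u' a c' -> (forall b', 0 < u' a b' -> c' <= b') -> c' <= c.
  move=> onu onu' ncu' cu mxu' uc uc' mnc'; rewrite leqNgt; apply/negP => cc'.
  have /andP[ac cN] := pos _ _ _ onu uc.
  have : 0 < \sum_(a < N) u' a c.
    by rewrite -cu //; apply: leq_trans uc _; apply: (ord_sum_ge (u^~ c)).
  case/(@ord_sum_gt0 _ (u'^~ c)) => a1 _ ua1; have := mxu' _ _ ua1; rewrite leq_eqVlt => /orP[/eqP E|a1a].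
    by move: ua1; rewrite E => /mnc'; lia.
  by move: uc'; rewrite (ncu' a1 a c c') //.
have Eb : b = b'.
  apply/eqP; rewrite eqn_leq; apply/andP; split.
    by apply: (step t' t) => //; move=> *; rewrite cols.
  by apply: (step t t').
subst b'; have /andP[ab bN] := pos _ _ _ on tb.
pose rm (u : nat -> nat -> nat) i j := u i j - (i == a) * (j == b).
have rmle u i j : rm u i j <= u i j by rewrite /rm leq_subr.
have rmE u i j : 0 < u a b -> u i j = rm u i j + (i == a) * (j == b).
  move=> h; rewrite /rm subnK //; case: eqP => [->|]; case: eqP => [->|] //=.
have rmrow u i : 0 < u a b -> \sum_(j < N) u i j = \sum_(j < N) rm u i j + (i == a).
  move=> h; under eq_bigr => j _ do rewrite rmE //.
  rewrite big_split /=; congr (_ + _); rewrite -big_distrr /= (bigD1 (Ordinal bN)) //= eqxx big1 ?muln1 // => j.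
  by rewrite -val_eqE /= => /negPf ->.
have rmcol u j : 0 < u a b -> \sum_(i < N) u i j = \sum_(i < N) rm u i j + (j == b).
  move=> h; under eq_bigr => i _ do rewrite rmE //.
  rewrite big_split /=; congr (_ + _); rewrite -big_distrl /= (bigD1 (Ordinal aN)) //= eqxx big1 ?mul1n // => i.
  by rewrite -val_eqE /= => /negPf ->.
have onrm u : arcs_on N u -> arcs_on N (rm u).
  by move=> onu i j h; apply/eqP; rewrite -leqn0 -(onu _ _ h).
have ncrm u : noncrossing u -> noncrossing (rm u).
  move=> ncu i j g h ij jg gh p; apply/eqP; rewrite -leqn0 -(ncu i j g h) //.
  exact: leq_trans p _.
have := IH (rm t) (rm t'); move/(_ _ (onrm _ on) (onrm _ on') (ncrm _ nc) (ncrm _ nc')) => IH'.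
suff E i j : rm t i j = rm t' i j by move=> i j; rewrite (rmE t) // (rmE t') // E.
apply: IH' => {i j}.
- rewrite -ltnS; apply: leq_trans les; rewrite ltnS.
  rewrite (bigD1 (Ordinal aN)) //= [X in _ < X](bigD1 (Ordinal aN)) //= (rmrow t a) // eqxx addn1 addSn ltnS.
  by rewrite leq_add2l leq_sum // => i _; rewrite leq_sum.
- by move=> i iN; apply/(@addIn (i == a)); rewrite -!rmrow // rows.
- by move=> j jN; apply/(@addIn (j == b)); rewrite -!rmcol // cols.
Qed.

(** * The level function *)

(* The totals describing a configuration with arcs starting at column d or
   beyond; see [raw_of]. *)
Record raw := Raw { g1 : nat; gl : nat; gr : nat; f1 : nat; mm : nat; rr : nat;
  dl : nat; dr : nat; mu2 : nat }.
Definition okraw x :=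
  [/\ 0 < dl x + dr x + rr x,
      (rr x = 0 -> dl x = 0 /\ gl x = 0),
      (0 < mu2 x -> rr x = 0),
      (0 < mm x -> dl x = 0 /\ gl x = 0) &
      [/\ (0 < f1 x -> gl x = 0 /\ gr x = 0), (0 < gl x -> dr x = 0) &
      mu2 x <= mm x + dr x + gr x]].
(** For a configuration, [rg] counts the arcs from a y column to an x column, [rkap] those starting
    in an x column, [rk] the T-degree that the x columns have to supply, [rn] all letters of the x
    columns with an arc counted once per endpoint there, and [rnu] those beyond column d + 1. [rw]
    is the exponent of column d + 1 when that of y_{2,0} is 0; each factor y_{2,0} restored moves
    one letter from column d + 1 back to column d. *)
Definition rg x := g1 x + gl x + gr x.
Definition rkap x := dl x + dr x + rr x.
Definition rk x := rg x + rkap x.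
Definition rn x := rg x + f1 x + mm x + 2 * rkap x.
Definition rnu x := dl x + gl x + 2 * rr x + mm x + dr x + gr x - mu2 x.
Definition rw x := g1 x + gr x + dr x + mu2 x.
(** Since [rn + rg = 2 * rk + f1 + mm], the vanishing of [f1] and [mm] is an equality between the
    other parameters. The resulting loss of one parameter is why [raw_inj] asks for [gl + gr] in
    this family only. *)
Definition tight x := [&& mm x == 0, f1 x == 0 & 0 < rr x].

Definition region (fam : bool) g g2 k n nu w :=
  if fam then [/\ g < k, n + g = 2 * k, g2 <= g, k - g + g2 < nu <= 2 * (k - g) + g2 & g <= w + g2 /\ w + nu <= n + g2]
  else [/\ g < k, g <= w, w + nu <= n + g, 2 * k <= n + g & (k < g + nu \/ 2 * k <= w + g + nu) /\ (n + g = 2 * k -> k <= w)].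

(* The formula has no conceptual meaning: any function with [level_bounds] and
   [level_inj] would do.  It was found by matching small cases. *)
Definition level fam g g2 k n nu w : nat :=
  let b := n - nu in let g0 := 2 * k - n in
  if fam then
    if k < nu then (if w <= b then g - g2 else w - b + (g - g2))
    else k - b - 1 - g2 + (w - b)
  else if 2 * k <= n then
    if (k < nu) || (2 * k <= w + nu) then g
    else if w < k then w - g else k - 1 - g
  else if k < nu then g
  else if n - k < nu then
    if w < k then k - b + g - g0 - 1 else g - (g0 - (w - b))
  else if w < k then w - g
  else if w + nu <= n then k - 1 - g else g - (g0 - (w - b)).

(** [J < k] separates these images from those of configurations without arcs starting in an x
    column. [J <= w] and the last bound keep the exponents of columns d + 1 and d nonnegative. The
    third bound leaves more than [k] letters beyond column d, enough for T-degree [k]. *)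
Lemma level_bounds fam g g2 k n nu w : region fam g g2 k n nu w ->
 let J := level fam g g2 k n nu w in
  [/\ J < k, J <= w, k + J < w + nu & w + nu <= n + J].
Proof.
rewrite /region /level /=; case: fam => [[? ? ? ? [? ?]]|[? ? ? ? [? ?]]];
by do ![case: ifP => ?]; split; lia.
Qed.

(** The image and the T-degree reveal [k], [n] and [nu], and, once [J] is known, also [w]. So [J]
    has to encode the parameters that remain. *)
Lemma level_inj fam g g2 fam' g' g2' k n nu w :
  region fam g g2 k n nu w -> region fam' g' g2' k n nu w ->
  level fam g g2 k n nu w = level fam' g' g2' k n nu w ->
  [/\ fam = fam', g = g' & fam -> g2 = g2'].
Proof.
rewrite /region /level /=; case: fam => [[? ? ? ? [? ?]]|[? ? ? ? [? ?]]];
case: fam' => [[? ? ? ? [? ?]]|[? ? ? ? [? ?]]];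
do ![case: ifP => ?] => ?; split; lia.
Qed.

Lemma raw_region x : okraw x ->
  region (tight x) (rg x) (gl x + gr x) (rk x) (rn x) (rnu x) (rw x).
Proof.
case: x => g1 gl gr f1 m r dl dr mu2 [] /=.
rewrite /region /tight /rw /rnu /rn /rk /rkap /rg /= => H1 H2 H3 H4 [H5 H6 H7].
case: ifP => ?; split; lia.
Qed.

Lemma raw_inj x y : okraw x -> okraw y -> rk x = rk y -> rn x = rn y -> rnu x = rnu y ->
  rw x = rw y -> tight x = tight y -> rg x = rg y -> (tight x -> gl x + gr x = gl y + gr y) -> x = y.
Proof.
move: x y => [g1 gl gr f1 m r dl dr mu2] [g1' gl' gr' f1' m' r' dl' dr' mu2'].
rewrite /okraw /tight /rw /rnu /rn /rk /rkap /rg /=.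
(* Once it is decided which of these totals vanish, the conditional clauses of [okraw] become
   linear, up to a split on [gl]. *)
case: m => [|m]; case: f1 => [|f1]; case: r => [|r] /=;
case: m' => [|m']; case: f1' => [|f1'] //=; case: r' => [|r'] //=.
all: case=> H1 H2 H3 H4 [H5 H6 H7].
all: case=> K1 K2 K3 K4 [K5 K6 K7] E1 E2 E3 E4 E5 E6 E7.
all: try have {}H2 := H2 erefl; try have {}H3 := fun h => H3 h; try have {}H4 := H4 isT; try have {}H5 := H5 isT.
all: try have {}K2 := K2 erefl; try have {}K4 := K4 isT; try have {}K5 := K5 isT.
all: try have {}E7 := E7 isT.
all: try (have {H3} H3 : mu2 = 0 by (case: (mu2) H3 => // ? /(_ isT))).
all: try (have {K3} K3 : mu2' = 0 by (case: (mu2') K3 => // ? /(_ isT))).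
all: rewrite ?H3 ?K3 in H7 K7 E1 E2 E3 E4 *.
all: try (case: H2 => ? ?); try (case: H4 => ? ?); try (case: H5 => ? ?).
all: try (case: K2 => ? ?); try (case: K4 => ? ?); try (case: K5 => ? ?); subst.
all: try discriminate.
all: try by (exfalso; lia).
all: try by (f_equal; lia).
all: case: gl H1 H6 E1 E2 E3 E4 E6 E7 => [|gl] H1 H6 E1 E2 E3 E4 E6 E7; try have {}H6 := H6 isT.
all: case: gl' K1 K6 E1 E2 E3 E4 E6 E7 => [|gl'] K1 K6 E1 E2 E3 E4 E6 E7; try have {}K6 := K6 isT.
all: subst; f_equal; lia.
Qed.

(** * Standard configurations *)

(* The exponents of a monomial: [fo p] of y_{2,p}, [fc c] of the first-row
   variable of column c, [arcs a b] of T_{a,b}. *)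
Record config := Config { fo : nat -> nat; fc : nat -> nat; arcs : nat -> nat -> nat }.

Section Config.
Variables d e : nat.
Local Notation N := (d + e).
Implicit Type x : config.

Definition supported x :=
  [/\ forall p, d <= p -> fo x p = 0, forall p, N <= p -> fc x p = 0 & arcs_on N (arcs x)].

(* The leading monomials avoided are those of UEN (stdU, stdV), of LEN (stdO in
   the columns of y, stdC in those of x), of PLU (stdP) and of LAP (stdL). *)
Record standard x : Prop := Standard {
  stdU : forall a b g, a < b -> b < g -> b <= d -> 0 < fc x b -> arcs x a g = 0;
  stdV : forall a b g, a < b -> b < g -> d < b -> 0 < fc x g -> arcs x a b = 0;
  stdO : forall a b g, a < b -> 0 < fo x a -> arcs x b g = 0;
  stdC : forall a b g, d <= a -> a < b -> 0 < fc x a.+1 -> arcs x b g = 0;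
  stdP : noncrossing (arcs x);
  stdL : forall a b g h, d < a -> b <= g -> g < h -> 0 < arcs x a b -> arcs x g h = 0 }.

Definition starts x a := \sum_(c < N) arcs x a c.
Definition ends x c := \sum_(a < d) arcs x a c.
(** The contributions that carry an extra unit of weight over their column; [mc] collects those that
    do not. *)
Definition mo x p := fo x p + starts x p.
Definition mc x p := fc x p + ends x p.
Definition narcs x := \sum_(a < N) starts x a.

(* Scanning the columns from left to right, the content [mc] of each column is
   matched as far as possible with content [mo] of the columns before it. *)
Fixpoint carry x p :=
  if p is q.+1 then carry x q + mo x q - minn (carry x q) (mc x q) else 0.
Definition taken x p := minn (carry x p) (mc x p).
Definition ntaken x := \sum_(p < d) taken x p.

Definition crossing x p := \sum_(a < p) \sum_(c < N | p <= c) arcs x a c.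

Section One.
Variable x : config.
Hypothesis xs : supported x.
Hypothesis sx : standard x.

Lemma arc_lt a b : 0 < arcs x a b -> a < b < N.
Proof. by case: (boolP (a < b < N)) => // /(let: And3 _ _ h := xs in h a b) ->. Qed.

Lemma carryS p : carry x p.+1 + taken x p = carry x p + mo x p.
Proof. by rewrite /= /taken; lia. Qed.

Lemma ends_small c : c <= d -> ends x c = \sum_(a < c) arcs x a c.
Proof.
move=> cd; rewrite (big_ord_widen _ (arcs x ^~ c) cd) /ends (bigID (fun a : 'I_d => a < c)) /=.
by rewrite [X in _ + X]big1 ?addn0 // => a; case: xs => _ _ h ca; apply: h; lia.
Qed.

Lemma crossingS p : p < d -> crossing x p.+1 + ends x p = crossing x p + starts x p.
Proof.
move=> pd; rewrite /crossing big_ord_recr /=.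
have -> : \sum_(c < N | p < c) arcs x p c = starts x p.
  rewrite /starts [RHS](bigID (fun c : 'I_N => p < c)) /= [X in _ = _ + X]big1 ?addn0 // => c.
  by case: xs => _ _ h cp; apply: h; lia.
rewrite addnAC; congr (_ + _); rewrite ends_small 1?ltnW // -big_split; apply: eq_bigr => a _ /=.
have pN : p < N by lia.
rewrite [RHS](bigD1 (Ordinal pN)) //= addnC; congr (_ + _).
by apply: eq_bigl => c; rewrite -val_eqE /=; lia.
Qed.

(** If the first-row variable of column [p] occurs, UEN forbids arcs passing over [p], so all open
    arcs close there. If it does not occur, [mc x p] consists of ends only. *)
Lemma ends_min p : p <= d -> ends x p = minn (crossing x p) (mc x p).
Proof.
move=> pd; have le : ends x p <= crossing x p.
  rewrite ends_small // leq_sum // => a _.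
  case: (ltnP p N) => pN; last by case: xs => _ _ ->; lia.
  by rewrite (bigD1 (Ordinal pN)) //= leq_addr.
case: (posnP (fc x p)) => [f0|fp].
  by rewrite /mc f0 add0n; apply/esym/minn_idPr.
have E : crossing x p = ends x p.
  rewrite ends_small //; apply: eq_bigr => a _; case: (ltnP p N) => pN; last first.
    case: xs => _ _ h; rewrite h; last lia.
    by rewrite big1 // => c pc; have := ltn_ord c; lia.
  rewrite (bigD1 (Ordinal pN)) //= big1 ?addn0 // => c /andP[pc]; rewrite -val_eqE /= => ne.
  apply: (stdU sx) fp => //; by rewrite ltn_neqAle eq_sym ne.
by rewrite E /mc; apply/esym/minn_idPl; rewrite leq_addl.
Qed.

Lemma crossing0 : crossing x 0 = 0. Proof. by rewrite /crossing big_ord0. Qed.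

End One.
End Config.

(** * Decomposition of the content of the x columns into ordered sections *)

Section Sections.
Variables d e : nat.
Local Notation N := (d + e).
Implicit Type x : config.

(* An arc is inner if it starts after column d.  The arcs from column d (D) and
   those from earlier columns to columns after d (O) are split into left and
   right ones: left if they end at or before some start of an inner arc. *)
Definition inner x a := if d < a then starts d e x a else 0.
Definition lf x c := [exists a : 'I_N, (c <= a) && (0 < inner x a)].
Definition DL x c := if lf x c then arcs x d c else 0.
Definition DR x c := if lf x c then 0 else arcs x d c.
Definition OL x c := if (d < c) && lf x c then ends d x c else 0.
Definition OR x c := if (d < c) && ~~ lf x c then ends d x c else 0.
Definition FX x c := if d < c then fc x c else 0.
Definition Xb x c := \sum_(a < N | d < a) arcs x a c.
(* The left sections and the starts of inner arcs are shifted by one column; the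
   supports of the seven terms are then in weakly increasing order
   ([section_order]). *)
Definition tot x c :=
  DL x c.-1 + (OL x c.-1 + (inner x c.-1 + (FX x c + (Xb x c + (DR x c + OR x c))))).
Definition kap x := starts d e x d + \sum_(a < N) inner x a.

Definition raw_of x := Raw (ends d x d) (\sum_(c < N) OL x c) (\sum_(c < N) OR x c)
  (fc x d) (\sum_(c < N) FX x c) (\sum_(c < N) inner x c)
  (\sum_(c < N) DL x c) (\sum_(c < N) DR x c) (tot x d.+1).

Lemma sum_shift n (f : nat -> nat) : f 0 = 0 -> f n.-1 = 0 ->
  \sum_(c < n) f c.-1 = \sum_(c < n) f c.
Proof.
case: n => [|n] /= f0 fn; first by rewrite !big_ord0.
by rewrite big_ord_recl /= f0 [RHS]big_ord_recr /= fn addn0.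
Qed.

Section One.
Variable x : config.
Hypotheses (xs : supported d e x) (sx : standard d x).
Let alt := arc_lt xs.

Lemma ends_eq0 c : (forall a, a < d -> arcs x a c = 0) -> ends d x c = 0.
Proof. exact: (@ord_sum_eq0 _ (arcs x ^~ c)). Qed.

Lemma endsP c : 0 < ends d x c -> exists2 a, a < d & 0 < arcs x a c.
Proof. exact: (@ord_sum_gt0 _ (arcs x ^~ c)). Qed.

Lemma innerP a : 0 < inner x a -> d < a /\ exists2 b, a < b < N & 0 < arcs x a b.
Proof.
rewrite /inner; case: ifP => // da /ord_sum_gt0[b _ h]; split=> //; exists b => //.
exact: alt.
Qed.

Lemma lfP c : lf x c -> exists a b, [/\ d < a, c <= a, a < b < N & 0 < arcs x a b].
Proof.
by case/existsP=> a /andP[ca /innerP[da [b ab h]]]; exists a, b.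
Qed.

Lemma lfN c a b : ~~ lf x c -> d < a -> 0 < arcs x a b -> a < c.
Proof.
rewrite negb_exists => /forallP h da ab; have /andP[ltab bN] := alt ab.
have aN : a < N by lia.
have := h (Ordinal aN); rewrite /= /inner da negb_and -ltnNge => /orP[] //.
rewrite -eqn0Ngt => /eqP E; have := @ord_sum_ge N (arcs x a) b bN; rewrite -/(starts d e x a) E; lia.
Qed.

(** The Laplace condition excludes disjoint inner arcs, so all inner starts precede all inner
    ends. *)
Lemma inner_pair a b a' b' : d < a -> 0 < arcs x a b -> d < a' -> 0 < arcs x a' b' -> a < b'.
Proof.
move=> da ab da' ab'; rewrite ltnNge; apply/negP => le.
have /andP[lt _] := alt ab; have := stdL sx da' le lt ab'; lia.
Qed.

(** An arc coming from outside and ending strictly within an inner arc would cross it. The same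
    reason gives [O_cross]. *)
Lemma D_cross c a b : d < a -> 0 < arcs x a b -> 0 < arcs x d c -> c <= a \/ b <= c.
Proof.
move=> da ab dc; case: (leqP c a) => ca; first by left.
right; rewrite leqNgt; apply/negP => cb; have := stdP sx da ca cb dc; lia.
Qed.

Lemma O_cross c a b : d < a -> 0 < arcs x a b -> 0 < ends d x c -> c <= a \/ b <= c.
Proof.
move=> da ab /endsP[a' a'd dc]; case: (leqP c a) => ca; first by left.
right; rewrite leqNgt; apply/negP => cb.
have := @stdP _ _ sx a' a c b (ltn_trans a'd da) ca cb dc; lia.
Qed.

(** One inner start at or after [c] puts [c] before all inner ends, by [inner_pair]; the alternative
    [b <= c] is then impossible for every inner arc. *)
Lemma cross_left c a b : (forall a b, d < a -> 0 < arcs x a b -> c <= a \/ b <= c) ->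
  lf x c -> d < a -> 0 < arcs x a b -> c <= a.
Proof.
move=> cr /lfP[a' [b' [da' ca' _ ab']]] da ab; case: (cr _ _ da ab) => // bc.
have := inner_pair da' ab' da ab; lia.
Qed.

Lemma OL_le c a b : 0 < OL x c -> d < a -> 0 < arcs x a b -> c <= a.
Proof.
rewrite /OL; case: ifP => // /andP[_ l] dc; apply: cross_left => // *; exact: O_cross.
Qed.

Lemma DR_ge c a b : 0 < DR x c -> d < a -> 0 < arcs x a b -> b <= c.
Proof.
rewrite /DR; case: ifP => // /negbT l dc da ab; have := lfN l da ab.
by case: (D_cross da ab dc); lia.
Qed.

Lemma OR_ge c a b : 0 < OR x c -> d < a -> 0 < arcs x a b -> b <= c.
Proof.
rewrite /OR; case: ifP => // /andP[_ l] dc da ab; have := lfN l da ab.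
by case: (O_cross da ab dc); lia.
Qed.

(** LEN bounds the column from the left and UEN from the right. The strict left bound is what makes
    the shift of inner starts by one column compatible with the order of the sections. *)
Lemma FX_inner c a b : 0 < FX x c -> d < a -> 0 < arcs x a b -> a < c <= b.
Proof.
rewrite /FX; case: ifP => // dc f da ab; have /andP[ltab bN] := alt ab; apply/andP; split.
  rewrite ltnNge; apply/negP => ca; case: c dc f ca => // c dc f ca.
  have := @stdC _ _ sx c a b; lia.
rewrite leqNgt; apply/negP => bc; have := @stdV _ _ sx a b c ltab bc _ f; lia.
Qed.

Lemma FX_arc c a b : 0 < FX x c -> a <= d -> d < b -> 0 < arcs x a b -> c <= b.
Proof.
rewrite /FX; case: ifP => // dc f ad db ab; rewrite leqNgt; apply/negP => bc.
have := @stdV _ _ sx a b c (leq_ltn_trans ad db) bc db f; lia.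
Qed.

Lemma OD_le c c' : 0 < arcs x d c -> d < c' -> 0 < ends d x c' -> c <= c'.
Proof.
move=> dc dc' /endsP[a ad ac']; rewrite leqNgt; apply/negP => lt.
have := stdP sx ad dc' lt ac'; lia.
Qed.

Lemma Xb_P c : 0 < Xb x c -> exists2 a, d < a & 0 < arcs x a c.
Proof.
rewrite lt0n sum_nat_eq0 negb_forall => /existsP[a]; rewrite negb_imply -lt0n => /andP[].
by exists a.
Qed.

Lemma DL_P c : 0 < DL x c -> lf x c /\ 0 < arcs x d c.
Proof. by rewrite /DL; case: ifP. Qed.
Lemma DR_P c : 0 < DR x c -> ~~ lf x c /\ 0 < arcs x d c.
Proof. by rewrite /DR; case: ifP. Qed.
Lemma OL_P c : 0 < OL x c -> [/\ d < c, lf x c & 0 < ends d x c].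
Proof. by rewrite /OL; case: ifP => // /andP[]. Qed.
Lemma OR_P c : 0 < OR x c -> [/\ d < c, ~~ lf x c & 0 < ends d x c].
Proof. by rewrite /OR; case: ifP => // /andP[]. Qed.
Lemma FX_P c : 0 < FX x c -> d < c /\ 0 < fc x c.
Proof. by rewrite /FX; case: ifP. Qed.

Lemma lf_inner c : lf x c -> 0 < \sum_(a < N) inner x a.
Proof.
case/existsP=> a /andP[_ h]; exact: leq_trans h (ord_sum_ge (inner x) (ltn_ord a)).
Qed.

Lemma inner_lf c : 0 < \sum_(a < N) inner x a -> c <= d.+1 -> lf x c.
Proof.
case/ord_sum_gt0=> a aN h cd; apply/existsP; exists (Ordinal aN) => /=; rewrite h andbT.
by have [da _] := innerP h; lia.
Qed.

Lemma tot_d1 : tot x d.+1 = FX x d.+1 + Xb x d.+1 + (DR x d.+1 + OR x d.+1).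
Proof.
have e1 : DL x d = 0.
  by apply/eqP; rewrite -leqn0 leqNgt; apply/negP => /DL_P[_ /alt]; lia.
have e2 : OL x d = 0 by rewrite /OL ltnn.
have e3 : inner x d = 0 by rewrite /inner ltnn.
by rewrite /tot /= e1 e2 e3 !add0n addnA.
Qed.

Lemma Xb_d1 : Xb x d.+1 = 0.
Proof.
by apply/eqP; rewrite -leqn0 leqNgt; apply/negP => /Xb_P[a da /alt]; lia.
Qed.

Lemma tot_small c : c <= d -> tot x c = 0.
Proof.
move=> cd; apply/eqP; rewrite -leqn0 leqNgt; apply/negP; rewrite /tot !addn_gt0.
case/or4P => [/DL_P[_ /alt]|/OL_P[]|/innerP[]|/or4P[/FX_P[]|/Xb_P[a da /alt]|/DR_P[_ /alt]|/OR_P[]]]; lia.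
Qed.

Lemma D_split : \sum_(c < N) DL x c + \sum_(c < N) DR x c = starts d e x d.
Proof.
rewrite -big_split; apply: eq_bigr => c _ /=.
by rewrite /DL /DR; case: ifP; rewrite ?addn0 ?add0n.
Qed.

Lemma O_split : ends d x d + (\sum_(c < N) OL x c + \sum_(c < N) OR x c)
  = \sum_(c < N | d <= c) ends d x c.
Proof.
rewrite [RHS]big_mkcond /= -big_split /=.
have -> : ends d x d = \sum_(c < N) (c == d :> nat) * ends d x d.
  rewrite -big_distrl /=; case: (posnP e) => [e0|e0].
    rewrite (_ : ends d x d = 0) ?muln0 //; apply: ends_eq0 => a ad.
    by case: xs => _ _ h; apply: h; lia.
  have dN : d < N by lia.
  rewrite (bigD1 (Ordinal dN)) //= eqxx big1 ?mul1n // => c.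
  by rewrite -val_eqE /= => /negPf ->.
rewrite -big_split; apply: eq_bigr => c _ /=; rewrite /OL /OR.
by case: (ltngtP (c : nat) d) => [||->]; case: lf; rewrite ?mul0n ?mul1n ?add0n ?addn0.
Qed.

Lemma okraw_of : 0 < kap x -> okraw (raw_of x).
Proof.
move=> k0; split => /=.
- by rewrite D_split.
- move=> r0; have l c : lf x c = false.
    by case E : (lf x c) => //; have := lf_inner E; rewrite r0.
  by split; apply: ord_sum_eq0 => c _; rewrite /DL /OL l ?andbF.
(* An inner arc makes column d + 1 a left column, which excludes right sections there, and pushes
   the x variables beyond its own start, hence beyond d + 1. *)
- move=> m2; apply/eqP; rewrite -leqn0 leqNgt; apply/negP => r0.
  have l := inner_lf r0 (leqnn _); move: m2; rewrite tot_d1 Xb_d1.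
  rewrite /DR /OR l andbF !addn0 => h; case/ord_sum_gt0: r0 => a aN /innerP[da [b _ ab]].
  by have := FX_inner h da ab; lia.
(* A left arc ends at or before an inner start, hence strictly before the x variable by [FX_inner],
   whereas [FX_arc] wants it to end at or after that variable. *)
- case/ord_sum_gt0=> f fN hf; split; apply: ord_sum_eq0 => c cN; apply/eqP;
    rewrite -leqn0 leqNgt; apply/negP => h.
  + have [l dc] := DL_P h; have [a [b [da ca _ ab]]] := lfP l.
    have := FX_inner hf da ab; have := alt dc; have := FX_arc hf (leqnn d) _ dc; lia.
  + have [d_c l oc] := OL_P h; have [a [b [da ca _ ab]]] := lfP l.
    have [a' a'd ac] := endsP oc.
    have := FX_inner hf da ab; have := FX_arc hf (ltnW a'd) d_c ac; lia.
- split.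
  + move=> f0; have z c : d < c -> ends d x c = 0.
      move=> dc; apply: ends_eq0 => a ad; exact: (stdU sx ad dc (leqnn d) f0).
    by split; apply: ord_sum_eq0 => c _; rewrite /OL /OR; case: ifP => // /andP[/z].
  + case/ord_sum_gt0=> c cN h; apply: ord_sum_eq0 => c' c'N; apply/eqP.
    rewrite -leqn0 leqNgt; apply/negP => h'.
    have [dc l oc] := OL_P h; have [a [b [da _ _ ab]]] := lfP l.
    have [l' dc'] := DR_P h'; have := OL_le h da ab; have := lfN l' da ab.
    have := OD_le dc' dc oc; lia.
  + rewrite tot_d1 Xb_d1; case: (ltnP d.+1 N) => dN; last first.
      rewrite (_ : FX x d.+1 = 0); last by case: xs => _ h _; rewrite /FX ltnSn h.
      rewrite (_ : DR x d.+1 = 0); last by case: xs => _ _ h; rewrite /DR h ?if_same //; lia.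
      rewrite (_ : OR x d.+1 = 0) //; rewrite /OR; case: ifP => // _; apply: ends_eq0 => a _.
      by case: xs => _ _ -> //; lia.
    rewrite addn0 -addnA leq_add ?leq_add //.
    * exact: (ord_sum_ge (FX x)).
    * exact: (ord_sum_ge (DR x)).
    * exact: (ord_sum_ge (OR x)).
Qed.

Lemma lf_last : lf x N.-1 = false.
Proof. by case E : (lf x _) => //; have [a [b [? ? ? ?]]] := lfP E; lia. Qed.

Lemma DL_first : DL x 0 = 0.
Proof. by rewrite /DL; case: ifP => // _; case: xs => _ _ ->; lia. Qed.

Lemma DL_last : DL x N.-1 = 0. Proof. by rewrite /DL lf_last. Qed.
Lemma OL_last : OL x N.-1 = 0. Proof. by rewrite /OL lf_last andbF. Qed.

Lemma inner_last : inner x N.-1 = 0.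
Proof.
rewrite /inner; case: ifP => // _; apply: ord_sum_eq0 => b bN.
by case: xs => _ _ ->; lia.
Qed.

Lemma Xb_sum : \sum_(c < N) Xb x c = \sum_(c < N) inner x c.
Proof.
by rewrite exchange_big /= big_mkcond /=; apply: eq_bigr => a _; rewrite /inner; case: ifP.
Qed.

Lemma tot_sum : \sum_(c < N) tot x c = \sum_(c < N) DL x c + (\sum_(c < N) OL x c +
  (2 * \sum_(c < N) inner x c + (\sum_(c < N) FX x c + (\sum_(c < N) DR x c + \sum_(c < N) OR x c)))).
Proof.
rewrite /tot !big_split /= (sum_shift DL_first DL_last) (@sum_shift N (OL x) _ OL_last) //.
rewrite (@sum_shift N (inner x) _ inner_last) // Xb_sum.
by rewrite mul2n -addnn -!addnA; do 3 congr (_ + _); rewrite addnCA.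
Qed.

Definition section_seq : seq (nat -> nat) := [:: fun c => DL x c.-1; fun c => OL x c.-1;
  fun c => inner x c.-1; FX x; Xb x; DR x; OR x].

Lemma section_order i j u v : i < j < 7 ->
  0 < nth (fun=> 0) section_seq i u -> 0 < nth (fun=> 0) section_seq j v -> u <= v.
Proof.
case: i => [|[|[|[|[|[|[|i]]]]]]] //.
- rewrite /= => + /DL_P[l du]; have [a0 [b0 [da0 ca0 lt0 ab0]]] := lfP l.
  have ou c : d < c -> 0 < ends d x c -> u.-1 <= c by exact: OD_le.
  have ltu := alt du.
  have Lu a b := @cross_left u.-1 a b (fun a b da ab => D_cross da ab du) l.
  case: j => [|[|[|[|[|[|[|j]]]]]]] //= _.
  + by case/OL_P=> dv _ /(ou _ dv); lia.
  + by case/innerP=> dv [b _ /(Lu _ _ dv)]; lia.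
  + by move=> /FX_inner/(_ da0 ab0); lia.
  + by case/Xb_P=> a da h; have := Lu _ _ da h; have := alt h; lia.
  + by move=> /DR_ge/(_ da0 ab0); lia.
  + by move=> /OR_ge/(_ da0 ab0); lia.
- rewrite /= => + /OL_P[du l ou]; have [a0 [b0 [da0 ca0 lt0 ab0]]] := lfP l.
  have Lu a b := @cross_left u.-1 a b (fun a b da ab => O_cross da ab ou) l.
  case: j => [|[|[|[|[|[|[|j]]]]]]] //= _.
  + by case/innerP=> dv [b _ /(Lu _ _ dv)]; lia.
  + by move=> /FX_inner/(_ da0 ab0); lia.
  + by case/Xb_P=> a da h; have := Lu _ _ da h; have := alt h; lia.
  + by move=> /DR_ge/(_ da0 ab0); lia.
  + by move=> /OR_ge/(_ da0 ab0); lia.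
- rewrite /= => + /innerP[du [b ltu hu]].
  case: j => [|[|[|[|[|[|[|j]]]]]]] //= _.
  + by move=> /FX_inner/(_ du hu); lia.
  + by case/Xb_P=> a da h; have := inner_pair du hu da h; lia.
  + by move=> /DR_ge/(_ du hu); lia.
  + by move=> /OR_ge/(_ du hu); lia.
- rewrite /= => + hu; have [du fu] := FX_P hu.
  case: j => [|[|[|[|[|[|[|j]]]]]]] //= _.
  + by case/Xb_P=> a da h; have := FX_inner hu da h; lia.
  + by case/DR_P=> _ h; have := alt h => h'; apply: (FX_arc hu (leqnn d)) h; lia.
  + by case/OR_P=> dv _ /endsP[a ad h]; apply: (FX_arc hu (ltnW ad)) h.
- rewrite /= => + /Xb_P[a da hu].
  case: j => [|[|[|[|[|[|[|j]]]]]]] //= _.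
  + by move=> /DR_ge/(_ da hu).
  + by move=> /OR_ge/(_ da hu).
- rewrite /= => + /DR_P[_ du].
  case: j => [|[|[|[|[|[|[|j]]]]]]] //= _.
  by case/OR_P=> dv _; apply: OD_le.
- by case: j => [|[|[|[|[|[|[|j]]]]]]].
- by rewrite /=; lia.
Qed.

End One.

(** Since the supports are ordered and [raw_of] gives the size of each section, [sections_unique]
    peels the sections off [tot] one by one from the left. *)
Lemma sections_inj x y : supported d e x -> supported d e y ->
    standard d x -> standard d y -> 0 < kap x -> 0 < kap y ->
    raw_of x = raw_of y -> (forall c, c < N -> tot x c = tot y c) ->
  [/\ forall c, c < N -> arcs x d c = arcs y d c,
      forall c, d < c < N -> ends d x c = ends d y c,
      forall a, d < a < N -> starts d e x a = starts d e y a,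
      forall c, c < N -> Xb x c = Xb y c &
      forall c, d < c < N -> fc x c = fc y c].
Proof.
move=> xs ys sx sy kx ky [_ eOL eOR _ eF eI eDL eDR _] etot.
have pre f g : f 0 = 0 -> f N.-1 = 0 -> g 0 = 0 -> g N.-1 = 0 ->
    \sum_(c < N) f c = \sum_(c < N) g c ->
    \sum_(c < N) f c.-1 = \sum_(c < N) g c.-1.
  by move=> *; rewrite !sum_shift.
(* A shifted section is observed only up to column [N.-2] of the original one; in the last column
   the shifted sections vanish. *)
have unpre f g : f N.-1 = 0 -> g N.-1 = 0 ->
    (forall c, c < N -> f c.-1 = g c.-1) -> forall c, c < N -> f c = g c :> nat.
  move=> fN gN h c cN; case: (ltnP c.+1 N) => c1; first exact: (h c.+1).
  by rewrite (_ : c = N.-1) ?fN ?gN //; lia.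
have sec i (B B' : nat -> nat) (A := nth (fun=> 0) (section_seq x) i)
    (A' := nth (fun=> 0) (section_seq y) i) :
    (forall c, c < N -> A c + B c = A' c + B' c) ->
    \sum_(c < N) A c = \sum_(c < N) A' c ->
    (forall v, 0 < B v -> has (fun j => 0 < nth (fun=> 0) (section_seq x) j v) (iota i.+1 (6 - i))) ->
    (forall v, 0 < B' v -> has (fun j => 0 < nth (fun=> 0) (section_seq y) j v) (iota i.+1 (6 - i))) ->
    (forall c, c < N -> A c = A' c) /\ (forall c, c < N -> B c = B' c).
  move=> eAB sA hB hB'; have h := sections_unique eAB sA; have {}h c : c < N -> A c = A' c.
    apply: h => u v hu.
      case/hB/hasP=> j; rewrite mem_iota => hj; apply: (section_order xs sx) hu; lia.
    case/hB'/hasP=> j; rewrite mem_iota => hj; apply: (section_order ys sy) hu; lia.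
  by split=> // c cN; have := eAB c cN; rewrite h // => /addnI.
have tl (b c : bool) : b = c -> b -> c by move=> ->.
rewrite /tot in etot.
have [e0 et0] := sec 0 _ _ etot (pre _ _ (DL_first xs) (DL_last xs) (DL_first ys) (DL_last ys) eDL)
  ltac:(by move=> v; rewrite /= !addn_gt0 orbF) ltac:(by move=> v; rewrite /= !addn_gt0 orbF).
have [e1 et1] := sec 1 _ _ et0 (pre _ _ erefl (OL_last xs) erefl (OL_last ys) eOL)
  ltac:(by move=> v; rewrite /= !addn_gt0 orbF) ltac:(by move=> v; rewrite /= !addn_gt0 orbF).
have [e2 et2] := sec 2 _ _ et1 (pre _ _ erefl (inner_last xs) erefl (inner_last ys) eI)
  ltac:(by move=> v; rewrite /= !addn_gt0 orbF) ltac:(by move=> v; rewrite /= !addn_gt0 orbF).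
have [e3 et3] := sec 3 _ _ et2 eF
  ltac:(by move=> v; rewrite /= !addn_gt0 orbF) ltac:(by move=> v; rewrite /= !addn_gt0 orbF).
have eX : \sum_(c < N) Xb x c = \sum_(c < N) Xb y c by rewrite !Xb_sum.
have [e4 et4] := sec 4 _ _ et3 eX
  ltac:(by move=> v; rewrite /= !addn_gt0 orbF) ltac:(by move=> v; rewrite /= !addn_gt0 orbF).
have [e5 e6] := sec 5 _ _ et4 eDR ltac:(by move=> v; rewrite /= orbF) ltac:(by move=> v; rewrite /= orbF).
have {}e0 := unpre _ _ (DL_last xs) (DL_last ys) e0.
have {}e1 := unpre _ _ (OL_last xs) (OL_last ys) e1.
have {}e2 := unpre _ _ (inner_last xs) (inner_last ys) e2.
have Dsum z c : arcs z d c = DL z c + DR z c.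
  by rewrite /DL /DR; case: ifP; rewrite ?addn0.
have Osum z c : d < c -> ends d z c = OL z c + OR z c.
  by move=> dc; rewrite /OL /OR dc /=; case: lf; rewrite ?addn0.
split.
- by move=> c cN; rewrite !Dsum e0 // -[DR x c]/(nth (fun=> 0) (section_seq x) 5 c) e5.
- by move=> c /andP[dc cN]; rewrite !Osum // e1 // e6.
- by move=> a /andP[da aN]; have := e2 a aN; rewrite /inner da.
- exact: e4.
- by move=> c /andP[dc cN]; have := e3 c cN; rewrite /= /FX dc.
Qed.
End Sections.

(** * The image of a standard configuration *)

Section Image.
Variables d e : nat.
Local Notation N := (d + e).
Implicit Type x : config.

(* The weight of the first-row variable of column c.  A second-row variable
   weighs one more than the variable above it, and T_{a,b} one more than the
   columns a and b together, so that all relations are homogeneous. *)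
Definition col_wt c := if c < d then (c != 0 : nat) else (c - d).+1.
Definition weight x := \sum_(p < d) fo x p * (col_wt p).+1 + \sum_(c < N) fc x c * col_wt c
  + \sum_(a < N) \sum_(b < N) arcs x a b * (col_wt a + col_wt b).+1.

Definition letter_wt (o c : nat -> nat) :=
  \sum_(p < d) o p * (col_wt p).+1 + \sum_(p < N) c p * col_wt p.
(* The largest T-degree in which the monomial with exponents [o] and [c] is
   realized, up to lower terms: y_{2,p} and x_i come from T_{0,p} and
   T_{0,d+i-1}, and y_{2,0}^e x_0 is the leading term of T_{0,N-1}. *)
Definition power (o c : nat -> nat) :=
  \sum_(p < d | 0 < p) o p + \sum_(i < e | 0 < i) c (d + i) + minn (c d) (o 0 %/ e).

(** Each taken unit becomes a letter y_{2,p}, which supplies one T-degree; the rest has to come from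
    letters in the x columns. *)
Definition excess x := narcs d e x - ntaken d e x.
Definition xlet x c := fc x c + ends d x c.
Definition xlets x := \sum_(i < e) xlet x (d + i).
Definition xlets1 x := \sum_(i < e | 0 < i) xlet x (d + i).
(** The letters to be pushed one column to the right when those beyond column d do not suffice: all
    of them, completed from column d up to [excess] in total. *)
Definition xkeep x c := if c == d then xlet x d - (xlets x - excess x) else xlet x c.
Definition raw_level r := level (tight r) (rg r) (gl r + gr r) (rk r) (rn r) (rnu r) (rw r).

(** There are three kinds of configurations. With arcs starting in x columns, the level is
    prescribed and the exponents of columns d and d + 1 follow from degree and weight. Without such
    arcs, if the letters beyond column d exceed [excess], nothing moves and the carried units become
    y_{2,0}. Otherwise [excess] letters move right at the price of one unit each, and a letter of
    the last column turns into y_{2,0}^e x_0, the leading term of the image of T_{0,N-1} up to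
    sign. *)
Definition img_level x :=
  if 0 < kap d e x then raw_level (raw_of d e x)
  else if excess x < xlets1 x then carry d e x d
  else carry d e x d - excess x + e * xkeep x N.-1.
Definition img_tail x c :=
  if 0 < kap d e x then
    let r := raw_of d e x in let z := rw r - raw_level r in
    if c == d then rn r - (z + rnu r) else if c == d.+1 then z else tot d e x c
  else if excess x < xlets1 x then xlet x c
  else if c == d then xlets x - excess x + xkeep x N.-1 else xkeep x c.-1.
Definition img_o x p := if p == 0 then img_level x else taken d e x p.
(** The content of column 0 is dropped: its column weight is 0 and y_{1,0} is specialized to 1. *)
Definition img_c x c := if d <= c then img_tail x c else
  if c == 0 then 0 else mo d e x c + mc d x c - taken d e x c.

Section One.
Variable x : config.
Hypotheses (d0 : 0 < d) (e0 : 0 < e) (xs : supported d e x) (sx : standard d x).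
Let alt := arc_lt xs.

Lemma mo_taken p : \sum_(q < p) mo d e x q = \sum_(q < p) taken d e x q + carry d e x p.
Proof.
elim: p => [|p IH]; first by rewrite !big_ord0.
have := @carryS d e x p; move: (carry d e x p.+1) => c h.
by rewrite !big_ord_recr /= IH -addnA -h addnA addnAC.
Qed.

Lemma ltd i : (d < d + i) = (0 < i).
Proof. by rewrite -{1}[d]addn0 ltn_add2l. Qed.

Lemma sum_tail (f : nat -> nat) : (forall c, c < d -> f c = 0) ->
  \sum_(c < N) f c = \sum_(i < e) f (d + i).
Proof.
by move=> f0; rewrite big_split_ord /= [X in X + _]big1 // => c _; apply: f0.
Qed.

Lemma ord_first n (f : nat -> nat) : 0 < n ->
  \sum_(i < n) f i = f 0 + \sum_(i < n | 0 < i) f i.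
Proof.
case: n => // n _; rewrite big_ord_recl; congr (_ + _).
by rewrite [RHS]big_mkcond [RHS]big_ord_recl /= add0n.
Qed.

Lemma ord_second n (f : nat -> nat) : 1 < n ->
  \sum_(i < n | 0 < i) f i = f 1 + \sum_(i < n | 1 < i) f i.
Proof.
case: n => [|[|n]] // _; rewrite big_mkcond [in RHS]big_mkcond /=.
by rewrite !big_ord_recl /= !add0n.
Qed.

Lemma kapE : kap d e x = \sum_(i < e) starts d e x (d + i).
Proof.
rewrite (@ord_first e (fun i => starts d e x (d + i))) // addn0 /kap; congr (_ + _).
rewrite sum_tail => [|c cd]; last by rewrite /inner ltnNge ltnW.
rewrite [RHS]big_mkcond; apply: eq_bigr => i _.
by rewrite /inner ltd.
Qed.

Lemma narcsE : narcs d e x = \sum_(a < d) starts d e x a + kap d e x.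
Proof. by rewrite kapE /narcs big_split_ord. Qed.

Lemma crossing_tail : crossing d e x d = \sum_(i < e) ends d x (d + i).
Proof.
rewrite /crossing exchange_big /= big_mkcond big_split_ord /= [X in X + _]big1 ?add0n => [|c _].
  by apply: eq_bigr => i _; rewrite leq_addr.
by rewrite leqNgt ltn_ord.
Qed.

Section Positive.
Hypothesis kp : 0 < kap d e x.

Lemma kap_arc : exists a b, [/\ d <= a, a < b < N & 0 < arcs x a b].
Proof.
move: kp; rewrite kapE; case/(@ord_sum_gt0 _ (fun i => starts d e x (d + i))) => i _.
by case/ord_sum_gt0=> b _ h; exists (d + i), b; rewrite leq_addr alt.
Qed.

Lemma fo_eq0 p : p < d -> fo x p = 0.
Proof.
move=> pd; have [a [b [da _ h]]] := kap_arc; apply/eqP; rewrite -leqn0 leqNgt; apply/negP => f.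
by have := @stdO _ _ sx p a b (leq_trans pd da) f; lia.
Qed.

(** An arc starting in an x column excludes all y_{2,p} by LEN. The units are then the arcs
    themselves, and by [ends_min] the greedy scan closes as many as really end. *)
Lemma carry_crossing p : p <= d -> carry d e x p = crossing d e x p.
Proof.
elim: p => [|p IH] pd; first by rewrite crossing0.
have := @carryS d e x p; have := crossingS xs pd.
rewrite (ends_min xs sx (ltnW pd)) /taken IH ?(ltnW pd) // /mo fo_eq0 // add0n => <- /addIn.
by [].
Qed.

Lemma carry_rg : carry d e x d = rg (raw_of d e x).
Proof.
rewrite carry_crossing // crossing_tail /rg /= -addnA O_split //.
rewrite [RHS]big_mkcond [RHS]big_split_ord /= [X in _ = X + _]big1 ?add0n => [|c _].
  by apply: eq_bigr => i _; rewrite leq_addr.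
by rewrite leqNgt ltn_ord.
Qed.

Lemma rkapE : rkap (raw_of d e x) = kap d e x.
Proof. by rewrite /rkap /= D_split. Qed.

Lemma excessE : excess x = rk (raw_of d e x) /\ narcs d e x = ntaken d e x + rk (raw_of d e x).
Proof.
suff h : narcs d e x = ntaken d e x + rk (raw_of d e x) by split=> //; rewrite /excess h addKn.
rewrite narcsE /rk -carry_rg rkapE addnA; congr (_ + _).
rewrite -mo_taken; apply: eq_bigr => a _; by rewrite /mo fo_eq0.
Qed.

Lemma tail_two : 1 < e.
Proof. by have [a [b [? ? _]]] := kap_arc; lia. Qed.

Lemma tot_rnu : \sum_(c < N) tot d e x c = tot d e x d.+1 + rnu (raw_of d e x).
Proof.
have : tot d e x d.+1 <= \sum_(c < N) tot d e x c.
  by apply: ord_sum_ge; have := tail_two; lia.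
rewrite [in RHS]/rnu /= (tot_sum xs); move: (tot d e x d.+1) => u.
move: (\sum_(c < N) DL d e x c) (\sum_(c < N) OL d e x c) (\sum_(c < N) inner d e x c).
move: (\sum_(c < N) FX d x c) (\sum_(c < N) DR d e x c) (\sum_(c < N) OR d e x c).
lia.
Qed.

Let b := level_bounds (raw_region (okraw_of xs sx kp)).

Lemma tot_rest (f : nat -> nat) : \sum_(c < N) tot d e x c * f c =
  tot d e x d.+1 * f d.+1 + \sum_(i < e | 1 < i) tot d e x (d + i) * f (d + i).
Proof.
rewrite (@sum_tail (fun c => tot d e x c * f c)) => [|c cd]; last by rewrite tot_small // ltnW.
rewrite (@ord_first e (fun i => tot d e x (d + i) * f (d + i))) // addn0 tot_small // mul0n add0n.
by rewrite (@ord_second e (fun i => tot d e x (d + i) * f (d + i))) ?tail_two // addn1.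
Qed.

Lemma img_tail_rest i : 1 < i -> img_tail x (d + i) = tot d e x (d + i).
Proof.
move=> i1; rewrite /img_tail kp /= -{2}[d]addn0 -[d.+1]addn1 !eqn_add2l.
by case: i i1 => [|[|]].
Qed.

Lemma img_tail1 : img_tail x (d + 1) = rw (raw_of d e x) - raw_level (raw_of d e x).
Proof. by rewrite /img_tail kp /= addn1 (gtn_eqF (ltnSn d)) eqxx. Qed.

Lemma tail_power : \sum_(i < e | 0 < i) img_tail x (d + i)
  = rw (raw_of d e x) - raw_level (raw_of d e x) + rnu (raw_of d e x).
Proof.
rewrite (@ord_second e (fun i => img_tail x (d + i))) ?tail_two // img_tail1; congr (_ + _).
have := tot_rest (fun=> 1); under eq_bigr do rewrite muln1.
rewrite tot_rnu muln1 => /addnI ->; apply: eq_bigr => i i1.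
by rewrite img_tail_rest // muln1.
Qed.

Lemma power_pos : narcs d e x <= power (img_o x) (img_c x).
Proof.
have [_ ->] := excessE; have [_ _ h1 h2] := b.
rewrite /power -addnA leq_add //.
  rewrite /ntaken (@ord_first d (taken d e x)) // /taken /= min0n add0n leq_sum // => p.
  by rewrite /img_o; case: (p : nat).
apply: leq_trans (leq_addr _ _); rewrite (eq_bigr (fun i : 'I_e => img_tail x (d + i))) => [|i _].
  by rewrite tail_power /raw_level; lia.
by rewrite /img_c leq_addr.
Qed.

Let V c := (c - d).+1.

Lemma col_wt_tail c : d <= c -> col_wt c = V c.
Proof. by rewrite /col_wt ltnNge => ->. Qed.

Lemma xlet_weight : \sum_(i < e) xlet x (d + i) * i.+1 = xlet x d +
  (\sum_(c < N) FX d x c * V c + (\sum_(c < N) OL d e x c * V c + \sum_(c < N) OR d e x c * V c)).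
Proof.
rewrite (@ord_first e (fun i => xlet x (d + i) * i.+1)) // addn0 muln1; congr (_ + _).
rewrite -!big_split /= (@sum_tail (fun c => FX d x c * V c + (OL d e x c * V c + OR d e x c * V c))).
  rewrite big_mkcond; apply: eq_bigr => i _ /=; rewrite -!mulnDl /FX /OL /OR ltd /V addKn; case: (0 < i) => //=.
  by case: lf; rewrite ?addn0.
by move=> c cd; rewrite /FX /OL /OR [d < c]ltnNge ltnW.
Qed.

Lemma arc_weight : \sum_(a < N | d <= a) \sum_(c < N) arcs x a c * (col_wt a + col_wt c).+1 =
  (\sum_(c < N) DL d e x c * (V c).+2 + \sum_(c < N) DR d e x c * (V c).+2) +
  (\sum_(c < N) inner d e x c * (V c).+1 + \sum_(c < N) Xb d e x c * V c).
Proof.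
rewrite big_mkcond (@sum_tail (fun a => if d <= a then \sum_(c < N) arcs x a c * (col_wt a + col_wt c).+1 else 0)) => [|a ad]; last by rewrite leqNgt ad.
rewrite (@ord_first e (fun i => if d <= d + i then \sum_(c < N) arcs x (d + i) c * (col_wt (d + i) + col_wt c).+1 else 0)) //.
rewrite addn0 leqnn; congr (_ + _).
  rewrite -big_split; apply: eq_bigr => c _ /=; rewrite -mulnDl.
  have -> : DL d e x c + DR d e x c = arcs x d c by rewrite /DL /DR; case: ifP; rewrite ?addn0.
  have [->|/alt/andP[dc _]] := posnP (arcs x d c); first by rewrite !mul0n.
  by rewrite !col_wt_tail ?(ltnW dc) // [V d]/V subnn.
have -> : \sum_(c < N) Xb d e x c * V c = \sum_(a < N | d < a) \sum_(c < N) arcs x a c * V c.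
  by rewrite exchange_big; apply: eq_bigr => c _; rewrite big_distrl.
rewrite [X in _ = _ + X]big_mkcond -big_split /=.
rewrite (@sum_tail (fun a => inner d e x a * (V a).+1 + (if d < a then \sum_(c < N) arcs x a c * V c else 0))); last first.
  by move=> a ad; rewrite /inner ltnNge ltnW.
rewrite [LHS]big_mkcond; apply: eq_bigr => i _; rewrite /inner ltd leq_addr.
case: (0 < i) => //; rewrite big_distrl -big_split; apply: eq_bigr => c _ /=; rewrite -mulnDr.
have [->|/alt/andP[dc _]] := posnP (arcs x (d + i) c); first by rewrite !mul0n.
by rewrite !col_wt_tail //; lia.
Qed.

(** Moving the left sections and the inner starts by one column absorbs exactly one unit of weight
    per arc. *)
Lemma tot_weight : \sum_(c < N) tot d e x c * V c = \sum_(c < N) DL d e x c * (V c).+1 +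
  (\sum_(c < N) OL d e x c * (V c).+1 + (\sum_(c < N) inner d e x c * (V c).+1 +
  (\sum_(c < N) FX d x c * V c + (\sum_(c < N) Xb d e x c * V c +
  (\sum_(c < N) DR d e x c * V c + \sum_(c < N) OR d e x c * V c))))).
Proof.
have sh (f : nat -> nat) : (forall c, 0 < f c -> d < c) -> f N.-1 = 0 ->
    \sum_(c < N) f c.-1 * V c = \sum_(c < N) f c * (V c).+1.
  move=> fd fN; have f0 : f 0 = 0 by apply/eqP; rewrite -leqn0 leqNgt; apply/negP => /fd.
  rewrite -(@sum_shift N (fun c => f c * (V c).+1)) ?f0 ?fN ?mul0n //.
  apply: eq_bigr => c _; have [->|/fd] := posnP (f c.-1); first by rewrite !mul0n.
  by move=> h; congr (_ * _); rewrite /V; lia.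
under eq_bigr => c _ do rewrite /tot !mulnDl.
rewrite !big_split /= !sh //.
- by move=> c /innerP[].
- exact: inner_last.
- by move=> c /OL_P[].
- exact: OL_last.
- by move=> c /DL_P[_ /alt] /andP[].
- exact: DL_last.
Qed.

Lemma tail_weight : carry d e x d + \sum_(i < e) xlet x (d + i) * i.+1
    + \sum_(a < N | d <= a) \sum_(c < N) arcs x a c * (col_wt a + col_wt c).+1
  = img_level x + \sum_(i < e) img_tail x (d + i) * i.+1.
Proof.
have [_ h1 _ h2] := b.
rewrite (@ord_first e (fun i => img_tail x (d + i) * i.+1)) // addn0 muln1.
rewrite (@ord_second e (fun i => img_tail x (d + i) * i.+1)) ?tail_two // img_tail1.
have -> : \sum_(i < e | 1 < i) img_tail x (d + i) * i.+1 = \sum_(i < e | 1 < i) tot d e x (d + i) * V (d + i).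
  by apply: eq_bigr => i i1; rewrite img_tail_rest // /V addKn.
have := tot_rest V; rewrite tot_weight; have -> : V d.+1 = 2 by rewrite /V subSnn.
rewrite xlet_weight arc_weight carry_rg /img_level kp /img_tail kp eqxx.
move: h1 h2; rewrite -/(raw_level _).
have mS (f g : nat -> nat) : \sum_(c < N) f c * (g c).+1 = \sum_(c < N) f c + \sum_(c < N) f c * g c.
  by rewrite -big_split; apply: eq_bigr => c _; rewrite mulnS.
rewrite !(mS _ V) !(mS _ (fun c => (V c).+1)) !(mS _ V).
have := tot_rnu; rewrite (tot_sum xs).
rewrite /rn /rw /rkap /rg /xlet /=; move: (raw_level _) => J.
move: (rnu _) => nu; move: (tot d e x d.+1) => t2.
move: (\sum_(i < e | 1 < i) _) (fc x d) (ends d x d) => s2 f1 o1.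
move: (\sum_(c < N) DL d e x c * V c) (\sum_(c < N) DR d e x c * V c) (\sum_(c < N) OL d e x c * V c) (\sum_(c < N) OR d e x c * V c) (\sum_(c < N) inner d e x c * V c) (\sum_(c < N) FX d x c * V c) (\sum_(c < N) Xb d e x c * V c).
move: (\sum_(c < N) DL d e x c) (\sum_(c < N) DR d e x c) (\sum_(c < N) OL d e x c) (\sum_(c < N) OR d e x c) (\sum_(c < N) inner d e x c) (\sum_(c < N) FX d x c).
lia.
Qed.
End Positive.

Section Zero.
Hypothesis k0 : kap d e x = 0.

Let closed p := \sum_(q < p) ends d x q.

(** The greedy matching closes at least as many units as the arcs, which form one particular
    matching of starts with later ends. The second inequality compares the arcs started so far with
    all units met so far. *)
Lemma closed_taken p : p <= d ->
  closed p <= \sum_(q < p) taken d e x q /\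
  crossing d e x p + closed p <= carry d e x p + \sum_(q < p) taken d e x q.
Proof.
elim: p => [|p IH] pd; first by rewrite /closed !big_ord0 crossing0.
have [h1 h2] := IH (ltnW pd); have := crossingS xs pd; have := ends_min xs sx (ltnW pd).
have := @carryS d e x p; move: h1 h2.
have -> : closed p.+1 = closed p + ends d x p by rewrite /closed big_ord_recr.
have -> : \sum_(q < p.+1) taken d e x q = \sum_(q < p) taken d e x q + taken d e x p by rewrite big_ord_recr.
move: (\sum_(i < p) _) (closed p) => a b; rewrite /taken /mo /mc.
move: (carry d e x p.+1) (crossing _ _ _ p.+1) (carry d e x p) (crossing _ _ _ p) => u v u' v'.
by move: (ends _ _ _) (starts _ _ _ _) => ? ?; clear; lia.
Qed.

Lemma narcs0 : narcs d e x = crossing d e x d + closed d.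
Proof.
rewrite narcsE k0 addn0 crossing_tail; rewrite /closed /ends addnC.
rewrite -[LHS]/(\sum_(a < d) \sum_(c < N) arcs x a c) exchange_big /=.
by rewrite big_split_ord.
Qed.

Lemma excess_le : excess x <= carry d e x d /\ excess x <= xlets x.
Proof.
have [h1 h2] := closed_taken (leqnn d); rewrite /excess narcs0 /ntaken; split.
  by rewrite leq_subLR [X in _ <= X]addnC.
rewrite leq_subLR [X in _ <= X]addnC; apply: leq_add => //; rewrite crossing_tail leq_sum // => i _.
by rewrite /xlet leq_addl.
Qed.

Lemma xlets_first : xlets x = xlet x d + xlets1 x.
Proof. by rewrite /xlets (@ord_first e (fun i => xlet x (d + i))) // addn0. Qed.

Lemma ord_last n (f : nat -> nat) : 0 < n ->
  \sum_(i < n) f i = f n.-1 + \sum_(i < n | 0 < i) f i.-1.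
Proof.
case: n => // n _; rewrite big_ord_recr addnC; congr (_ + _).
by rewrite [RHS]big_mkcond [RHS]big_ord_recl.
Qed.

Section Small.
Hypothesis small : xlets1 x <= excess x.

Lemma xkeep_sum : \sum_(i < e) xkeep x (d + i) = excess x.
Proof.
rewrite (@ord_first e (fun i => xkeep x (d + i))) // addn0 /xkeep eqxx.
have -> : \sum_(i < e | 0 < i) (if d + i == d then xlet x d - (xlets x - excess x)
     else xlet x (d + i)) = xlets1 x.
  by apply: eq_bigr => i i0; rewrite gtn_eqF // ltd.
have [_] := excess_le; have := small; rewrite xlets_first; lia.
Qed.

Lemma img_tail_small i : 0 < i -> img_tail x (d + i) = xkeep x (d + i).-1.
Proof.
by move=> i0; rewrite /img_tail k0 /= ltnNge small /= gtn_eqF // ltd.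
Qed.

Lemma last_tail : N.-1 = d + e.-1.
Proof. lia. Qed.

Lemma xkeep_shift (f : nat -> nat) : \sum_(i < e) xkeep x (d + i) * f i =
   xkeep x N.-1 * f e.-1 + \sum_(i < e | 0 < i) img_tail x (d + i) * f i.-1.
Proof.
rewrite (@ord_last e (fun i => xkeep x (d + i) * f i)) // -last_tail; congr (_ + _).
by apply: eq_bigr => i i0; rewrite img_tail_small //; congr (xkeep _ _ * _); lia.
Qed.

End Small.

Lemma power_zero : narcs d e x <= power (img_o x) (img_c x).
Proof.
have [h1 h2] := excess_le.
have -> : power (img_o x) (img_c x) = ntaken d e x + \sum_(i < e | 0 < i) img_tail x (d + i)
    + minn (img_tail x d) (img_level x %/ e).
  rewrite /power /img_c leqnn /img_o /=; congr (_ + _ + _).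
    rewrite /ntaken (@ord_first d (taken d e x)) // /taken /= min0n add0n.
    by apply: eq_bigr => p; case: (p : nat).
  by apply: eq_bigr => i _; rewrite leq_addr.
apply: (@leq_trans (ntaken d e x + excess x)); first by rewrite /excess; lia.
rewrite -addnA leq_add2l /img_level k0 /=; case: ltnP => [lt|small].
  apply: leq_trans (leq_addr _ _); apply: leq_trans (ltnW lt) _; rewrite leq_sum // => i i0.
  by rewrite /img_tail k0 lt.
have := xkeep_shift small (fun=> 1); rewrite -!big_distrl /= !muln1.
rewrite xkeep_sum // => ->; rewrite addnC leq_add2l leq_min; apply/andP; split.
  by rewrite /img_tail k0 /= ltnNge small eqxx leq_addl.
rewrite leq_divRL // mulnC; exact: leq_addl.
Qed.

Lemma tail_weight0 : carry d e x d + \sum_(i < e) xlet x (d + i) * i.+1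
  = img_level x + \sum_(i < e) img_tail x (d + i) * i.+1.
Proof.
have [h1 h2] := excess_le.
rewrite /img_level k0 /=; case: ltnP => [lt|small].
  by congr (_ + _); apply: eq_bigr => i _; rewrite /img_tail k0 lt.
rewrite (@ord_first e (fun i => xlet x (d + i) * i.+1)) // addn0 muln1.
rewrite (@ord_first e (fun i => img_tail x (d + i) * i.+1)) // addn0 muln1.
have := xkeep_shift small (fun i => i.+2); have := xkeep_sum small.
have -> : \sum_(i < e) xkeep x (d + i) * i.+2 =
    \sum_(i < e) xkeep x (d + i) + \sum_(i < e) xkeep x (d + i) * i.+1.
  by rewrite -big_split; apply: eq_bigr => i _; rewrite mulnS.
move=> ->; rewrite (@ord_first e (fun i => xkeep x (d + i) * i.+1)) // addn0 muln1.
have -> : \sum_(i < e | 0 < i) xkeep x (d + i) * i.+1 = \sum_(i < e | 0 < i) xlet x (d + i) * i.+1.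
  by apply: eq_bigr => i i0; rewrite /xkeep gtn_eqF // ltd.
have -> : \sum_(i < e | 0 < i) img_tail x (d + i) * (i.-1).+2 = \sum_(i < e | 0 < i) img_tail x (d + i) * i.+1.
  by apply: eq_bigr => i i0; rewrite prednK.
have -> : img_tail x d = xlets x - excess x + xkeep x N.-1.
  by rewrite /img_tail k0 /= ltnNge small eqxx.
have -> : (e.-1).+2 = e.+1 by lia.
have -> : xkeep x d = xlet x d - (xlets x - excess x) by rewrite /xkeep eqxx.
have h3 : xlets x <= xlet x d + excess x by rewrite xlets_first leq_add2l.
rewrite mulnS (mulnC _ e).
move: (\sum_(i < e | 0 < i) xlet x (d + i) * i.+1) (\sum_(i < e | 0 < i) img_tail x (d + i) * i.+1).
move: h1 h2 h3; move: (e * xkeep _ _) => ?; move: (xkeep _ _) (xlet _ _) (carry d e x d) (xlets x) (excess x).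
clear; lia.
Qed.

End Zero.

Lemma power_img : narcs d e x <= power (img_o x) (img_c x).
Proof. by have [k0|kp] := posnP (kap d e x); [apply: power_zero|apply: power_pos]. Qed.

Lemma weight_img : fc x 0 = 0 -> letter_wt (img_o x) (img_c x) = weight x.
Proof.
move=> f0.
have yw : \sum_(p < d) img_o x p * (col_wt p).+1 + \sum_(p < d) img_c x p * col_wt p + carry d e x d
    = \sum_(p < d) (mo d e x p * (col_wt p).+1 + mc d x p * col_wt p) + img_level x.
  rewrite (@ord_first d (fun p => img_o x p * (col_wt p).+1)) //.
  have -> : col_wt 0 = 0 by rewrite /col_wt d0.
  have -> : \sum_(p < d | 0 < p) img_o x p * (col_wt p).+1 = \sum_(p < d) taken d e x p * (col_wt p).+1.
    rewrite (@ord_first d (fun p => taken d e x p * (col_wt p).+1)) // /taken /= min0n mul0n add0n.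
    by apply: eq_bigr => p; rewrite /img_o; case: (p : nat).
  have mS (f g : nat -> nat) : \sum_(c < d) f c * (g c).+1 = \sum_(c < d) f c + \sum_(c < d) f c * g c.
    by rewrite -big_split; apply: eq_bigr => c _; rewrite mulnS.
  rewrite big_split /= !mS mo_taken muln1 /img_o /=.
  have -> : \sum_(p < d) img_c x p * col_wt p = \sum_(p < d) (mo d e x p * col_wt p + mc d x p * col_wt p)
      - \sum_(p < d) taken d e x p * col_wt p.
    apply: (canRL (addnK _)); rewrite -big_split; apply: eq_bigr => p _ /=.
    rewrite /img_c leqNgt ltn_ord /=; case: eqP => [->|_].
      by rewrite /col_wt d0 /= !muln0.
    rewrite -mulnDl -mulnDl subnK // /taken; apply: leq_trans (geq_minr _ _) (leq_addl _ _).
  have : \sum_(p < d) taken d e x p * col_wt p <=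
      \sum_(p < d) (mo d e x p * col_wt p + mc d x p * col_wt p).
    rewrite leq_sum // => p _; rewrite -mulnDl leq_mul2r; apply/orP; right.
    by apply: leq_trans (geq_minr _ _) (leq_addl _ _).
  rewrite big_split /=.
  move: (\sum_(p < d) taken d e x p * col_wt p) (\sum_(p < d) mo d e x p * col_wt p) (\sum_(p < d) mc d x p * col_wt p).
  move: (\sum_(p < d) taken d e x p); clear; lia.
have xw : carry d e x d + \sum_(i < e) xlet x (d + i) * i.+1
    + \sum_(a < N | d <= a) \sum_(c < N) arcs x a c * (col_wt a + col_wt c).+1
  = img_level x + \sum_(i < e) img_tail x (d + i) * i.+1.
  have [k0|kp] := posnP (kap d e x); last exact: tail_weight.
  rewrite -tail_weight0 // [X in _ + X]big1 ?addn0 // => a da.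
  rewrite big1 // => c _; suff -> : arcs x a c = 0 by [].
  move: k0; rewrite kapE => /eqP; rewrite sum_nat_eq0 => /forallP h.
  have ae : a - d < e by have := ltn_ord a; lia.
  have := h (Ordinal ae); rewrite /= subnKC // sum_nat_eq0 => /forallP h'.
  by apply/eqP; exact: (h' c).
have cd (c : 'I_d) : (d <= c) = false by rewrite leqNgt ltn_ord.
have cw (i : nat) : col_wt (d + i) = i.+1 by rewrite /col_wt ltnNge leq_addr addKn.
have eL : letter_wt (img_o x) (img_c x) = \sum_(p < d) img_o x p * (col_wt p).+1 +
    \sum_(p < d) img_c x p * col_wt p + \sum_(i < e) img_tail x (d + i) * i.+1.
  rewrite /letter_wt big_split_ord addnA; congr (_ + _); apply: eq_bigr => i _ /=.
  by rewrite cw /img_c leq_addr.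
have eW : weight x = \sum_(p < d) (mo d e x p * (col_wt p).+1 + mc d x p * col_wt p) +
    (\sum_(i < e) xlet x (d + i) * i.+1 +
     \sum_(a < N | d <= a) \sum_(c < N) arcs x a c * (col_wt a + col_wt c).+1).
  rewrite /weight [X in _ + X = _](bigID (fun a : 'I_N => d <= a)) /= big_split_ord /=.
  have -> : \sum_(i < N | ~~ (d <= i)) \sum_(b < N) arcs x i b * (col_wt i + col_wt b).+1 =
      \sum_(p < d) starts d e x p * (col_wt p).+1 +
      (\sum_(p < d) ends d x p * col_wt p + \sum_(i < e) ends d x (d + i) * i.+1).
    rewrite big_mkcond big_split_ord /= [X in _ + X = _]big1 => [|i _]; last by rewrite leq_addr.
    rewrite addn0; under eq_bigr do rewrite cd.
    have -> : \sum_(p < d) ends d x p * col_wt p + \sum_(i < e) ends d x (d + i) * i.+1 =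
        \sum_(c < N) ends d x c * col_wt c.
      by rewrite big_split_ord; congr (_ + _); apply: eq_bigr => i _; rewrite cw.
    under [X in _ = _ + X]eq_bigr do rewrite big_distrl.
    rewrite [X in _ = _ + X]exchange_big -big_split; apply: eq_bigr => a _ /=.
    by rewrite /starts big_distrl -big_split; apply: eq_bigr => c _ /=; rewrite -mulnDr.
  have -> : \sum_(i < e) fc x (d + i) * col_wt (d + i) = \sum_(i < e) fc x (d + i) * i.+1.
    by apply: eq_bigr => i _; rewrite cw.
  rewrite /mo /mc /xlet; under [in RHS]eq_bigr do rewrite !mulnDl.
  rewrite !big_split /=; under [X in _ = _ + (X + _)]eq_bigr do rewrite mulnDl.
  rewrite big_split /=; set A := \sum_(a < N | _) _.
  move: A => A; clear.
  move: (\sum_(i < d) _) (\sum_(i < d) _) (\sum_(i < d) _) (\sum_(i < d) _) (\sum_(i < e) _) (\sum_(i < e) _); lia.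
move: yw xw; rewrite eL eW; set A := \sum_(a < N | _) _; move: A => A.
do 3 move: (\sum_(i < d) _) => ?; do 2 move: (\sum_(i < e) _) => ?.
move: (carry _ _ _ _) (img_level x); clear; lia.
Qed.
End One.
End Image.

(** * Recovering a configuration from its image and its T-degree *)

Section Decode.
Variables d e : nat.
Local Notation N := (d + e).
Hypotheses (d0 : 0 < d) (e0 : 0 < e).
Implicit Type x y : config.

Definition admissible x := [/\ supported d e x, standard d x & fc x 0 = 0].

Lemma tail_total x : admissible x -> \sum_(i < e) img_tail d e x (d + i) =
  if 0 < kap d e x then rn (raw_of d e x) else xlets d e x.
Proof.
case=> xs sx f0; have [k0|kp] := posnP (kap d e x).
  case: (ltnP (excess d e x) (xlets1 d e x)) => [lt|small].
    by apply: eq_bigr => i _; rewrite /img_tail k0 /= lt.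
  have := xkeep_shift d0 e0 k0 small (fun=> 1); rewrite -!big_distrl /= !muln1 xkeep_sum // => h.
  rewrite (@ord_first e (fun i => img_tail d e x (d + i))) // addn0 {1}/img_tail k0 /= ltnNge small eqxx.
  by have [_ h2] := excess_le e0 xs sx k0; rewrite -addnA -h subnK.
rewrite (@ord_first e (fun i => img_tail d e x (d + i))) // tail_power // addn0.
rewrite {1}/img_tail kp eqxx subnK //.
by have [] := level_bounds (raw_region (okraw_of xs sx kp)); rewrite /raw_level; lia.
Qed.

Definition upper_sum x := \sum_(i < e | 0 < i) img_tail d e x (d + i).

(** This and the next two lemmas tell the three kinds apart by comparing [excess] with [img_level]
    and [upper_sum], all of which can be read off the image and the T-degree. *)
Lemma kind_pos x : admissible x -> 0 < kap d e x ->
  img_level d e x < excess d e x < upper_sum x.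
Proof.
case=> xs sx f0 kp; have [h1 h2 h3 h4] := level_bounds (raw_region (okraw_of xs sx kp)).
have [-> _] := excessE d0 e0 xs sx kp.
by rewrite /upper_sum tail_power // /img_level kp /raw_level; lia.
Qed.

Lemma kind_large x : admissible x -> kap d e x = 0 -> excess d e x < xlets1 d e x ->
  excess d e x <= img_level d e x /\ excess d e x < upper_sum x.
Proof.
case=> xs sx f0 k0 lt; rewrite /img_level k0 /= lt; split; first by have [] := excess_le e0 xs sx k0.
apply: (leq_trans (n := xlets1 d e x)) => //; rewrite leq_sum // => i i0.
by rewrite /img_tail k0 /= lt.
Qed.

Lemma kind_small x : admissible x -> kap d e x = 0 -> xlets1 d e x <= excess d e x ->
  upper_sum x <= excess d e x.
Proof.
case=> xs sx f0 k0 small.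
have := xkeep_shift d0 e0 k0 small (fun=> 1); rewrite -!big_distrl /= !muln1 xkeep_sum // => ->.
exact: leq_addl.
Qed.

Section Two.
Variables x y : config.
Hypotheses (ax : admissible x) (ay : admissible y).
Hypothesis eqn : narcs d e x = narcs d e y.
Hypothesis eqo : forall p, p < d -> img_o d e x p = img_o d e y p.
Hypothesis eqc : forall c, c < N -> img_c d e x c = img_c d e y c.

Let xs : supported d e x. Proof. by case: ax. Qed.
Let ys : supported d e y. Proof. by case: ay. Qed.
Let sx : standard d x. Proof. by case: ax. Qed.
Let sy : standard d y. Proof. by case: ay. Qed.

Lemma eq_taken p : p < d -> taken d e x p = taken d e y p.
Proof.
case: p => [|p] pd; first by rewrite /taken /= !min0n.
by have := eqo pd.
Qed.

Lemma eq_ntaken : ntaken d e x = ntaken d e y.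
Proof. by apply: eq_bigr => p _; apply: eq_taken. Qed.

Lemma eq_excess : excess d e x = excess d e y.
Proof. by rewrite /excess eqn eq_ntaken. Qed.

Lemma eq_content p : 0 < p < d -> mo d e x p + mc d x p = mo d e y p + mc d y p.
Proof.
case/andP=> p0 pd; have := eqc (ltn_addr e pd); have := eq_taken pd.
rewrite /img_c leqNgt pd /= gtn_eqF //.
have := geq_minr (carry d e x p) (mc d x p); have := geq_minr (carry d e y p) (mc d y p).
rewrite -!/(taken d e _ p).
move: (mo d e x p) (mo d e y p) (mc d x p) (mc d y p) (taken d e x p) (taken d e y p); clear; lia.
Qed.

Lemma eq_level : img_level d e x = img_level d e y.
Proof. exact: (eqo d0). Qed.

Lemma eq_tail i : i < e -> img_tail d e x (d + i) = img_tail d e y (d + i).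
Proof.
move=> ie; have iN : d + i < N by rewrite ltn_add2l.
by have := eqc iN; rewrite /img_c leq_addr.
Qed.

Lemma eq_upper : upper_sum x = upper_sum y.
Proof. by apply: eq_bigr => i _; apply: eq_tail. Qed.

Lemma eq_total : \sum_(i < e) img_tail d e x (d + i) = \sum_(i < e) img_tail d e y (d + i).
Proof. by apply: eq_bigr => i _; apply: eq_tail. Qed.

Lemma eq_kap : (0 < kap d e x) = (0 < kap d e y).
Proof.
have aux u v : admissible u -> admissible v -> 0 < kap d e u ->
    img_level d e u = img_level d e v -> excess d e u = excess d e v ->
    upper_sum u = upper_sum v -> 0 < kap d e v.
  move=> au av ku; have := kind_pos au ku; rewrite lt0n => h e1 e2 e3; apply/eqP => kv.
  case: (ltnP (excess d e v) (xlets1 d e v)) => [lt|small].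
    by have := kind_large av kv lt; lia.
  by have := kind_small av kv small; lia.
apply/idP/idP => h; apply: aux h _ _ _ => //; rewrite ?eq_level ?eq_excess ?eq_upper //.
Qed.

Lemma eq_xlet : kap d e x = 0 -> carry d e x d = carry d e y d /\
  forall i, i < e -> xlet d x (d + i) = xlet d y (d + i).
Proof.
move=> kx; have ky : kap d e y = 0.
  by apply/eqP; rewrite -leqn0 leqNgt -eq_kap kx.
have tot : xlets d e x = xlets d e y.
  by have := eq_total; rewrite !tail_total // kx ky.
have [hx1 hx2] := excess_le e0 xs sx kx; have [hy1 hy2] := excess_le e0 ys sy ky.
case: (ltnP (excess d e x) (xlets1 d e x)) => [lx|sml].
  case: (ltnP (excess d e y) (xlets1 d e y)) => [ly|sml]; last first.
    have := kind_small ay ky sml; have := kind_large ax kx lx.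
    by rewrite eq_excess eq_upper; lia.
  have := eq_level; rewrite /img_level kx ky /= lx ly => ->; split=> // i ie.
  by have := eq_tail ie; rewrite /img_tail kx ky /= lx ly.
have smly : xlets1 d e y <= excess d e y.
  rewrite leqNgt; apply/negP => ly; have := kind_small ax kx sml; have := kind_large ay ky ly.
  by rewrite eq_excess eq_upper; lia.
have k_eq i : i < e -> xkeep d e x (d + i) = xkeep d e y (d + i).
  move=> ie; case: (ltnP i.+1 e) => ie1.
    have := eq_tail ie1; rewrite (img_tail_small kx sml) // (img_tail_small ky smly) //.
    by rewrite addnS.
  (* The pushed letters of the last column have wrapped around into the exponent of column d, next
     to the known number of letters not pushed. *)
  have -> : d + i = N.-1 by lia.
  have := eq_tail e0; rewrite addn0 /img_tail kx ky /= eqxx !ltnNge sml smly /=.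
  by rewrite eq_excess tot => /addnI.
have k_last : xkeep d e x N.-1 = xkeep d e y N.-1.
  by rewrite (last_tail d0 e0 kx sml) k_eq // prednK.
split.
  have := eq_level; rewrite /img_level kx ky /= !ltnNge sml smly /= k_last => /addIn.
  rewrite eq_excess => h; move: hx1; rewrite eq_excess.
  by move: h hy1; move: (carry d e x d) (carry d e y d) (excess d e y); clear; lia.
case=> [|i] ie.
  have := k_eq 0 e0; rewrite addn0 /xkeep eqxx tot eq_excess.
  have h3 : xlets d e y <= xlet d x d + excess d e y.
    by rewrite -tot -eq_excess xlets_first // leq_add2l.
  have h4 : xlets d e y <= xlet d y d + excess d e y by rewrite xlets_first // leq_add2l.
  by move: h3 h4 hy2; move: (xlet d x d) (xlet d y d) (xlets d e y) (excess d e y); clear; lia.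
by have := k_eq _ ie; rewrite /xkeep gtn_eqF // ltd.
Qed.

Lemma eq_raw : 0 < kap d e x -> raw_of d e x = raw_of d e y /\
  forall c, c < N -> tot d e x c = tot d e y c.
Proof.
move=> kx; have ky : 0 < kap d e y by rewrite -eq_kap.
have rx := raw_region (okraw_of xs sx kx); have ry := raw_region (okraw_of ys sy ky).
have [bx1 bx2 bx3 bx4] := level_bounds rx; have [by1 by2 by3 by4] := level_bounds ry.
have e2 := tail_two d0 e0 xs kx.
have ek : rk (raw_of d e x) = rk (raw_of d e y).
  have [<- _] := excessE d0 e0 xs sx kx; have [<- _] := excessE d0 e0 ys sy ky; exact: eq_excess.
have en : rn (raw_of d e x) = rn (raw_of d e y).
  by have := eq_total; rewrite !tail_total // kx ky.
have et i : 1 < i < e -> tot d e x (d + i) = tot d e y (d + i).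
  by case/andP=> i1 ie; have := eq_tail ie; rewrite !img_tail_rest.
have rest u : admissible u -> 0 < kap d e u ->
    rnu (raw_of d e u) = \sum_(i < e | 1 < i) tot d e u (d + i).
  move=> [us su _] ku; have := tot_rest d0 e0 us ku (fun=> 1).
  by rewrite -!big_distrl /= !muln1 tot_rnu // => /addnI.
have enu : rnu (raw_of d e x) = rnu (raw_of d e y).
  rewrite !rest //; apply: eq_bigr => i i1; apply: et; by rewrite i1 /=.
have eJ : raw_level (raw_of d e x) = raw_level (raw_of d e y).
  by have := eq_level; rewrite /img_level kx ky.
have ew : rw (raw_of d e x) = rw (raw_of d e y).
  have := eq_tail e2; rewrite !img_tail1 // eJ.
  move: bx2 by2; rewrite -!/(raw_level _) eJ.
  by move: (rw _) (rw _) (raw_level _); clear; lia.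
have rx' := rx; rewrite ek en enu ew in rx'.
have eJ' := eJ; rewrite /raw_level ek en enu ew in eJ'.
have [e3 e4 e5] := level_inj rx' ry eJ'.
have eR : raw_of d e x = raw_of d e y.
  exact: raw_inj (okraw_of xs sx kx) (okraw_of ys sy ky) ek en enu ew e3 e4 e5.
split=> // c cN; case: (leqP c d) => cd; first by rewrite !tot_small.
have -> : c = d + (c - d) by lia.
case: (ltnP 1 (c - d)) => c1; first by apply: et; lia.
have -> : d + (c - d) = d.+1 by lia.
by case: eR.
Qed.

Lemma eq_carry_d : carry d e x d = carry d e y d.
Proof.
have [k0|kp] := posnP (kap d e x); first by have [] := eq_xlet k0.
have ky : 0 < kap d e y by rewrite -eq_kap.
by rewrite !carry_rg //; have [-> _] := eq_raw kp.
Qed.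

Lemma mc0 u : admissible u -> mc d u 0 = 0.
Proof.
case=> us _ f0; rewrite /mc f0 /ends big1 // => a _; by case: us => _ _ ->; lia.
Qed.

(** The scan is run backwards. The next carry, the taken number and the column content determine the
    difference of [carry] and [mc] at a column; [taken] is their minimum, so both are determined. *)
Lemma eq_carry p : p <= d -> carry d e x p = carry d e y p.
Proof.
move=> pd; rewrite -(subKn pd); elim: (d - p) (leq_subr p d) => [|q IH] qd.
  by rewrite subn0 eq_carry_d.
have {}IH := IH (ltnW qd); set r := d - q.+1.
have er : d - q = r.+1 by rewrite /r; lia.
rewrite er in IH; case: (posnP r) => [->//|r0].
have rd : r < d by rewrite /r; lia.
have h := eq_content (introT andP (conj r0 rd)); have := eq_taken rd.
have := @carryS d e x r; have := @carryS d e y r; rewrite IH /taken.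
move: h; move: (carry d e y r.+1) (carry d e x r) (carry d e y r) (mo d e x r) (mo d e y r) (mc d x r) (mc d y r).
clear; lia.
Qed.

Lemma eq_mo_mc p : p < d -> mo d e x p = mo d e y p /\ mc d x p = mc d y p.
Proof.
move=> pd; have emo : mo d e x p = mo d e y p.
  have := @carryS d e x p; have := @carryS d e y p.
  by rewrite eq_carry // eq_carry 1?ltnW // eq_taken // => -> /addnI.
split=> //; case: (posnP p) => [->|p0]; first by rewrite !mc0.
by have := eq_content (introT andP (conj p0 pd)); rewrite emo => /addnI.
Qed.

Lemma eq_lower : (forall p, p < d -> starts d e x p = starts d e y p) /\
  (forall p, p < d -> ends d x p = ends d y p).
Proof.
have est p : p < d -> starts d e x p = starts d e y p.
  have [k0|kp] := posnP (kap d e x); last first.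
    have ky : 0 < kap d e y by rewrite -eq_kap.
    by move=> pd; have [+ _] := eq_mo_mc pd; rewrite /mo (fo_eq0 d0 e0 xs sx kp) // (fo_eq0 d0 e0 ys sy ky).
  have ky : kap d e y = 0 by apply/eqP; rewrite -leqn0 leqNgt -eq_kap k0.
  (* All arcs start in y columns here, so the total of the starts is the T-degree; LEN puts every
     start weakly before every y_{2,p}. *)
  move: p; apply: (@sections_unique d _ (fo x) _ (fo y)).
  - by move=> p pd; have [+ _] := eq_mo_mc pd; rewrite /mo !(addnC (fo _ _)).
  - by have := eqn; rewrite !narcsE // k0 ky !addn0.
  - move=> u v hu hv; rewrite leqNgt; apply/negP => vu; move: hu.
    by rewrite /starts big1 // => c _; apply: (stdO sx c vu hv).
  - move=> u v hu hv; rewrite leqNgt; apply/negP => vu; move: hu.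
    by rewrite /starts big1 // => c _; apply: (stdO sy c vu hv).
split=> // p pd.
have ecr q : q <= d -> crossing d e x q = crossing d e y q.
  elim: q => [|q IH] qd; first by rewrite !crossing0.
  have := crossingS xs qd; have := crossingS ys qd; rewrite IH ?(ltnW qd) // est //.
  rewrite (ends_min xs sx (ltnW qd)) (ends_min ys sy (ltnW qd)) IH ?(ltnW qd) //; have [_ ->] := eq_mo_mc qd.
  by move=> <- /addIn.
by rewrite (ends_min xs sx (ltnW pd)) (ends_min ys sy (ltnW pd)) ecr ?(ltnW pd) //; have [_ ->] := eq_mo_mc pd.
Qed.

Lemma eq_upper_cols : kap d e x = 0 -> forall i, i < e -> ends d x (d + i) = ends d y (d + i).
Proof.
move=> kx; have ky : kap d e y = 0 by apply/eqP; rewrite -leqn0 leqNgt -eq_kap kx.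
have [est een] := eq_lower; have [_ exl] := eq_xlet kx.
have ecr : crossing d e x d = crossing d e y d.
  have := eqn; rewrite !narcs0 //.
  have -> : \sum_(q < d) ends d x q = \sum_(q < d) ends d y q by apply: eq_bigr => q _; apply: een.
  by move/addIn.
(* Column d is treated apart: UEN lets its variable force all crossing arcs to end there. In the
   later columns UEN instead puts the variables weakly before the ends. *)
have first u : admissible u -> ends d u d = minn (xlet d u d) (crossing d e u d).
  move=> [us su _]; rewrite crossing_tail (@ord_first e (fun i => ends d u (d + i))) // addn0 /xlet.
  have [f0|fp] := posnP (fc u d).
    by rewrite f0 add0n; apply/esym/minn_idPl; rewrite leq_addr.
  rewrite [X in _ = minn _ (_ + X)]big1 ?addn0 => [|i i0]; last first.
    rewrite /ends big1 // => a _; apply: (stdU su (ltn_ord a) _ (leqnn d) fp); lia.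
  by apply/esym/minn_idPr; rewrite leq_addl.
have ed : ends d x d = ends d y d.
  by rewrite !first // ecr; have := exl 0 e0; rewrite addn0 => ->.
pose A u i := if 0 < i then fc u (d + i) else 0.
pose B u i := if 0 < i then ends d u (d + i) else 0.
have ord u : admissible u -> forall i j, 0 < A u i -> 0 < B u j -> i <= j.
  move=> [us su _] i j; rewrite /A /B; case: ifP => // i0 fi; case: ifP => // j0.
  case/endsP=> a ad h; rewrite leqNgt; apply/negP => ji.
  by have := @stdV _ _ su a (d + j) (d + i); lia.
have sB : \sum_(i < e) B x i = \sum_(i < e) B y i.
  have sBu u : \sum_(i < e) B u i + ends d u d = crossing d e u d.
    rewrite crossing_tail (@ord_first e (fun i => ends d u (d + i))) // addn0 addnC.
    by rewrite [X in _ = _ + X]big_mkcond.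
  by have := sBu x; have := sBu y; rewrite ecr ed => <- /addIn.
have AB i : i < e -> A x i + B x i = A y i + B y i.
  by move=> ie; rewrite /A /B; case: ifP => // _; exact: exl.
have sA : \sum_(i < e) A x i = \sum_(i < e) A y i.
  apply: (@addIn (\sum_(i < e) B x i)); rewrite [in RHS]sB -!big_split.
  by apply: eq_bigr => i _; apply: AB.
have eA := sections_unique AB sA (ord x ax) (ord y ay).
case=> [|i] ie; first by rewrite addn0.
by have := AB _ ie; rewrite eA // => /addnI.
Qed.

Lemma eq_cols : [/\ forall c, c < N -> ends d x c = ends d y c,
  forall c, c < N -> fc x c = fc y c,
  forall c, c < N -> arcs x d c = arcs y d c,
  forall a, d < a < N -> starts d e x a = starts d e y a &
  forall c, c < N -> Xb d e x c = Xb d e y c].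
Proof.
have [est een] := eq_lower.
have lowfc c : c < d -> fc x c = fc y c.
  by move=> cd; have [_] := eq_mo_mc cd; rewrite /mc een // => /addIn.
have low (P : nat -> Prop) : (forall c, c < d -> P c) -> (forall i, i < e -> P (d + i)) ->
    forall c, c < N -> P c.
  move=> h1 h2 c cN; case: (ltnP c d) => cd; first exact: h1.
  by rewrite -(subnKC cd); apply: h2; rewrite ltn_subLR.
have [k0|kp] := posnP (kap d e x); last first.
  have ky : 0 < kap d e y by rewrite -eq_kap.
  have [eR eT] := eq_raw kp.
  have [h1 h2 h3 h4 h5] := sections_inj xs ys sx sy kp ky eR eT.
  case: eR => g1 _ _ f1 _ _ _ _ _.
  split=> //; apply: low => // i ie; (case: (posnP i) => [->|i0]; first by rewrite addn0).
    by apply: h2; rewrite ltd i0 ltn_add2l.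
  by apply: h5; rewrite ltd i0 ltn_add2l.
have ky : kap d e y = 0 by apply/eqP; rewrite -leqn0 leqNgt -eq_kap k0.
have een' := eq_upper_cols k0.
have z u a c : kap d e u = 0 -> supported d e u -> d <= a -> arcs u a c = 0.
  move=> ku us da; case: (boolP (a < c < N)) => [/andP[ac cN]|]; last by case: us => _ _ h /h.
  move: ku; rewrite kapE // => /eqP; rewrite sum_nat_eq0 => /forallP h.
  have ae : a - d < e by lia.
  have := h (Ordinal ae); rewrite /= subnKC // sum_nat_eq0 => /forallP h'.
  by apply/eqP; exact: (h' (Ordinal cN)).
split.
- exact: low.
- apply: low => // i ie; have [_ h] := eq_xlet k0; have := h i ie.
  by rewrite /xlet een' // => /addIn.
- by move=> c _; rewrite !z.
- by move=> a /andP[da _]; rewrite /starts !big1 // => c _; rewrite z // ltnW.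
- by move=> c _; rewrite /Xb !big1 // => a da; rewrite z // ltnW.
Qed.

Lemma image_inj : [/\ forall p, fo x p = fo y p, forall c, fc x c = fc y c &
  forall a b, arcs x a b = arcs y a b].
Proof.
have [est een] := eq_lower; have [h1 h2 h3 h4 h5] := eq_cols.
have cols u c : supported d e u -> c < N -> \sum_(a < N) arcs u a c = ends d u c + (arcs u d c + Xb d e u c).
  move=> us cN; rewrite big_split_ord /=; congr (_ + _).
  rewrite (@ord_first e (fun i => arcs u (d + i) c)) // addn0; congr (_ + _).
  rewrite /Xb [RHS]big_mkcond [RHS]big_split_ord /= [X in _ = X + _]big1 ?add0n => [|a _].
    by rewrite big_mkcond; apply: eq_bigr => i _; rewrite ltd.
  by rewrite ltnNge ltnW.
split.
- move=> p; case: (ltnP p d) => pd; last by case: xs => -> // _ _; case: ys => ->.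
  by have [+ _] := eq_mo_mc pd; rewrite /mo est // => /addIn.
- move=> c; case: (ltnP c N) => cN; first exact: h2.
  by case: xs => _ -> // _; case: ys => _ ->.
- have [[_ _ onx] [_ _ ony]] := (xs, ys).
  apply: (noncrossing_unique onx ony (stdP sx) (stdP sy)) => [a aN|b bN].
    case: (ltngtP a d) => [ad|da|->]; first exact: est.
      by apply: h4; rewrite da.
    by apply: eq_bigr => c _; apply: h3.
  by rewrite !cols // h1 // h3 // h5.
Qed.

End Two.
End Decode.

Import Order.TTheory GRing.Theory.

(** * Leading monomials *)

Lemma lex_lt_nth (I : eqType) (s : seq I) (f g : I -> nat) x :
    x \in s -> f x < g x -> {in take (index x s) s, f =1 g} ->
  lex_lt [seq f i | i <- s] [seq g i | i <- s].
Proof.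
elim: s => //= y s IH; rewrite inE /lex_lt /= ltxi_cons leEnat eq_sym; case: eqP => [-> _ lt _|yx /= xs lt].
  by rewrite (ltnW lt) /= leqNgt lt.
move=> eqs; have fy : f y = g y by apply: eqs; rewrite inE eqxx.
rewrite fy leqnn /=; apply: IH => // z zs; apply: eqs; by rewrite inE zs orbT.
Qed.

Lemma take_index_enum n (i z : 'I_n) : z \in take (index i (enum 'I_n)) (enum 'I_n) -> z < i.
Proof.
rewrite index_enum_ord => h.
have : val z \in map val (take i (enum 'I_n)) by apply: map_f.
by rewrite map_take val_enum_ord take_iota mem_iota add0n (minn_idPl _) // ltnW.
Qed.

Lemma lex_lt_enum n (f g : 'I_n -> nat) (i : 'I_n) : f i < g i ->
  (forall j : 'I_n, j < i -> f j = g j) -> lex_lt [seq f j | j <- enum 'I_n] [seq g j | j <- enum 'I_n].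
Proof.
move=> lt eqf; apply: (@lex_lt_nth _ _ _ _ i) => //; first by rewrite mem_enum.
by move=> z /take_index_enum; apply: eqf.
Qed.

Lemma rev_enum_ord n : rev (enum 'I_n) = [seq rev_ord j | j <- enum 'I_n].
Proof.
case: n => [|n]; first by rewrite enum_ord0.
apply: (@eq_from_nth _ ord0) => [|i]; first by rewrite size_rev size_map.
rewrite size_rev size_enum_ord => ltin.
rewrite nth_rev ?size_enum_ord // (nth_map ord0) ?size_enum_ord //.
by apply: val_inj; rewrite /= !nth_enum_ord // subSS ltnS leq_subr.
Qed.

Lemma lex_lt_rev_enum n (f g : 'I_n -> nat) (i : 'I_n) : f i < g i ->
  (forall j : 'I_n, i < j -> f j = g j) ->
  lex_lt (rev [seq f j | j <- enum 'I_n]) (rev [seq g j | j <- enum 'I_n]).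
Proof.
move=> lt eqf; rewrite -(map_rev f) -(map_rev g) rev_enum_ord -(map_comp f) -(map_comp g).
apply: (@lex_lt_enum _ (f \o @rev_ord n) (g \o @rev_ord n) (rev_ord i)) => [|j] /=.
  by rewrite rev_ordK.
by rewrite ltn_subRL => ji; apply: eqf; rewrite /= ltn_subRL addSn addnC -addSn.
Qed.

Section Order.
Variables d e : nat.
Local Notation N := (d + e).
Local Notation V := (Pvar d e).
Local Notation lt := (@mono_lt d e).

Definition pair_mnm (v w : V) : 'X_{1..#|V|} := (U_(enum_rank v) + U_(enum_rank w))%MM.
Definition mult2 (v w z : V) : nat := (v == z) + (w == z).

Lemma pair_mnmE v w z : pair_mnm v w (enum_rank z) = mult2 v w z.
Proof. by rewrite /pair_mnm mnmDE !mnm1E !(inj_eq enum_rank_inj). Qed.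

Lemma exps_pair v w s : exps (pair_mnm v w) s = [seq mult2 v w z | z <- s].
Proof. by apply: eq_map => z; apply: pair_mnmE. Qed.

Lemma multideg_pair (wt : V -> 'I_N -> nat) v w :
  multideg wt (pair_mnm v w) = [seq wt v i + wt w i | i <- enum 'I_N].
Proof.
apply: eq_map => i.
have one u : \sum_(z : V) (u == z) * wt z i = wt u i.
  by rewrite (bigD1 u) //= eqxx mul1n big1 ?addn0 // => z /negPf; rewrite eq_sym => ->.
rewrite (eq_bigr (fun z => (v == z) * wt z i + (w == z) * wt z i)) => [|z _].
  by rewrite big_split !one.
by rewrite pair_mnmE mulnDl.
Qed.

Lemma lt_y2 a b v w (j : 'I_d) : mult2 a b (inl (y2v e j)) < mult2 v w (inl (y2v e j)) ->
  (forall k : 'I_d, k < j -> mult2 a b (inl (y2v e k)) = mult2 v w (inl (y2v e k))) ->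
  lt (pair_mnm a b) (pair_mnm v w).
Proof.
move=> h1 h2; have h : lex_lt (exps (pair_mnm a b) (y2_vars d e)) (exps (pair_mnm v w) (y2_vars d e)).
  rewrite !exps_pair /y2_vars -(map_comp (mult2 a b)) -(map_comp (mult2 v w)).
  exact: (lex_lt_enum h1 h2).
rewrite /mono_lt h; case: eqP => // E; by move: h; rewrite E lex_lt_irr.
Qed.

Definition is_y2 (v : V) := if v is inl (inl (inr _)) then true else false.

Lemma exps_y2_0 a b : ~~ is_y2 a -> ~~ is_y2 b ->
  exps (pair_mnm a b) (y2_vars d e) = [seq 0 | _ <- y2_vars d e].
Proof.
move=> na nb; rewrite exps_pair; apply/eq_in_map => z /mapP[j _ ->].
by rewrite /mult2; case: eqP na => [->|_ _] //; case: eqP nb => [->|_ _].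
Qed.

Definition wt1_tot (v : V) := match v with inl (inl (inr _)) => 0 | inl _ => 1 | inr _ => 2 end.

Lemma sum_wt1 v : \sum_(i < N) wt1 v i = wt1_tot v.
Proof.
have one (k : 'I_N) : \sum_(i < N) (i == k) = 1.
  by rewrite (bigD1 k) //= eqxx big1 ?addn0 // => i /negPf ->.
case: v => [[[j|j]|j]|t] /=; rewrite ?one //; first by rewrite big1.
by rewrite big_split !one.
Qed.

Lemma sumn_mdeg1 v w : sumn (rev (Defs.mdeg1 (pair_mnm v w))) = wt1_tot v + wt1_tot w.
Proof. by rewrite sumn_rev /Defs.mdeg1 multideg_pair sumnE big_map big_enum big_split !sum_wt1. Qed.

(** In equal degree, reverse lexicographic comparison is decided at the smallest basis vector, here
    the lowest column, and the larger entry loses. For [lt_mdeg2] it is the highest column. *)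
Lemma lt_mdeg1 a b v w (i : 'I_N) : ~~ [|| is_y2 a, is_y2 b, is_y2 v | is_y2 w] ->
  wt1_tot a + wt1_tot b = wt1_tot v + wt1_tot w -> wt1 v i + wt1 w i < wt1 a i + wt1 b i ->
  (forall k : 'I_N, k < i -> wt1 v k + wt1 w k = wt1 a k + wt1 b k) ->
  lt (pair_mnm a b) (pair_mnm v w).
Proof.
rewrite !negb_or => /and4P[na nb nv nw] et h1 h2.
rewrite /mono_lt !exps_y2_0 // eqxx /=.
have h : grevlex_lt (rev (Defs.mdeg1 (pair_mnm a b))) (rev (Defs.mdeg1 (pair_mnm v w))).
  rewrite /grevlex_lt !sumn_mdeg1 et eqxx ltnn /= !revK /Defs.mdeg1 !multideg_pair.
  exact: (lex_lt_enum h1 h2).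
rewrite h; case: eqP => // E; by move: h; rewrite E grevlex_lt_irr.
Qed.

Definition is_T (v : V) := if v is inr _ then true else false.
Lemma sum_wt2 v : \sum_(i < N) wt2 v i = is_T v.
Proof.
case: v => [u|t] /=; first by rewrite big1.
by rewrite (bigD1 (val t).1) //= eqxx big1 ?addn0 // => i /negPf ->.
Qed.

Lemma sumn_mdeg2 v w : sumn (mdeg2 (pair_mnm v w)) = is_T v + is_T w.
Proof. by rewrite /mdeg2 multideg_pair sumnE big_map big_enum big_split !sum_wt2. Qed.

Lemma lt_mdeg2 a b v w (i : 'I_N) : ~~ [|| is_y2 a, is_y2 b, is_y2 v | is_y2 w] ->
  (forall k : 'I_N, wt1 v k + wt1 w k = wt1 a k + wt1 b k) ->
  is_T a + is_T b = is_T v + is_T w -> wt2 v i + wt2 w i < wt2 a i + wt2 b i ->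
  (forall k : 'I_N, i < k -> wt2 v k + wt2 w k = wt2 a k + wt2 b k) ->
  lt (pair_mnm a b) (pair_mnm v w).
Proof.
rewrite !negb_or => /and4P[na nb nv nw] e1 et h1 h2.
rewrite /mono_lt !exps_y2_0 // eqxx /=.
have -> : Defs.mdeg1 (pair_mnm a b) = Defs.mdeg1 (pair_mnm v w).
  by rewrite /Defs.mdeg1 !multideg_pair; apply: eq_map => k; rewrite e1.
rewrite eqxx /=.
have h : grevlex_lt (mdeg2 (pair_mnm a b)) (mdeg2 (pair_mnm v w)).
  rewrite /grevlex_lt !sumn_mdeg2 et eqxx ltnn /= /mdeg2 !multideg_pair.
  exact: (lex_lt_rev_enum h1 h2).
rewrite h; case: eqP => // E; by move: h; rewrite E grevlex_lt_irr.
Qed.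

Local Notation idx z := (index z (all_vars d e)).

Lemma lt_last a b v w : ~~ [|| is_y2 a, is_y2 b, is_y2 v | is_y2 w] ->
  (forall k : 'I_N, wt1 v k + wt1 w k = wt1 a k + wt1 b k) ->
  (forall k : 'I_N, wt2 v k + wt2 w k = wt2 a k + wt2 b k) ->
  idx v < idx a -> idx v < idx b -> lt (pair_mnm a b) (pair_mnm v w).
Proof.
rewrite !negb_or => /and4P[na nb nv nw] e1 e2 va vb.
rewrite /mono_lt !exps_y2_0 // eqxx /=.
have -> : Defs.mdeg1 (pair_mnm a b) = Defs.mdeg1 (pair_mnm v w).
  by rewrite /Defs.mdeg1 !multideg_pair; apply: eq_map => k; rewrite e1.
have -> : mdeg2 (pair_mnm a b) = mdeg2 (pair_mnm v w).
  by rewrite /mdeg2 !multideg_pair; apply: eq_map => k; rewrite e2.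
rewrite !eqxx /= !exps_pair.
(* The first variable where the exponents differ: anything earlier occurs in neither product. *)
pose x := if idx w < idx v then w else v.
have xle z : idx z < idx x -> (v == z) = false /\ (w == z) = false.
  move=> h; split; apply/eqP => E; subst z; move: h; rewrite /x; case: ifP; rewrite ?ltnn //.
    by move=> h1 h2; have := ltn_trans h1 h2; rewrite ltnn.
  by move=> ->.
have xv : idx x <= idx v by rewrite /x; case: ifP => // /ltnW.
have ne z u : idx z < idx u -> (u == z) = false.
  by move=> h; apply/eqP => E; move: h; rewrite E ltnn.
have xa := leq_ltn_trans xv va; have xb := leq_ltn_trans xv vb.
apply: (@lex_lt_nth _ _ (mult2 a b) (mult2 v w) x); first exact: mem_all_vars.
  rewrite /mult2 (ne x a xa) (ne x b xb) /x; case: ifP => _; rewrite eqxx //.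
  by rewrite addn1.
move=> z; rewrite in_take ?mem_all_vars // => zx; have [h1 h2] := xle _ zx.
by rewrite /mult2 h1 h2 (ne z a (ltn_trans zx xa)) (ne z b (ltn_trans zx xb)).
Qed.
End Order.

(** * Positions in the final lexicographic order *)

Section Index.
Variable I : eqType.
Implicit Types (x z : I) (s t : seq I).

Lemma index_head s t x z : x \in s -> z \notin s -> index x (s ++ t) < index z (s ++ t).
Proof.
by move=> xs zs; rewrite !index_cat xs (negPf zs) ltn_addr // index_mem.
Qed.

Lemma index_skip s t x z : x \notin s -> z \notin s ->
  (index x (s ++ t) < index z (s ++ t)) = (index x t < index z t).
Proof. by move=> /negPf xs /negPf zs; rewrite !index_cat xs zs ltn_add2l. Qed.

Lemma index_within s t x z : x \in s -> z \in s ->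
  (index x (s ++ t) < index z (s ++ t)) = (index x s < index z s).
Proof. by move=> xs zs; rewrite !index_cat xs zs. Qed.

Lemma index_pmap_insub (P : pred I) (sT : subEqType P) (s : seq I) (u v : sT) :
  index (val u) s < index (val v) s ->
  index u (pmap insub s) < index v (pmap insub s).
Proof.
elim: s => //= x s IH; case: (eqVneq x (val u)) => [->|xu]; case: (eqVneq _ (val v)) => // xv.
  by rewrite valK /= eqxx => _; case: eqP => // E; move: xv; rewrite E eqxx.
rewrite ltnS => /IH; case: insubP => //= w _ wx; rewrite -wx in xu xv.
by rewrite !(inj_eq val_inj) in xu xv; rewrite (negPf xu) (negPf xv) ltnS.
Qed.

Lemma index_allpairs (J : eqType) (s : seq I) (t : seq J) a b : a \in s -> b \in t ->
  index (a, b) [seq (x, y) | x <- s, y <- t] = index a s * size t + index b t.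
Proof.
elim: s => //= x s IH; rewrite inE => as_ bt.
have inrow (y : I) c : ((y, c) \in [seq (x, y) | y <- t]) = (y == x) && (c \in t).
  apply/mapP/andP => [[c' ct [-> ->]]|[/eqP -> ct]]; first by rewrite eqxx.
  by exists c.
rewrite index_cat inrow bt andbT eq_sym; case: (eqVneq x a) as_ => [->|xa] /= as_.
  by rewrite mul0n add0n (@index_map _ _ (fun y => (a, y))) // => ? ? [].
by rewrite size_map IH ?mulSn ?addnA //; move: as_; rewrite eq_sym (negPf xa).
Qed.
End Index.

Section Vars.
Variables d e : nat.
Local Notation N := (d + e).
Local Notation V := (Pvar d e).
Local Notation idx z := (index z (all_vars d e)).

Definition cv (c : 'I_N) : V :=
  match split c with inl j => inl (y1v e j) | inr j => inl (xv d j) end.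
Definition tv (a b : 'I_N) (ab : a < b) : V := inr (exist _ (a, b) ab).

Lemma cv_y1 (c : 'I_N) (cd : c < d) : cv c = inl (y1v e (Ordinal cd)).
Proof.
rewrite /cv; case: splitP => j E; last by exfalso; move: cd; rewrite E ltnNge leq_addr.
by congr (inl (y1v e _)); apply: val_inj.
Qed.

Lemma cv_x (c : 'I_N) : d <= c -> exists2 j : 'I_e, cv c = inl (xv d j) & c = d + j :> nat.
Proof.
rewrite /cv; case: splitP => j E; last by exists j.
by rewrite E leqNgt ltn_ord.
Qed.

Lemma nat_y2 (v : V) : v \in y2_vars d e -> is_y2 v.
Proof. by case/mapP=> j _ ->. Qed.
Lemma not_y2 (v : V) : ~~ is_y2 v -> v \notin y2_vars d e.
Proof. by apply: contra => /nat_y2. Qed.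

Lemma not_y1 (v : V) : (forall j, v != inl (y1v e j)) -> v \notin y1_vars d e.
Proof. by move=> h; apply/mapP => -[j _ E]; have := h j; rewrite E eqxx. Qed.

Lemma idx_y1 (b : 'I_d) v : ~~ is_y2 v -> (forall j : 'I_d, j <= b -> v != inl (y1v e j)) ->
  idx (inl (y1v e b)) < idx v.
Proof.
move=> nv h; rewrite /all_vars index_skip ?not_y2 //.
have bin : inl (y1v e b) \in y1_vars d e by rewrite map_f ?mem_enum.
case: (boolP (v \in y1_vars d e)) => [vin|]; last exact: index_head.
rewrite index_within //; case/mapP: vin => j _ E; rewrite E.
rewrite !(@index_map _ _ (fun j => inl (y1v e j) : V)) ?index_enum_ord => [|? ? []|? ? []] //.
by rewrite ltnNge; apply/negP => jb; have := h j jb; rewrite E eqxx.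
Qed.

Lemma index_x j : index (inl (xv d j) : V) (x_vars d e) = j.
Proof.
by rewrite (@index_map _ _ (fun j => inl (xv d j) : V)) ?index_enum_ord // => ? ? [].
Qed.

Lemma mem_x j : (inl (xv d j) : V) \in x_vars d e.
Proof. by rewrite map_f ?mem_enum. Qed.

Lemma not_x1 (v : V) n : (forall j : 'I_e, v != inl (xv d j)) -> v \notin take n (x_vars d e).
Proof. by move=> h; apply/negP => /mem_take/mapP[j _ E]; have := h j; rewrite E eqxx. Qed.

Lemma idx_x0 (j : 'I_e) v : j = 0 :> nat -> ~~ is_y2 v ->
  (forall k, v != inl (y1v e k)) -> v != inl (xv d j) -> idx (inl (xv d j)) < idx v.
Proof.
move=> j0 nv h vx; rewrite /all_vars index_skip ?not_y2 // index_skip ?not_y1 //.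
apply: index_head; first by rewrite in_take ?mem_x // index_x j0.
apply/negP => vt; have := mem_take vt => /mapP[k _ E]; move: vt; rewrite E in_take ?mem_x // index_x.
by rewrite ltnS leqn0 => /eqP k0; move: vx; rewrite E (_ : k = j) ?eqxx //; apply: val_inj; rewrite /= k0.
Qed.

Lemma mem_T (t : Tvar d e) : (inr t : V) \in T_vars d e.
Proof.
rewrite map_f // mem_pmap_sub; case: t => [[a b] ab] /=.
by apply: allpairs_f; apply: mem_enum.
Qed.

Lemma idx_T (t t' : Tvar d e) :
  (val t).1 < (val t').1 \/ (val t).1 = (val t').1 /\ (val t).2 < (val t').2 ->
  idx (inr t) < idx (inr t').
Proof.
move=> h; rewrite /all_vars index_skip ?not_y2 // index_skip ?not_y1 // index_skip ?not_x1 // index_within ?mem_T //.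
rewrite !(@index_map _ _ (fun t : Tvar d e => inr t : V)) => [|? ? []|? ? []] //.
apply: index_pmap_insub; move: (val t) (val t') h => [a b] [a' b'] /= h.
rewrite !index_allpairs ?mem_enum // !index_enum_ord size_enum_ord.
case: h => [lt|[-> lt]]; last by rewrite ltn_add2l.
apply: (@leq_trans (a.+1 * N)); first by rewrite mulSn addnC ltn_add2r.
by apply: leq_trans (leq_addr _ _); rewrite leq_mul2r lt orbT.
Qed.

Lemma idx_T_x (t : Tvar d e) (j : 'I_e) : 0 < j -> idx (inr t) < idx (inl (xv d j)).
Proof.
move=> j0; have nx : (inl (xv d j) : V) \notin take 1 (x_vars d e).
  by rewrite in_take ?mem_x // index_x -leqNgt.
rewrite /all_vars index_skip ?not_y2 // index_skip ?not_y1 // index_skip ?nx ?not_x1 //; apply: index_head; first exact: mem_T.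
by apply/mapP => -[].
Qed.
End Vars.

Local Open Scope ring_scope.

Section Lead.
Variables (K : fieldType) (d e : nat).
Local Notation N := (d + e)%N.
Local Notation V := (Pvar d e).
Local Notation lt := (@mono_lt d e).
Local Notation P := (@Pring K d e).
Local Notation varP := (@varP K d e).
Local Notation SinP := (@SinP K d e).
Local Notation Lmx := (@Lmx K d e).
Local Notation T := (@T K d e).

Definition var_wt (v : V) : nat :=
  match v with
  | inl (inl (inl j)) => col_wt d j
  | inl (inl (inr j)) => (col_wt d j).+1
  | inl (inr j) => j.+1
  | inr t => (col_wt d (val t).1 + col_wt d (val t).2).+1
  end.

(** T-degree and weight are recorded together with the order, so that division can be used in the
    counting argument, where both are fixed. *)
Definition smaller (v w : V) (i : V * V) :=
  [/\ lt (pair_mnm i.1 i.2) (pair_mnm v w), (is_T i.1 + is_T i.2 = is_T v + is_T w)%N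
    & (var_wt i.1 + var_wt i.2 = var_wt v + var_wt w)%N].

(** The relation is displayed with its tail as a list of quadratic terms, because division rewrites
    the leading pair by exactly this list. *)
Definition lead_pair (v w : V) := exists (g : P) (c : K) (s : seq (K * (V * V))),
  [/\ rees_relation g, c != 0,
      g = c *: 'X_[pair_mnm v w] + \sum_(i <- s) i.1 *: 'X_[pair_mnm i.2.1 i.2.2]
    & forall i, i \in s -> smaller v w i.2].

Lemma varPM u w : varP u * varP w = 'X_[pair_mnm u w].
Proof. by rewrite /Defs.varP -mpolyXD. Qed.

Lemma SinP_var v : SinP (@varS K d e v) = varP (inl v).
Proof. by rewrite /Defs.SinP mmapX mmap1U /= enum_rankK. Qed.

Lemma SinP_0 : SinP 0 = 0. Proof. exact: raddf0. Qed.

Lemma SinP_L0 (c : 'I_N) : SinP (Lmx 0 c) = varP (cv c).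
Proof.
rewrite mxE /cv; case: splitP => k E; first by rewrite SinP_var.
by rewrite /xS add0n valK /= SinP_var.
Qed.

Lemma SinP_L1y (c : 'I_N) (cd : (c < d)%N) : SinP (Lmx 1 c) = varP (inl (y2v e (Ordinal cd))).
Proof.
rewrite mxE; case: splitP => k E; last by exfalso; move: cd; rewrite E ltnNge leq_addr.
by rewrite SinP_var; congr (varP (inl (y2v e _))); apply: val_inj.
Qed.

Lemma SinP_L1x (c c1 : 'I_N) : (d <= c)%N -> c1 = c.+1 :> nat -> SinP (Lmx 1 c) = varP (cv c1).
Proof.
move=> dc cc; rewrite mxE; case: splitP => k E; first by rewrite E leqNgt ltn_ord in dc.
have [j -> Ej] := @cv_x _ _ c1 (leq_trans dc (eq_ind _ (fun z => (c <= z)%N) (leqnSn c) _ (esym cc))).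
have -> : (1 + k)%N = j by apply/eqP; rewrite -(eqn_add2l d) -Ej cc E add1n addnS.
by rewrite /xS valK /= SinP_var.
Qed.

Lemma SinP_L1_last (c : 'I_N) : (d <= c)%N -> c.+1 = N -> SinP (Lmx 1 c) = 0.
Proof.
move=> dc cN; rewrite mxE; case: splitP => k E; first by rewrite E leqNgt ltn_ord in dc.
rewrite /xS insubN ?SinP_0 //= -leqNgt add1n -(leq_add2l d) addnS -E cN //.
Qed.

Lemma T_var (a b : 'I_N) (ab : (a < b)%N) : T a b = varP (tv ab).
Proof. by rewrite /Defs.T insubT. Qed.

Lemma wt1_cv (c i : 'I_N) : wt1 (cv c) i = (i == c).
Proof.
rewrite /cv; case: splitP => j E /=.
  by rewrite (_ : lshift e j = c) //; apply: val_inj.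
by rewrite (_ : rshift d j = c) //; apply: val_inj.
Qed.

Lemma wt1_tv (a b i : 'I_N) (ab : (a < b)%N) : wt1 (tv ab) i = ((i == a) + (i == b))%N.
Proof. by []. Qed.
Lemma wt2_tv (a b i : 'I_N) (ab : (a < b)%N) : wt2 (tv ab) i = (i == a).
Proof. by []. Qed.
Lemma wt2_cv (c i : 'I_N) : wt2 (cv c) i = 0%N.
Proof. by rewrite /cv; case: splitP. Qed.
Lemma y2_cv (c : 'I_N) : is_y2 (cv c) = false.
Proof. by rewrite /cv; case: splitP. Qed.
Lemma is_T_cv (c : 'I_N) : is_T (cv c) = false.
Proof. by rewrite /cv; case: splitP. Qed.
Lemma tot_cv (c : 'I_N) : wt1_tot (cv c) = 1%N.
Proof. by rewrite /cv; case: splitP. Qed.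
Lemma var_wt_cv (c : 'I_N) : var_wt (cv c) = col_wt d c.
Proof.
rewrite /cv; case: splitP => j -> //=.
by rewrite /col_wt ltnNge leq_addr /= addKn.
Qed.

Lemma var_wt_tv (a b : 'I_N) (ab : (a < b)%N) : var_wt (tv ab) = (col_wt d a + col_wt d b).+1.
Proof. by []. Qed.

Lemma ord_neq (a b : 'I_N) : (a < b)%N -> (a == b) = false /\ (b == a) = false.
Proof. by move=> ab; split; rewrite -val_eqE /= (ltn_eqF ab, gtn_eqF ab). Qed.

Lemma cv_notT t (c : 'I_N) : cv c != inr t.
Proof. by rewrite /cv; case: splitP. Qed.

Lemma idx_y1_cv (b c : 'I_N) (bd : (b < d)%N) : (b < c)%N ->
  (index (inl (y1v e (Ordinal bd)) : V) (all_vars d e) < index (cv c) (all_vars d e))%N.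
Proof.
move=> bc; apply: idx_y1; rewrite ?y2_cv // => j; rewrite /= => jb.
rewrite /cv; case: splitP => k E //; apply/eqP => -[] E'.
by move: bc; rewrite E E' ltnNge jb.
Qed.

Lemma idx_x0_cv (b c : 'I_N) : b = d :> nat -> (b < c)%N ->
  (index (cv b) (all_vars d e) < index (cv c) (all_vars d e))%N.
Proof.
move=> bd bc; have [j -> Ej] := @cv_x _ _ b (eq_leq (esym bd)).
have [k -> Ek] := @cv_x _ _ c (leq_trans (eq_leq (esym bd)) (ltnW bc)).
apply: idx_x0 => //; first by apply/eqP; rewrite -(eqn_add2l d) -Ej bd addn0.
by apply/eqP => -[] /(congr1 val) /= E; move: bc; rewrite Ej Ek E ltnn.
Qed.

Lemma smaller_U_mdeg2 (a b g : 'I_N) (ab : (a < b)%N) (bg : (b < g)%N) (ag : (a < g)%N) :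
  smaller (cv b) (tv ag) (cv a, tv bg).
Proof.
have [n1 n2] := ord_neq ab; split=> /=; rewrite ?is_T_cv ?var_wt_cv ?var_wt_tv; last 2 first.
- by [].
- by rewrite !addnS; congr _.+1; rewrite addnCA.
apply: (lt_mdeg2 (i := b)); rewrite ?y2_cv ?is_T_cv //.
- by move=> k; rewrite !wt1_cv !wt1_tv addnCA.
- by rewrite !wt2_cv !wt2_tv eqxx n2.
- move=> k bk; rewrite !wt2_cv !wt2_tv (ord_neq bk).2.
  by rewrite (ord_neq (ltn_trans ab bk)).2.
Qed.

Lemma smaller_U_last (a b g : 'I_N) (ab : (a < b)%N) (bg : (b < g)%N) (ag : (a < g)%N) :
  (b <= d)%N -> smaller (cv b) (tv ag) (cv g, tv ab).
Proof.
move=> bd; split=> /=; rewrite ?is_T_cv ?var_wt_cv ?var_wt_tv; last 2 first.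
- by [].
- rewrite !addnS; congr _.+1; by rewrite addnC -addnA addnCA.
have ineq (z : V) : z = cv g \/ z = tv ab -> (index (cv b) (all_vars d e) < index z (all_vars d e))%N.
  move=> hz; case: (ltngtP b d) bd => // bd _.
    rewrite (cv_y1 bd); case: hz => ->; first exact: idx_y1_cv.
    by apply: idx_y1.
  case: hz => ->; first exact: idx_x0_cv.
  have [j -> Ej] := @cv_x _ _ b (eq_leq (esym bd)); apply: idx_x0 => //.
  by apply/eqP; rewrite -(eqn_add2l d) -Ej bd addn0.
apply: lt_last; rewrite ?y2_cv //.
- by move=> k; rewrite !wt1_cv !wt1_tv; rewrite addnC -addnA addnCA.
- by move=> k; rewrite !wt2_cv !wt2_tv.
- by apply: ineq; left.
- by apply: ineq; right.
Qed.

Lemma smaller_V_mdeg2 (a b g : 'I_N) (ab : (a < b)%N) (bg : (b < g)%N) :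
  smaller (tv ab) (cv g) (cv a, tv bg).
Proof.
have [n1 n2] := ord_neq ab; split=> /=; rewrite ?is_T_cv ?var_wt_cv ?var_wt_tv; last 2 first.
- by [].
- by lia.
apply: (lt_mdeg2 (i := b)); rewrite ?y2_cv ?is_T_cv //.
- by move=> k; rewrite !wt1_cv !wt1_tv; case: (k == a); case: (k == b); case: (k == g).
- by rewrite !wt2_cv !wt2_tv eqxx n2.
- move=> k bk; rewrite !wt2_cv !wt2_tv (ord_neq bk).2.
  by rewrite (ord_neq (ltn_trans ab bk)).2.
Qed.

Lemma smaller_V_last (a b g : 'I_N) (ab : (a < b)%N) (bg : (b < g)%N) (ag : (a < g)%N) :
  (d < b)%N -> smaller (tv ab) (cv g) (cv b, tv ag).
Proof.
move=> db; split=> /=; rewrite ?is_T_cv ?var_wt_cv ?var_wt_tv; last 2 first.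
- by [].
- by lia.
apply: lt_last; rewrite ?y2_cv //.
- by move=> k; rewrite !wt1_cv !wt1_tv; case: (k == a); case: (k == b); case: (k == g).
- by move=> k; rewrite !wt2_cv !wt2_tv addn0.
- have [j -> Ej] := @cv_x _ _ b (ltnW db); apply: idx_T_x.
  by move: db; rewrite Ej -{1}[d]addn0 ltn_add2l.
- by apply: idx_T => /=; right.
Qed.

Lemma smaller_Ly (a b g a' b' : 'I_N) (ad : (a < d)%N) (bg : (b < g)%N) (ab' : (a' < b')%N) u :
    is_T u = false -> (forall k : 'I_d, (k <= a)%N -> u != inl (y2v e k)) ->
    (var_wt u + (col_wt d a' + col_wt d b') = (col_wt d a).+1 + (col_wt d b + col_wt d g))%N ->
  smaller (inl (y2v e (Ordinal ad))) (tv bg) (u, tv ab').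
Proof.
move=> uT uy uo; split=> /=; rewrite ?uT // ?addnS ?uo //.
apply: (lt_y2 (j := Ordinal ad)) => [|k ka]; rewrite /mult2.
  by rewrite (negPf (uy _ _)) //= eqxx.
rewrite (negPf (uy _ _)) ?(ltnW ka) //=; case: eqP => // -[] E.
by move: ka; rewrite -E /= ltnn.
Qed.

Lemma smaller_Lx (a b g a1 c1 a' b' : 'I_N) (bg : (b < g)%N) (ab' : (a' < b')%N) :
    (a < b)%N -> (a < a1)%N -> (a <= c1)%N -> (a <= a')%N -> ((c1 == a) || (a' == a)) ->
    (col_wt d c1 + (col_wt d a' + col_wt d b') = col_wt d a1 + (col_wt d b + col_wt d g))%N ->
  smaller (cv a1) (tv bg) (cv c1, tv ab').
Proof.
move=> ab aa1 ac1 aa' ex uo; split=> /=; rewrite ?is_T_cv ?var_wt_cv ?var_wt_tv ?addnS ?uo //.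
have f1 (k z : 'I_N) : (k < a)%N -> (a <= z)%N -> (k == z) = false.
  by move=> ka az; rewrite (ord_neq (leq_trans ka az)).1.
apply: (lt_mdeg1 (i := a)); rewrite ?y2_cv ?tot_cv //.
  rewrite !wt1_cv !wt1_tv (ord_neq ab).1 (ord_neq aa1).1 (ord_neq (ltn_trans ab bg)).1.
  by case/orP: ex => /eqP ->; rewrite eqxx ?addn_gt0 ?orbT.
move=> k ka; rewrite !wt1_cv !wt1_tv.
by rewrite !f1 ?(ltnW aa1) ?(ltnW ab) ?(ltnW (ltn_trans ab bg)) // (leq_trans aa' (ltnW ab')).
Qed.

Lemma smaller_P_mdeg2 (a b g h : 'I_N) (ab : (a < b)%N) (bh : (b < h)%N) (ag : (a < g)%N) (gh : (g < h)%N) :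
  (b < g)%N -> smaller (tv ag) (tv bh) (tv ab, tv gh).
Proof.
move=> bg; split=> //=; last by lia.
apply: (lt_mdeg2 (i := g)) => //.
- by move=> k; rewrite !wt1_tv addnACA.
- by rewrite !wt2_tv eqxx (ord_neq ag).2 (ord_neq bg).2.
- move=> k gk; rewrite !wt2_tv (ord_neq gk).2 (ord_neq (ltn_trans ag gk)).2.
  by rewrite (ord_neq (ltn_trans bg gk)).2.
Qed.

Lemma smaller_P_last (a b g h : 'I_N) (ah : (a < h)%N) (bh : (b < h)%N) (ag : (a < g)%N) (bg : (b < g)%N) :
  (a < b)%N -> (g < h)%N -> smaller (tv ag) (tv bh) (tv ah, tv bg).
Proof.
move=> ab gh; split=> //=; last by lia.
apply: lt_last => //.
- by move=> k; rewrite !wt1_tv; case: (k == a); case: (k == b); case: (k == g); case: (k == h).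
- by apply: idx_T; right.
- by apply: idx_T; left.
Qed.

Lemma smaller_LAP (i a1 b1 g h u1 u2 u3 u4 : 'I_N) (ab : (a1 < b1)%N) (gh : (g < h)%N)
    (u12 : (u1 < u2)%N) (u34 : (u3 < u4)%N) :
    (forall k : 'I_N, (k < i)%N -> ((k == a1) + (k == b1) + ((k == g) + (k == h)) =
       (k == u1) + (k == u2) + ((k == u3) + (k == u4)))%N) ->
    ((i == a1) + (i == b1) + ((i == g) + (i == h)) < (i == u1) + (i == u2) + ((i == u3) + (i == u4)))%N ->
    (col_wt d u1 + col_wt d u2 + (col_wt d u3 + col_wt d u4) =
      col_wt d a1 + col_wt d b1 + (col_wt d g + col_wt d h))%N ->
  smaller (tv ab) (tv gh) (tv u12, tv u34).
Proof.
move=> h1 h2 h3; split=> //=; last by rewrite !addSn !addnS h3.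
by apply: (lt_mdeg1 (i := i)).
Qed.

End Lead.

Section LeadPairs.
Variables (K : fieldType) (d e : nat).
Local Notation N := (d + e)%N.
Local Notation V := (Pvar d e).
Local Notation lead_pair := (@lead_pair K d e).
Local Notation varP := (@varP K d e).
Local Notation SinP := (@SinP K d e).
Local Notation Lmx := (@Lmx K d e).

Lemma lead_U (a b g : 'I_N) (ab : (a < b)%N) (bg : (b < g)%N) (ag : (a < g)%N) :
  (b <= d)%N -> lead_pair (cv b) (tv ag).
Proof.
move=> bd; exists (UEN K a b g), (-1), [:: (1, (cv a, tv bg)); (1, (cv g, tv ab))]; split.
- by apply: rel_UEN; rewrite ab.
- by rewrite oppr_eq0 oner_eq0.
- rewrite /UEN /EN !SinP_L0 !T_var !varPM !big_cons big_nil /= !scale1r scaleN1r addr0.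
  by rewrite addrCA addrA.
- move=> i; rewrite !inE => /orP[] /eqP -> /=; first exact: smaller_U_mdeg2.
  exact: smaller_U_last.
Qed.

Lemma lead_V (a b g : 'I_N) (ab : (a < b)%N) (bg : (b < g)%N) :
  (d < b)%N -> lead_pair (tv ab) (cv g).
Proof.
move=> db; have ag := ltn_trans ab bg.
exists (UEN K a b g), 1, [:: (1, (cv a, tv bg)); (-1, (cv b, tv ag))]; split.
- by apply: rel_UEN; rewrite ab.
- exact: oner_neq0.
- rewrite /UEN /EN !SinP_L0 !T_var [varP (cv g) * _]mulrC !varPM !big_cons big_nil /=.
  by rewrite !scale1r scaleN1r addr0 addrC.
- move=> i; rewrite !inE => /orP[] /eqP -> /=; first exact: smaller_V_mdeg2.
  exact: smaller_V_last.
Qed.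

(** The list has one element, or none for the final entry 0; this treats the y columns, the x
    columns and the last column of LEN uniformly. *)
Lemma second_row (c : 'I_N) : exists s : seq V, SinP (Lmx 1 c) = \sum_(u <- s) varP u /\
  forall u, u \in s -> [/\ is_T u = false, var_wt u = (col_wt d c).+1,
    forall cd : (c < d)%N, u = inl (y2v e (Ordinal cd)) &
    (d <= c)%N -> exists2 c1 : 'I_N, c1 = c.+1 :> nat & u = cv c1].
Proof.
have /orP[cd|cd] : (c < d)%N || (d <= c)%N by case: ltnP.
  exists [:: inl (y2v e (Ordinal cd))]; rewrite big_seq1 (SinP_L1y K cd); split=> // u.
  rewrite inE => /eqP ->; split=> // [cd'|].
    by congr (inl (y2v e _)); apply: val_inj.
  by rewrite leqNgt cd.
have [cN|cN] := ltnP c.+1 N.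
  exists [:: cv (Ordinal cN)]; rewrite big_seq1 (SinP_L1x K (c1 := Ordinal cN)) //; split=> // u.
  rewrite inE => /eqP ->; rewrite is_T_cv var_wt_cv /col_wt /=; split=> //.
  - by rewrite ltnNge (leqW cd) /= ltnNge cd subSn.
  - by move=> cd'; exfalso; move: cd; rewrite leqNgt cd'.
  - by exists (Ordinal cN).
exists [::]; rewrite big_nil SinP_L1_last //.
by apply/eqP; rewrite eqn_leq cN andbT.
Qed.

Lemma lead_O (a b g : 'I_N) (ad : (a < d)%N) (ab : (a < b)%N) (bg : (b < g)%N) :
  lead_pair (inl (y2v e (Ordinal ad))) (tv bg).
Proof.
have ag := ltn_trans ab bg.
have [sb [eb hb]] := second_row b; have [sg [eg hg]] := second_row g.
exists (LEN K a b g), 1, ([seq (-1, (u, tv ag)) | u <- sb] ++ [seq (1, (u, tv ab)) | u <- sg]); split.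
- by apply: rel_LEN; rewrite ab.
- exact: oner_neq0.
- rewrite /LEN /EN eb eg (SinP_L1y K ad) !T_var !mulr_suml !varPM scale1r -addrA; congr (_ + _).
  rewrite big_cat !big_map -sumrN; congr (_ + _); apply: eq_bigr => u _ /=.
    by rewrite varPM scaleN1r.
  by rewrite varPM scale1r.
- have ne c u : (a < c)%N -> (forall cd : (c < d)%N, u = inl (y2v e (Ordinal cd))) ->
     ((d <= c)%N -> exists2 c1 : 'I_N, c1 = c.+1 :> nat & u = cv c1) ->
     forall k : 'I_d, (k <= a)%N -> u != inl (y2v e k).
    move=> ac h1 h2 k ka; have /orP[cd|/h2[c1 _ ->]] : (c < d)%N || (d <= c)%N by case: ltnP.
      by rewrite (h1 cd); apply/eqP => -[] E; move: ka; rewrite -E /= leqNgt ac.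
    by apply/eqP => E; have := y2_cv c1; rewrite E.
  move=> i; rewrite mem_cat => /orP[] /mapP[u us ->] /=.
    have [h1 h2 h3 h4] := hb u us; apply: smaller_Ly => //; first exact: ne h3 h4.
    by rewrite h2; lia.
  have [h1 h2 h3 h4] := hg u us; apply: smaller_Ly => //; first exact: ne h3 h4.
  by rewrite h2; lia.
Qed.

Lemma col_wt_next (c c1 : 'I_N) : (d <= c)%N -> c1 = c.+1 :> nat -> col_wt d c1 = (col_wt d c).+1.
Proof. by move=> dc ->; rewrite /col_wt !ltnNge dc (leqW dc) subSn. Qed.

Lemma lead_C (a a1 b g : 'I_N) (ab : (a < b)%N) (bg : (b < g)%N) :
  (d <= a)%N -> a1 = a.+1 :> nat -> lead_pair (cv a1) (tv bg).
Proof.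
move=> da ea; have ag := ltn_trans ab bg; have aa1 : (a < a1)%N by rewrite ea.
have [sb [eb hb]] := second_row b; have [sg [eg hg]] := second_row g.
exists (LEN K a b g), 1, ([seq (-1, (u, tv ag)) | u <- sb] ++ [seq (1, (u, tv ab)) | u <- sg]); split.
- by apply: rel_LEN; rewrite ab.
- exact: oner_neq0.
- rewrite /LEN /EN eb eg (SinP_L1x K da ea) !T_var !mulr_suml !varPM scale1r -addrA; congr (_ + _).
  rewrite big_cat !big_map -sumrN; congr (_ + _); apply: eq_bigr => u _ /=.
    by rewrite varPM scaleN1r.
  by rewrite varPM scale1r.
- move=> i; rewrite mem_cat => /orP[] /mapP[u us ->] /=.
    have [_ _ _ /(_ (ltnW (leq_ltn_trans da ab)))[c1 ec ->]] := hb u us.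
    apply: (@smaller_Lx d e a b g a1 c1 a g) => //; rewrite ?eqxx ?orbT //.
      by rewrite ec ltnW // ltnW.
    by rewrite (col_wt_next da ea) (col_wt_next (ltnW (leq_ltn_trans da ab)) ec); lia.
  have [_ _ _ /(_ (ltnW (leq_ltn_trans da ag)))[c1 ec ->]] := hg u us.
  apply: (@smaller_Lx d e a b g a1 c1 a b) => //; rewrite ?eqxx ?orbT //.
    by rewrite ec ltnW // ltnW.
  by rewrite (col_wt_next da ea) (col_wt_next (ltnW (leq_ltn_trans da ag)) ec); lia.
Qed.

Lemma lead_P (a b g h : 'I_N) (ag : (a < g)%N) (bh : (b < h)%N) :
  (a < b)%N -> (b < g)%N -> (g < h)%N -> lead_pair (tv ag) (tv bh).
Proof.
move=> ab bg gh; have ah := ltn_trans ag gh.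
exists (PLU K a b g h), (-1), [:: (1, (tv ab, tv gh)); (1, (tv ah, tv bg))]; split.
- by apply: rel_PLU => //; rewrite ab.
- by rewrite oppr_eq0 oner_eq0.
- rewrite /PLU !T_var !varPM !big_cons big_nil /= !scale1r scaleN1r addr0.
  by rewrite addrCA addrA.
- move=> i; rewrite !inE => /orP[] /eqP -> /=; first exact: smaller_P_mdeg2.
  exact: smaller_P_last.
Qed.

Lemma lead_LAP (a b g h a1 b1 : 'I_N) (ab1 : (a1 < b1)%N) (gh : (g < h)%N) :
  (d <= a)%N -> (a < b)%N -> (b < g)%N -> a1 = a.+1 :> nat -> b1 = b.+1 :> nat ->
  lead_pair (tv ab1) (tv gh).
Proof.
move=> da ab bg ea eb.
have ag := ltn_trans ab bg; have ah := ltn_trans ag gh; have bh := ltn_trans bg gh.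
have hN := ltn_ord h; have eS (c : 'I_N) : (c < h)%N -> ordS c = c.+1 :> nat.
  by move=> ch; rewrite /= modn_small // (leq_ltn_trans ch hN).
have Ea : ordS a = a1 by apply: val_inj; rewrite [LHS]eS.
have Eb : ordS b = b1 by apply: val_inj; rewrite [LHS]eS.
have [g1 Eg] : {g1 | ordS g = g1} by exists (ordS g).
have eg : g1 = g.+1 :> nat by rewrite -Eg eS.
have b1g1 : (b1 < g1)%N by rewrite eb eg.
have a1g1 : (a1 < g1)%N by rewrite ea eg (leq_ltn_trans ag).
have wa := col_wt_next da ea; have wb := col_wt_next (ltnW (leq_ltn_trans da ab)) eb.
have wg : col_wt d g1 = (col_wt d g).+1.
  by apply: col_wt_next eg; rewrite (leq_trans da) // ltnW.
have neq (k c : 'I_N) : (k < c)%N -> (k == c) = false by move=> kc; have [] := ord_neq kc.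
have [hlast|hlast] := eqVneq h.+1 N.
  exists (LAP_last K a b g h), 1, [:: (1, (tv ah, tv b1g1)); (-1, (tv bh, tv a1g1))]; split.
  - by apply: rel_LAP_last => //; rewrite ab.
  - exact: oner_neq0.
  - rewrite /LAP_last Ea Eb Eg !T_var [varP (tv gh) * _]mulrC !varPM.
    by rewrite !big_cons big_nil /= !scale1r scaleN1r addr0 addrC.
  (* A term containing column [a] is decided at [a], which the leading pair avoids. The others, here
     and in LAP below, contain [a1] like the leading pair and are decided at [b], of which they
     contain one more copy, also when [b = a1]. *)
  - move=> i; rewrite !inE => /orP[] /eqP -> /=.
      apply: (@smaller_LAP _ _ a) => [k ka||]; last by lia.
        by rewrite !neq //; lia.
      by rewrite eqxx !neq //; lia.
    apply: (@smaller_LAP _ _ b) => [k kb||]; last by lia.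
      by rewrite (neq k b1) ?(neq k g) ?(neq k h) ?(neq k b) ?(neq k g1) //; lia.
    by rewrite eqxx (neq b b1) ?(neq b g) ?(neq b h) ?(neq b g1) //; lia.
have hN1 : (h.+1 < N)%N by rewrite ltn_neqAle hlast.
have [h1 Eh] : {h1 | ordS h = h1} by exists (ordS h).
have eh : h1 = h.+1 :> nat by rewrite -Eh /= modn_small.
have g1h1 : (g1 < h1)%N by rewrite eg eh.
have b1h1 : (b1 < h1)%N := ltn_trans b1g1 g1h1.
have a1h1 : (a1 < h1)%N := ltn_trans a1g1 g1h1.
have wh : col_wt d h1 = (col_wt d h).+1.
  by apply: col_wt_next eh; rewrite (leq_trans da) // ltnW.
exists (LAP K a b g h), 1, [:: (1, (tv ab, tv g1h1)); (-1, (tv ag, tv b1h1)); (1, (tv ah, tv b1g1));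
  (1, (tv bg, tv a1h1)); (-1, (tv bh, tv a1g1))]; split.
- by apply: rel_LAP => //; rewrite ab.
- exact: oner_neq0.
- rewrite /LAP Ea Eb Eg Eh !T_var [varP (tv gh) * _]mulrC !varPM.
  by rewrite !big_cons big_nil /= !scale1r !scaleN1r addr0 addrC !addrA.
- move=> i; rewrite !inE => /or4P[|||/orP[]] /eqP -> /=.
  + apply: (@smaller_LAP _ _ a) => [k ka||]; last by lia.
      by rewrite !neq //; lia.
    by rewrite eqxx !neq //; lia.
  + apply: (@smaller_LAP _ _ a) => [k ka||]; last by lia.
      by rewrite !neq //; lia.
    by rewrite eqxx !neq //; lia.
  + apply: (@smaller_LAP _ _ a) => [k ka||]; last by lia.
      by rewrite !neq //; lia.
    by rewrite eqxx !neq //; lia.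
  + apply: (@smaller_LAP _ _ b) => [k kb||]; last by lia.
      by rewrite (neq k b1) ?(neq k g) ?(neq k h) ?(neq k b) ?(neq k h1) //; lia.
    by rewrite eqxx (neq b b1) ?(neq b g) ?(neq b h) ?(neq b h1) //; lia.
  + apply: (@smaller_LAP _ _ b) => [k kb||]; last by lia.
      by rewrite (neq k b1) ?(neq k g) ?(neq k h) ?(neq k b) ?(neq k g1) //; lia.
    by rewrite eqxx (neq b b1) ?(neq b g) ?(neq b h) ?(neq b g1) //; lia.
Qed.
End LeadPairs.

(** * Division *)

Section Identities.
Variable R : comNzRingType.
Implicit Types (p q s t : R).

Lemma det3_row0 p1 p2 p3 q1 q2 q3 t :
  p1 * ((p2 * q3 - p3 * q2) * t) - p2 * ((p1 * q3 - p3 * q1) * t)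
    + p3 * ((p1 * q2 - p2 * q1) * t) = 0.
Proof. ring. Qed.

Lemma det3_row1 p1 p2 p3 q1 q2 q3 t :
  q1 * ((p2 * q3 - p3 * q2) * t) - q2 * ((p1 * q3 - p3 * q1) * t)
    + q3 * ((p1 * q2 - p2 * q1) * t) = 0.
Proof. ring. Qed.

Lemma plucker_identity p1 p2 p3 p4 q1 q2 q3 q4 t :
  (p1 * q2 - p2 * q1) * t * ((p3 * q4 - p4 * q3) * t)
  - (p1 * q3 - p3 * q1) * t * ((p2 * q4 - p4 * q2) * t)
  + (p1 * q4 - p4 * q1) * t * ((p2 * q3 - p3 * q2) * t) = 0.
Proof. ring. Qed.

(* Laplace expansion of a 4 x 4 determinant with rows p, q, q, s. *)
Lemma laplace_identity p1 p2 p3 p4 q1 q2 q3 q4 s1 s2 s3 s4 t :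
  (p1 * q2 - p2 * q1) * t * ((q3 * s4 - q4 * s3) * t)
  - (p1 * q3 - p3 * q1) * t * ((q2 * s4 - q4 * s2) * t)
  + (p1 * q4 - p4 * q1) * t * ((q2 * s3 - q3 * s2) * t)
  + (p2 * q3 - p3 * q2) * t * ((q1 * s4 - q4 * s1) * t)
  - (p2 * q4 - p4 * q2) * t * ((q1 * s3 - q3 * s1) * t)
  + (p3 * q4 - p4 * q3) * t * ((q1 * s2 - q2 * s1) * t) = 0.
Proof. ring. Qed.

(** The case [q4 = s4 = 0] of [laplace_identity]: beyond the last column the matrix continues by
    zeros. *)
Lemma laplace_identity_last p1 p2 p3 p4 q1 q2 q3 s1 s2 s3 t :
  (p1 * 0 - p4 * q1) * t * ((q2 * s3 - q3 * s2) * t)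
  - (p2 * 0 - p4 * q2) * t * ((q1 * s3 - q3 * s1) * t)
  + (p3 * 0 - p4 * q3) * t * ((q1 * s2 - q2 * s1) * t) = 0.
Proof. ring. Qed.
End Identities.

Section Kernel.
Variables (K : fieldType) (d e : nat) (R : comNzRingType).
Local Notation N := (d + e)%N.
Local Notation P := (@Pring K d e).
Local Notation SinP := (@SinP K d e).
Local Notation Lmx := (@Lmx K d e).
Variables (phi : {rmorphism P -> R}) (r0 r1 : 'I_N -> R) (tau : R).
Hypothesis phi0 : forall c, phi (SinP (Lmx 0 c)) = r0 c.
Hypothesis phi1 : forall c, phi (SinP (Lmx 1 c)) = r1 c.
Hypothesis phiT : forall a b : 'I_N, (a < b)%N -> phi (T K a b) = (r0 a * r1 b - r0 b * r1 a) * tau.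

(** Only the fact that the T variables go to scaled minors matters, so one proof serves both the
    presentation [piR] and the specialization [eval]. *)
Lemma relation_kernel g : rees_relation g -> phi g = 0.
Proof.
have sh (c c1 : 'I_N) : (d <= c)%N -> c1 = c.+1 :> nat -> r1 c = r0 c1.
  by move=> dc cc; rewrite -phi1 (SinP_L1x K dc cc) -SinP_L0 phi0.
have last (c : 'I_N) : (d <= c)%N -> c.+1 = N -> r1 c = 0.
  by move=> dc cN; rewrite -phi1 SinP_L1_last // rmorph0.
have eS (c : 'I_N) : (c.+1 < N)%N -> ordS c = c.+1 :> nat.
  by move=> ch; rewrite /= modn_small.
case=> {g} [a b g /andP[ab bg]|a b g /andP[ab bg]|a b g h /andP[ab bg] gh|
  a b g h da /andP[ab bg] gh hN|a b g h da /andP[ab bg] gh hN].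
- have ag := ltn_trans ab bg; rewrite /UEN /EN rmorphD rmorphB !rmorphM /= !phi0 !phiT //; exact: det3_row0.
- have ag := ltn_trans ab bg; rewrite /LEN /EN rmorphD rmorphB !rmorphM /= !phi1 !phiT //; exact: det3_row1.
- have ag := ltn_trans ab bg; have bh := ltn_trans bg gh; have ah := ltn_trans ab bh.
  rewrite /PLU rmorphD rmorphB !rmorphM /= !phiT //; exact: plucker_identity.
- have ag := ltn_trans ab bg; have bh := ltn_trans bg gh; have ah := ltn_trans ab bh.
  have gN := leq_ltn_trans gh (ltnW hN).
  have bN := ltn_trans (bg : b.+1 < g.+1)%N gN; have aN := ltn_trans (ab : a.+1 < b.+1)%N bN.
  have db := ltnW (leq_ltn_trans da ab); have dg := ltnW (leq_ltn_trans db bg).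
  have dh := ltnW (leq_ltn_trans dg gh).
  rewrite /LAP !(rmorphD, rmorphN, rmorphM) /= !phiT // ?eS //.
  rewrite -!(sh _ _ _ (eS _ _)) //; exact: laplace_identity.
- have ag := ltn_trans ab bg; have bh := ltn_trans bg gh; have ah := ltn_trans ab bh.
  have gN : (g.+1 < N)%N := leq_ltn_trans gh (ltn_ord h).
  have bN := ltn_trans (bg : b.+1 < g.+1)%N gN; have aN := ltn_trans (ab : a.+1 < b.+1)%N bN.
  have db := ltnW (leq_ltn_trans da ab); have dg := ltnW (leq_ltn_trans db bg).
  have dh := ltnW (leq_ltn_trans dg gh).
  rewrite /LAP_last !(rmorphD, rmorphN, rmorphM) /= !phiT // ?eS //.
  rewrite -!(sh _ _ _ (eS _ _)) // (last h) //; exact: laplace_identity_last.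
Qed.
End Kernel.

Section Reduce.
Variables (K : fieldType) (d e : nat).
Local Notation N := (d + e)%N.
Local Notation V := (Pvar d e).
Local Notation P := (@Pring K d e).
Local Notation lt := (@mono_lt d e).
Implicit Type m : 'X_{1..#|V|}.

Definition grade (f : V -> nat) m := (\sum_(v : V) m (enum_rank v) * f v)%N.

Lemma gradeD f m1 m2 : grade f (m1 + m2)%MM = (grade f m1 + grade f m2)%N.
Proof. by rewrite /grade -big_split; apply: eq_bigr => v _; rewrite mnmDE mulnDl. Qed.

Lemma grade_pair f (v w : V) : grade f (pair_mnm v w) = (f v + f w)%N.
Proof.
have one u : (\sum_(z : V) (u == z) * f z = f u)%N.
  by rewrite (bigD1 u) //= eqxx mul1n big1 ?addn0 // => z /negPf; rewrite eq_sym => ->.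
rewrite /grade (eq_bigr (fun z => ((v == z) * f z + (w == z) * f z)%N)) => [|z _].
  by rewrite big_split !one.
by rewrite pair_mnmE mulnDl.
Qed.

Lemma mdeg_pair (v w : V) : mdeg (pair_mnm v w) = 2%N :> nat.
Proof. by rewrite /pair_mnm mdegD !mdeg1. Qed.

Definition tdeg := grade (fun v => is_T v).
Definition wdeg := grade (@var_wt d e).

Definition reduced m := ~ exists v w, lead_pair K v w /\ (pair_mnm v w <= m)%MM.

Let irr : irreflexive lt. Proof. by have [] := mono_lt_monomial_order d e. Qed.
Let tr : transitive lt. Proof. by have [] := mono_lt_monomial_order d e. Qed.

(** The termination measure for division: the relations are homogeneous quadrics, so division keeps
    the total degree and meets only finitely many monomials. *)
Definition below m := #|[set x : 'X_{1..#|V| < (mdeg m).+1} | lt x m]|.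

Lemma below_lt m1 m : lt m1 m -> mdeg m1 = mdeg m -> (below m1 < below m)%N.
Proof.
move=> lt1 em; rewrite /below em; apply/proper_card/properP; split.
  by apply/subsetP => x; rewrite !inE => h; apply: tr h lt1.
have b1 : (mdeg m1 < (mdeg m).+1)%N by rewrite em.
by exists (BMultinom b1); rewrite !inE /= ?lt1 ?irr.
Qed.

Variables (R : comNzRingType) (phi : {rmorphism P -> R}).
Hypothesis phi_rel : forall g, rees_relation g -> phi g = 0.

Lemma phiZ c p : phi (c *: p) = phi c%:MP * phi p.
Proof. by rewrite -mul_mpolyC rmorphM. Qed.

Definition preserved m m' := [/\ (m' == m) || lt m' m, tdeg m' = tdeg m & wdeg m' = wdeg m].

(** Working with values of [phi] instead of congruence modulo an ideal lets division apply directly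
    to [piR] and to [eval]. *)
Lemma reduction m : exists2 q : P, phi q = phi 'X_[m] &
  forall m', m' \in msupp q -> reduced m' /\ preserved m m'.
Proof.
move: {2}(below m).+1 (ltnSn (below m)) => n.
elim: n m => // n IH m lem.
have [[v [w [[g [c [s [rg c0 eg hs]]]] vw]]]|rm] := classic (exists v w, lead_pair K v w /\ (pair_mnm v w <= m)%MM); last first.
  exists 'X_[m] => // m'; rewrite msuppX inE => /eqP ->.
  by split=> //; rewrite /preserved eqxx.
pose mi (i : K * (V * V)) := (pair_mnm i.2.1 i.2.2 + (m - pair_mnm v w))%MM.
have em : m = (pair_mnm v w + (m - pair_mnm v w))%MM by rewrite addmC submK.
have ltmi i : i \in s -> [/\ lt (mi i) m, mdeg (mi i) = mdeg m, tdeg (mi i) = tdeg m & wdeg (mi i) = wdeg m].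
  move=> /hs[h1 h2 h3]; rewrite [in X in lt _ X]em [in mdeg m]em [in tdeg m]em [in wdeg m]em.
  rewrite /mi !(mdegD _ (m - pair_mnm v w)%MM) !mdeg_pair /tdeg /wdeg !(gradeD _ _ (m - pair_mnm v w)%MM) !grade_pair h2 h3; split=> //.
  by have [_ _ _ + _] := mono_lt_monomial_order d e; apply.
have hq i : i \in s -> exists2 q : P, phi q = phi 'X_[mi i] &
    forall m', m' \in msupp q -> reduced m' /\ preserved (mi i) m'.
  move=> /ltmi[h1 h2 _ _]; apply: IH; apply: leq_trans (below_lt h1 h2) _; exact: lem.
have {hq} [q hq] : exists q : K * (V * V) -> P, forall i, i \in s -> phi (q i) = phi 'X_[mi i] /\
    forall m', m' \in msupp (q i) -> reduced m' /\ preserved (mi i) m'.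
  clear -hq; elim: s hq => [|i s IHs] hq; first by exists (fun=> 0).
  have [q q1 q2] := hq i (mem_head _ _).
  have [|q' hq'] := IHs; first by move=> j js; apply: hq; rewrite inE js orbT.
  exists (fun j => if j == i then q else q' j) => j; rewrite inE; case: eqP => [-> _|_ /= js].
    by split.
  exact: hq'.
exists (- \sum_(i <- s) (c^-1 * i.1) *: q i).
  have := phi_rel rg; rewrite eg rmorphD /= => /eqP; rewrite addr_eq0 phiZ => /eqP e1.
  have -> : phi 'X_[m] = phi (c^-1)%:MP * (phi c%:MP * phi 'X_[pair_mnm v w]) * phi 'X_[m - pair_mnm v w].
    by rewrite mulrA -rmorphM /= -mpolyCM mulVf // rmorph1 mul1r -rmorphM -mpolyXD -em.
  rewrite e1 rmorphN mulrN mulNr; congr (- _); rewrite !rmorph_sum mulr_sumr mulr_suml.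
  rewrite big_seq [RHS]big_seq; apply: eq_bigr => i is_; have [h _] := hq i is_.
  by rewrite !phiZ h /mi mpolyXD mpolyCM !rmorphM /= !mulrA.
move=> m'; rewrite (perm_mem (msuppN _)) => /msupp_sum_le /flattenP[/= ms] /mapP[i].
rewrite filter_predT => is_ -> hm.
have [_ /(_ m' (msuppZ_le hm))[h1 [h2 h3 h4]]] := hq i is_; have [k1 k2 k3 k4] := ltmi i is_.
split=> //; split; rewrite ?h3 ?h4 //.
by case/orP: h2 => [/eqP ->|h2]; rewrite ?k1 ?(tr h2 k1) orbT.
Qed.
End Reduce.

Section ConfigOf.
Local Open Scope nat_scope.
Variables d e : nat.
Local Notation N := (d + e).
Local Notation V := (Pvar d e).
Implicit Type m : 'X_{1..#|V|}.

Definition arc_of m (a b : nat) : nat :=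
  match insub a : option 'I_N, insub b : option 'I_N with
  | Some a', Some b' => oapp (fun t : Tvar d e => m (enum_rank (inr t : V))) 0 (insub (a', b'))
  | _, _ => 0
  end.

Definition config_of m := Config
  (fun p => oapp (fun j : 'I_d => m (enum_rank (inl (y2v e j) : V))) 0 (insub p))
  (fun c => oapp (fun c : 'I_N => m (enum_rank (cv c))) 0 (insub c))
  (arc_of m).

Lemma fo_config m (j : 'I_d) : fo (config_of m) j = m (enum_rank (inl (y2v e j) : V)).
Proof. by rewrite /= valK. Qed.

Lemma fc_config m (c : 'I_N) : fc (config_of m) c = m (enum_rank (cv c)).
Proof. by rewrite /= valK. Qed.

Lemma arc_config0 m (a b : 'I_N) : arcs (config_of m) a b =
  oapp (fun t : Tvar d e => m (enum_rank (inr t : V))) 0 (insub (a, b)).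
Proof. by rewrite /= /arc_of !valK. Qed.

Lemma arc_config m (a b : 'I_N) (ab : a < b) : arcs (config_of m) a b = m (enum_rank (tv ab)).
Proof. by rewrite arc_config0 insubT. Qed.

Lemma fo_gt0 m p : 0 < fo (config_of m) p ->
  exists2 j : 'I_d, p = j & 0 < m (enum_rank (inl (y2v e j) : V)).
Proof. by rewrite /=; case: insubP => //= j _ <-; exists j. Qed.

Lemma fc_gt0 m c : 0 < fc (config_of m) c -> exists2 c' : 'I_N, c = c' & 0 < m (enum_rank (cv c')).
Proof. by rewrite /=; case: insubP => //= j _ <-; exists j. Qed.

Lemma arc_gt0 m a b : 0 < arcs (config_of m) a b -> exists (a' b' : 'I_N) (ab : a' < b'),
  [/\ a = a', b = b' & 0 < m (enum_rank (tv ab))].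
Proof.
rewrite /= /arc_of; case: insubP => //= a' _ <-; case: insubP => //= b' _ <-.
case: insubP => //= -[[a1 b1] ab] /= _ [E1 E2]; subst a1 b1 => h.
by exists a', b', ab.
Qed.

Lemma supported_config m : supported d e (config_of m).
Proof.
split=> [p dp|c Nc|a b h] /=; try by rewrite insubN // -leqNgt.
rewrite /arc_of; case: insubP => //= a' _ Ea; case: insubP => //= b' _ Eb.
rewrite insubN //=; apply: contra h => ab; rewrite -Ea -Eb /= ab; exact: ltn_ord.
Qed.

Lemma pair_le m (v w : V) : v != w -> 0 < m (enum_rank v) -> 0 < m (enum_rank w) ->
  (pair_mnm v w <= m)%MM.
Proof.
move=> vw hv hw; apply/mnm_lepP => i; rewrite -(enum_valK i) pair_mnmE /mult2.
case: (eqVneq v (enum_val i)) => [<-|_]; case: (eqVneq w _) => [E|_] //=.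
- by move: vw; rewrite E eqxx.
- by rewrite -E.
Qed.

Section Standard.
Variable K : fieldType.

Lemma standard_config m : reduced K m -> standard d (config_of m).
Proof.
move=> rm; have bad v w : lead_pair K v w -> v != w -> 0 < m (enum_rank v) -> 0 < m (enum_rank w) -> False.
  by move=> lp vw hv hw; apply: rm; exists v, w; split=> //; apply: pair_le.
have zero a b (x := arcs (config_of m) a b) : (0 < x -> False) -> x = 0 by case: x => // n /(_ isT).
split.
- move=> a b g ab bg bd /fc_gt0[b' Eb hb]; apply: zero => /arc_gt0[a' [g' [ag [Ea Eg h]]]]; subst a b g.
  exact: (bad _ _ (lead_U K ab bg ag bd) (cv_notT _ _) hb h).
- move=> a b g ab bg db /fc_gt0[g' Eg hg]; apply: zero => /arc_gt0[a' [b' [ab' [Ea Eb h]]]]; subst a b g.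
  by apply: (bad _ _ (lead_V K ab' bg db)) => //; rewrite eq_sym; exact: cv_notT.
- move=> a b g ab /fo_gt0[a' Ea ha]; apply: zero => /arc_gt0[b' [g' [bg [Eb Eg h]]]]; subst a b g.
  have aN : a' < N by rewrite ltn_addr.
  have := @lead_O K d e (Ordinal aN) b' g' (ltn_ord a') ab bg => lp.
  apply: (bad _ _ lp) h => //; congr (0 < m (enum_rank (inl (y2v e _) : V))): ha; exact: val_inj.
- move=> a b g da ab /fc_gt0[a1 Ea ha]; apply: zero => /arc_gt0[b' [g' [bg [Eb Eg h]]]]; subst b g.
  have aN : a < N by apply: leq_trans ab (ltnW (ltn_ord b')).
  exact: (bad _ _ (@lead_C K d e (Ordinal aN) a1 b' g' ab bg da (esym Ea)) (cv_notT _ _) ha h).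
- move=> a b g h ab bg gh /arc_gt0[a' [g' [ag [Ea Eg h1]]]]; apply: zero => /arc_gt0[b' [h' [bh [Eb Eh h2]]]].
  subst a b g h; apply: (bad _ _ (lead_P K ag bh ab bg gh)) => //.
  by apply/eqP => -[E _]; move: ab; rewrite E ltnn.
- move=> a b g h da bg gh /arc_gt0[a1 [b1 [ab [Ea Eb h1]]]]; apply: zero => /arc_gt0[g' [h' [gh' [Eg Eh h2]]]].
  subst a b g h.
  have aN : a1.-1 < N by have := ltn_ord a1; lia.
  have bN : b1.-1 < N by have := ltn_ord b1; lia.
  have lp := @lead_LAP K d e (Ordinal aN) (Ordinal bN) g' h' a1 b1 ab gh'.
  apply: (bad _ _ (lp _ _ _ _ _)) => //=; try lia.
  by apply/eqP => -[/(congr1 val) /= E1 _]; move: bg; rewrite -E1 leqNgt ab.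
Qed.
End Standard.

Lemma sum_Tvar (G : Tvar d e -> nat) :
  \sum_(t : Tvar d e) G t = \sum_(a < N) \sum_(b < N) oapp G 0 (insub (a, b)).
Proof.
rewrite pair_big /= (bigID (fun p : 'I_N * 'I_N => p.1 < p.2)) /= [X in _ = _ + X]big1 ?addn0 => [|[a b] h].
  rewrite (@reindex_omap _ _ _ _ (Tvar d e) val insub) /= => [|[a b] ab]; last by rewrite insubT.
  by apply: eq_big => [t|t _]; rewrite ?valK ?(valP t) ?eqxx //= -surjective_pairing valK.
by rewrite insubN.
Qed.

Lemma sum_vars (F : V -> nat) : \sum_v F v = \sum_(j < d) F (inl (y2v e j)) +
  \sum_(c < N) F (cv c) + \sum_(a < N) \sum_(b < N) oapp (fun t => F (inr t)) 0 (insub (a, b)).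
Proof.
rewrite -(sum_Tvar (fun t => F (inr t))) !big_sumType /=; congr (_ + _).
have -> : \sum_(c < N) F (cv c) = \sum_(j < d) F (inl (y1v e j)) + \sum_(j < e) F (inl (xv d j)).
  rewrite big_split_ord; congr (_ + _); apply: eq_bigr => j _ /=.
    by rewrite /cv (unsplitK (inl j : 'I_d + 'I_e)).
  by rewrite /cv (unsplitK (inr j : 'I_d + 'I_e)).
by rewrite addnA [X in X + _ = _]addnC.
Qed.

Lemma wdeg_config m : weight d e (config_of m) = wdeg m.
Proof.
rewrite /wdeg /grade sum_vars /weight; congr (_ + _ + _).
- by apply: eq_bigr => j _; rewrite fo_config.
- by apply: eq_bigr => c _; rewrite fc_config var_wt_cv.
- apply: eq_bigr => a _; apply: eq_bigr => b _; rewrite arc_config0.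
  by case: insubP => [[[a1 b1] ab] _ /= [E1 E2]|] //=; subst a1 b1.
Qed.

Lemma tdeg_config m : narcs d e (config_of m) = tdeg m.
Proof.
rewrite /tdeg /grade sum_vars [X in _ = X + _ + _]big1 => [|j _]; last by rewrite muln0.
rewrite [X in _ = _ + X + _]big1 => [|c _]; last by rewrite is_T_cv muln0.
apply: eq_bigr => a _; apply: eq_bigr => b _; rewrite arc_config0.
by case: insubP => //= t _ _; rewrite muln1.
Qed.

Lemma config_inj m1 m2 :
    (forall p, fo (config_of m1) p = fo (config_of m2) p) ->
    (forall c, fc (config_of m1) c = fc (config_of m2) c) ->
    (forall a b, arcs (config_of m1) a b = arcs (config_of m2) a b) -> m1 = m2.
Proof.
move=> h1 h2 h3; apply/mnmP => i; rewrite -(enum_valK i); case: (enum_val i) => [[[j|j]|j]|[[a b] ab]].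
- have := h2 (lshift e j); rewrite !fc_config /cv (unsplitK (inl j : 'I_d + 'I_e)).
  exact.
- by have := h1 j; rewrite !fo_config.
- have := h2 (rshift d j); rewrite !fc_config /cv (unsplitK (inr j : 'I_d + 'I_e)).
  exact.
- by have := h3 a b; rewrite !(arc_config _ ab).
Qed.
End ConfigOf.

(** * Specialization and independence *)

(** A vector in the left kernel of [C] is a relation between the [b i], so the square matrix [C] is
    invertible and a relation between the [s j] is carried back to one between the [b i]. *)
Lemma free_transfer (K : fieldType) (A : lmodType K) n (s b : 'I_n -> A) (C : 'M[K]_n) :
    (forall i, b i = \sum_j C i j *: s j) ->
    (forall x : 'I_n -> K, \sum_i x i *: b i = 0 -> forall i, x i = 0) ->
  forall x : 'I_n -> K, \sum_i x i *: s i = 0 -> forall i, x i = 0.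
Proof.
move=> bC fb; have rf : row_free C.
  apply/row_freeP; apply/row_freeP; rewrite -kermx_eq0; apply/eqP/row_matrixP => i.
  rewrite row0; have: row i (kermx C) *m C = 0 by rewrite -row_mul mulmx_ker row0.
  move: (row i (kermx C)) => r h; apply/rowP => j; rewrite [RHS]mxE; apply: (fb (r 0)).
  under eq_bigr => k _ do rewrite bC scaler_sumr.
  rewrite exchange_big big1 //= => k _; under eq_bigr => l _ do rewrite scalerA.
  rewrite -scaler_suml; have := congr1 (fun M : 'rV_n => M 0 k) h.
  by rewrite !mxE => ->; rewrite scale0r.
have uC : C \in unitmx by rewrite -row_free_unit.
move=> x xs i; pose y := (\row_j x j) *m invmx C.
have yC : y *m C = \row_j x j by rewrite /y mulmxKV.
have y0 : forall j, y 0 j = 0.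
  apply: fb; under eq_bigr => k _ do rewrite bC scaler_sumr.
  rewrite exchange_big /= -[RHS]xs; apply: eq_bigr => k _.
  under eq_bigr => l _ do rewrite scalerA.
  by rewrite -scaler_suml; congr (_ *: _); have := congr1 (fun M : 'rV_n => M 0 k) yC; rewrite !mxE => <-.
have := congr1 (fun M : 'rV_n => M 0 i) yC; rewrite !mxE => <-.
by rewrite big1 // => j _; rewrite y0 mul0r.
Qed.

(** Serves to list the monomials satisfying [good], which is a proposition and not a boolean. *)
Lemma classical_list (T : eqType) (P : T -> Prop) (l : seq T) :
  exists s : seq T, uniq s /\ forall x, x \in s <-> x \in l /\ P x.
Proof.
elim: l => [|y l [s [us hs]]]; first by exists [::]; split=> // x; split=> // -[].
have [hy|hy] := classic (P y /\ y \notin s).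
  exists (y :: s); split; first by rewrite /= us andbT; case: hy.
  move=> x; rewrite !inE; split.
    by case/orP=> [/eqP ->|/hs[-> ?]]; rewrite ?eqxx ?orbT //; case: hy.
  by case=> /orP[->//|xl] px; apply/orP; right; apply/hs.
exists s; split=> // x; rewrite inE; split; first by case/hs=> -> ?; rewrite orbT.
case=> /orP[/eqP ->|xl] px; last by apply/hs.
by apply/negPn/negP => ys; apply: hy.
Qed.

Section Evaluation.
Variables (K : fieldType) (d e : nat).
Hypotheses (d0 : (0 < d)%N) (e0 : (0 < e)%N).
Local Notation N := (d + e)%N.
Local Notation V := (Pvar d e).
Local Notation L := (Svar d e).
Local Notation A := (@Sring K d e).
Local Notation P := (@Pring K d e).
Local Notation varS := (@varS K d e).
Local Notation varP := (@varP K d e).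
Local Notation xS := (@xS K d e).

Let z0 : 'I_d := Ordinal d0.
Let v : A := varS (y2v e z0).

(* With tau = 1 and y_{1,0} = 1, T_{0,p} goes to y_{2,p}, T_{0,d+i} to x_{i+1}
   and T_{0,N-1} to - y_{2,0} xe (e - 1), whose term of highest degree in x_0 is
   - y_{2,0}^e x_0. *)
Fixpoint xe i : A := if i is i'.+1 then xS i + v * xe i' else xS 0.

Definition erow0 (c : 'I_N) : A :=
  match split c with inl j => if j == z0 then 1 else varS (y1v e j) | inr j => xe j end.
Definition erow1 (c : 'I_N) : A :=
  match split c with
  | inl j => if j == z0 then v else varS (y2v e j) + v * varS (y1v e j)
  | inr j => if (j.+1 < e)%N then xe j.+1 else 0 end.

Definition eval_var (u : V) : A :=
  match u with
  | inl (inl (inl j)) => erow0 (lshift e j)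
  | inl (inl (inr j)) => erow1 (lshift e j)
  | inl (inr j) => erow0 (rshift d j)
  | inr t => erow0 (val t).1 * erow1 (val t).2 - erow0 (val t).2 * erow1 (val t).1
  end.

Definition eval : {rmorphism P -> A} := mmap (@mpolyC _ K) (eval_var \o enum_val).

Lemma eval_varP u : eval (varP u) = eval_var u.
Proof. by rewrite /eval /= mmapX mmap1U /= enum_rankK. Qed.

Lemma evalC c : eval c%:MP = c%:MP.
Proof. exact: mmapC. Qed.

Lemma eval_cv c : eval (varP (cv c)) = erow0 c.
Proof.
rewrite eval_varP /cv; case: splitP => j E /=.
  by congr erow0; apply: val_inj.
by congr erow0; apply: val_inj.
Qed.

Lemma eval_relation g : rees_relation g -> eval g = 0.
Proof.
apply: (@relation_kernel _ _ _ _ eval erow0 erow1 1) => [c|c|a b ab].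
- by rewrite SinP_L0 eval_cv.
- have /orP[cd|dc] : (c < d)%N || (d <= c)%N by case: ltnP.
    rewrite (SinP_L1y K cd) eval_varP /=; congr erow1; exact: val_inj.
  have [cN|cN] := ltnP c.+1 N.
    rewrite (SinP_L1x K (c1 := Ordinal cN)) // eval_cv /erow0 /erow1.
    case: splitP => j /= Ej; first by have := ltn_ord j; lia.
    case: splitP => i /= Ei; first by have := ltn_ord i; lia.
    have -> : j = i.+1 :> nat by lia.
    by rewrite (_ : (i.+1 < e)%N) //; have := ltn_ord j; lia.
  rewrite SinP_L1_last ?rmorph0 //; last by apply/eqP; rewrite eqn_leq cN andbT.
  rewrite /erow1; case: splitP => i /= Ei; first by have := ltn_ord i; lia.
  by rewrite ltnNge (_ : (e <= i.+1)%N) //; lia.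
- by rewrite T_var eval_varP mulr1.
Qed.

End Evaluation.

(** * Elements with a dominant monomial in one variable *)

Section Top.
Variables (K : fieldType) (n : nat) (u : 'I_n).
Implicit Types (p q a b : {mpoly K[n]}) (M : 'X_{1..n}).

(** Only the degree in [u] is compared, with no monomial order; this is stable under products and
    still yields independence. *)
Definition top_form M a := forall m, m \in msupp (a - 'X_[M]) -> (m u < M u)%N.

Lemma topX M : top_form M 'X_[M].
Proof. by move=> m; rewrite subrr msupp0. Qed.

Lemma topM M1 M2 a b : top_form M1 a -> top_form M2 b -> top_form (M1 + M2)%MM (a * b).
Proof.
move=> ha hb m; have -> : a * b - 'X_[M1 + M2] = (a - 'X_[M1]) * b + 'X_[M1] * (b - 'X_[M2]).
  by rewrite mulrBl mulrBr mpolyXD addrA addrNK.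
have leb m2 : m2 \in msupp b -> (m2 u <= M2 u)%N.
  rewrite -[b](subrK 'X_[M2]) => /msuppD_le; rewrite mem_cat msuppX inE => /orP[/hb/ltnW //|/eqP->] //.
move=> /msuppD_le; rewrite mem_cat => /orP[/msuppM_le|/msuppM_le] /allpairsP[[m1 m2] /= [h1 h2 ->]].
  by rewrite !mnmDE -addSn leq_add ?ha ?leb.
move: h1; rewrite msuppX inE => /eqP ->; by rewrite !mnmDE ltn_add2l hb.
Qed.

(** Among the indices with nonzero coefficient take one whose [M i] has maximal degree in [u]: no
    other summand of the relation contains the monomial [M i]. *)
Lemma top_free (s : nat) (M : 'I_s -> 'X_{1..n}) (a : 'I_s -> {mpoly K[n]}) :
    injective M -> (forall i, top_form (M i) (a i)) ->
  forall x : 'I_s -> K, \sum_i x i *: a i = 0 -> forall i, x i = 0.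
Proof.
move=> Mi ta x x0 i0; apply/eqP/negPn/negP => nz0.
case: (@arg_maxnP _ i0 (fun i => x i != 0) (fun i => M i u) nz0) => i nz hm.
have := congr1 (fun p : {mpoly K[n]} => p@_(M i)) x0; rewrite mcoeff0 raddf_sum (bigD1 i) //= big1.
  rewrite addr0 mcoeffZ -[a i](subrK 'X_[M i]) mcoeffD mcoeffX eqxx memN_msupp_eq0 ?add0r ?mulr1 => [/eqP|].
    by rewrite (negPf nz).
  by apply/negP => /ta; rewrite ltnn.
move=> j ji; rewrite mcoeffZ; have [->|nzj] := eqVneq (x j) 0; first by rewrite mul0r.
rewrite -[a j](subrK 'X_[M j]) mcoeffD mcoeffX (inj_eq Mi) (negPf ji) addr0 memN_msupp_eq0 ?mulr0 //.
by apply/negP => /ta; rewrite ltnNge; move/negP; apply; apply: hm.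
Qed.
End Top.

Section Homogeneous.
Variables (K : fieldType) (d e : nat).
Local Notation V := (Pvar d e).
Local Notation P := (@Pring K d e).

Definition bihom k w (p : P) := forall m, m \in msupp p -> tdeg m = k /\ wdeg m = w.

Lemma bihomM k1 w1 k2 w2 p q : bihom k1 w1 p -> bihom k2 w2 q -> bihom (k1 + k2) (w1 + w2) (p * q).
Proof.
move=> hp hq m /msuppM_le/allpairsP[[m1 m2] /= [/hp[t1 o1] /hq[t2 o2] ->]].
by rewrite /tdeg /wdeg !gradeD -!/(tdeg _) -!/(wdeg _) t1 t2 o1 o2.
Qed.

Lemma bihomB k w p q : bihom k w p -> bihom k w q -> bihom k w (p - q).
Proof. by move=> hp hq m /msuppB_le; rewrite mem_cat => /orP[/hp|/hq]. Qed.

Lemma bihomN k w p : bihom k w p -> bihom k w (- p).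
Proof. by move=> hp m; rewrite (perm_mem (msuppN p)) => /hp. Qed.

Lemma bihom1 : bihom 0 0 1.
Proof. by move=> m; rewrite msupp1 inE => /eqP ->; rewrite /tdeg /wdeg /grade !big1 // => v _; rewrite mnm0E. Qed.

Lemma grade_var (f : V -> nat) (v : V) : grade f U_(enum_rank v)%MM = f v.
Proof.
rewrite /grade (bigD1 v) //= mnmE eqxx mul1n big1 ?addn0 // => w wv.
by rewrite mnmE (inj_eq enum_rank_inj) eq_sym (negPf wv).
Qed.

Lemma bihom_var v : bihom (is_T v) (var_wt v) (@varP K d e v).
Proof. by move=> m; rewrite msuppX inE => /eqP ->; rewrite /tdeg /wdeg !grade_var. Qed.

End Homogeneous.

(** * Letters as values of polynomials of prescribed T-degree *)

Section Letters.
Variables (K : fieldType) (d e : nat).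
Hypotheses (d0 : (0 < d)%N) (e0 : (0 < e)%N).
Local Notation N := (d + e)%N.
Local Notation V := (Pvar d e).
Local Notation L := (Svar d e).
Local Notation A := (@Sring K d e).
Local Notation P := (@Pring K d e).
Local Notation varS := (@varS K d e).
Local Notation varP := (@varP K d e).
Local Notation eval := (@eval K d e d0).
Local Notation xe := (@xe K d e d0).
Local Notation erow0 := (@erow0 K d e d0).
Local Notation erow1 := (@erow1 K d e d0).

Let z0 : 'I_d := Ordinal d0.
Let z1 : 'I_e := Ordinal e0.
Local Notation U v := (U_(enum_rank (v : L))%MM).
Let x0 : 'I_#|L| := enum_rank (xv d z1 : L).

(* An element of T-degree flexible between 0 and k: this is what replacing
   y_{1,0} by 1 makes possible. *)
Definition flex k w (a : A) :=
  forall k', (k' <= k)%N -> exists2 p : P, eval p = a & bihom k' w p.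

Definition rep k w M a := flex k w a /\ top_form x0 M a.

Lemma flexM k1 w1 k2 w2 a b : flex k1 w1 a -> flex k2 w2 b -> flex (k1 + k2) (w1 + w2) (a * b).
Proof.
move=> ha hb k hk; have [p <- hp] := ha (minn k k1) (geq_minr _ _).
have [q <- hq] := hb (k - minn k k1)%N ltac:(lia).
by exists (p * q); rewrite ?rmorphM // -[k](subnKC (geq_minl k k1)); apply: bihomM.
Qed.

Lemma repM k1 w1 M1 k2 w2 M2 a b : rep k1 w1 M1 a -> rep k2 w2 M2 b ->
  rep (k1 + k2) (w1 + w2) (M1 + M2)%MM (a * b).
Proof. by move=> [f1 t1] [f2 t2]; split; [apply: flexM|apply: topM]. Qed.

Lemma rep1 : rep 0 0 0%MM 1.
Proof.
split; last by rewrite -mpolyX0; apply: topX.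
by move=> k; rewrite leqn0 => /eqP ->; exists 1; rewrite ?rmorph1 //; apply: bihom1.
Qed.

Lemma rep_exp k w M a n : rep k w M a -> rep (n * k) (n * w) (M *+ n)%MM (a ^+ n).
Proof.
move=> h; elim: n => [|n IH]; first by rewrite mulm0n; exact: rep1.
by rewrite !mulSn mulmS exprS; apply: repM.
Qed.

Lemma rep_prod (I : Type) (r : seq I) (Q : pred I) k w M (a : I -> A) :
  (forall i, Q i -> rep (k i) (w i) (M i) (a i)) ->
  rep (\sum_(i <- r | Q i) k i) (\sum_(i <- r | Q i) w i) (\big[mnm_add/0%MM]_(i <- r | Q i) M i) (\prod_(i <- r | Q i) a i).
Proof.
move=> h; elim: r => [|i r IH]; first by rewrite !big_nil; exact: rep1.
by rewrite !big_cons; case: ifP => // hi; apply: (repM (h _ hi) IH).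
Qed.

Lemma flex0 p w : bihom 0 w p -> flex 0 w (eval p).
Proof. by move=> hp k; rewrite leqn0 => /eqP ->; exists p. Qed.

Lemma flex1 p q w : eval p = eval q -> bihom 0 w p -> bihom 1 w q -> flex 1 w (eval q).
Proof. by move=> e1 hp hq [|[|//]] _; [exists p|exists q]. Qed.

Lemma eval_y1 j : eval (varP (inl (y1v e j))) = if j == z0 then 1 else varS (y1v e j).
Proof. by rewrite eval_varP /= /erow0 (unsplitK (inl j : 'I_d + 'I_e)). Qed.

Lemma eval_y2 j : eval (varP (inl (y2v e j))) = 
  if j == z0 then varS (y2v e z0) else varS (y2v e j) + varS (y2v e z0) * varS (y1v e j).
Proof. by rewrite eval_varP /= /erow1 (unsplitK (inl j : 'I_d + 'I_e)). Qed.

Lemma eval_x j : eval (varP (inl (xv d j))) = xe j.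
Proof. by rewrite eval_varP /= /erow0 (unsplitK (inr j : 'I_d + 'I_e)). Qed.

Lemma var_wt_y1 j : var_wt (inl (y1v e j) : V) = (j != z0).
Proof. by rewrite /= /col_wt ltn_ord. Qed.

Lemma var_wt_y2 j : var_wt (inl (y2v e j) : V) = (j != z0).+1.
Proof. by rewrite /= /col_wt ltn_ord. Qed.

Lemma xE (j : 'I_e) : xS K d e j = varS (xv d j).
Proof. by rewrite /xS valK. Qed.

Lemma rep_y1 j : j != z0 -> rep 0 1 (U (y1v e j)) (varS (y1v e j)).
Proof.
move=> jz; split; last exact: topX.
have := @flex0 (varP (inl (y1v e j))) 1; rewrite eval_y1 (negPf jz); apply.
by rewrite (_ : 1%N = var_wt (inl (y1v e j) : V)); [exact: bihom_var|rewrite var_wt_y1 jz].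
Qed.

Lemma rep_v : rep 0 1 (U (y2v e z0)) (varS (y2v e z0)).
Proof.
split; last exact: topX.
have := @flex0 (varP (inl (y2v e z0))) 1; rewrite eval_y2 eqxx; apply.
by rewrite (_ : 1%N = var_wt (inl (y2v e z0) : V)); [exact: bihom_var|rewrite var_wt_y2 eqxx].
Qed.

Lemma rep_x0 : rep 0 1 (U (xv d z1)) (varS (xv d z1)).
Proof.
split; last exact: topX.
have := @flex0 (varP (inl (xv d z1))) 1; rewrite eval_x /= (xE z1); apply.
exact: bihom_var.
Qed.

Let c0 : 'I_N := lshift e z0.

Lemma row0_c0 : erow0 c0 = 1.
Proof. by rewrite /erow0 (unsplitK (inl z0 : 'I_d + 'I_e)) eqxx. Qed.
Lemma row1_c0 : erow1 c0 = varS (y2v e z0).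
Proof. by rewrite /erow1 (unsplitK (inl z0 : 'I_d + 'I_e)) eqxx. Qed.

Lemma eval_T0 (c : 'I_N) (h : (c0 < c)%N) : eval (varP (tv h)) = erow1 c - erow0 c * varS (y2v e z0).
Proof. by rewrite eval_varP /= row0_c0 row1_c0 mul1r. Qed.

Lemma bihom_T0 (c : 'I_N) (h : (c0 < c)%N) : bihom 1 (col_wt d c).+1 (varP (tv h)).
Proof. by have := @bihom_var K d e (tv h); rewrite /= (_ : col_wt d 0 = 0%N) // /col_wt d0. Qed.

Lemma bihom_pair (v w : V) : bihom (is_T v + is_T w) (var_wt v + var_wt w) (varP v * varP w).
Proof. by apply: bihomM; apply: bihom_var. Qed.

(** The letter is the value of T_{0,j} and, since y_{1,0} and tau are 1, also of the minor y_{2,j} -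
    y_{2,0} y_{1,j}; these have T-degrees 1 and 0. [rep_x] and [rep_last] use the minors of column 0
    with an x column in the same way. *)
Lemma rep_y2 j : j != z0 -> rep 1 2 (U (y2v e j)) (varS (y2v e j)).
Proof.
move=> jz; split; last exact: topX.
have h : (c0 < lshift e j)%N by rewrite /= lt0n; move: jz; rewrite -val_eqE.
have ev : eval (varP (tv h)) = varS (y2v e j).
  rewrite eval_T0 /erow0 /erow1 (unsplitK (inl j : 'I_d + 'I_e)) (negPf jz).
  by rewrite [varS (y2v e z0) * _]mulrC addrK.
rewrite -ev; apply: (@flex1 (varP (inl (y2v e j)) - varP (inl (y2v e z0)) * varP (inl (y1v e j)))).
- by rewrite ev rmorphB rmorphM /= !eval_y2 eval_y1 (negPf jz) eqxx addrK.
- apply: bihomB.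
    have := @bihom_var K d e (inl (y2v e j) : V); by rewrite var_wt_y2 jz.
  have := @bihom_pair (inl (y2v e z0)) (inl (y1v e j)); by rewrite var_wt_y2 var_wt_y1 jz eqxx.
- have := @bihom_T0 _ h; rewrite /= /col_wt ltn_ord; by move: jz; rewrite -val_eqE /= => ->.
Qed.

Lemma rep_x (j : 'I_e) : (0 < j)%N -> rep 1 j.+1 (U (xv d j)) (varS (xv d j)).
Proof.
move=> j0; split; last exact: topX.
have pj : (j.-1 < e)%N := leq_ltn_trans (leq_pred j) (ltn_ord j).
pose i := Ordinal pj; have ei : i.+1 = j :> nat by rewrite /= prednK.
have h : (c0 < rshift d i)%N by rewrite /= ltn_addr.
have xj : xe j = varS (xv d j) + varS (y2v e z0) * xe i by rewrite -ei /= ei xE.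
have ev : eval (varP (tv h)) = varS (xv d j).
  rewrite eval_T0 /erow0 /erow1 (unsplitK (inr i : 'I_d + 'I_e)) ei ltn_ord xj.
  by rewrite mulrC addrK.
rewrite -ev; apply: (@flex1 (varP (inl (xv d j)) - varP (inl (y2v e z0)) * varP (inl (xv d i)))).
- by rewrite ev rmorphB rmorphM /= !eval_x eval_y2 eqxx xj addrK.
- apply: bihomB; first exact: (@bihom_var K d e (inl (xv d j) : V)).
  have := @bihom_pair (inl (y2v e z0)) (inl (xv d i)); by rewrite var_wt_y2 eqxx /= prednK // add1n.
- have := @bihom_T0 _ h; by rewrite /= /col_wt ltnNge leq_addr /= addKn prednK.
Qed.

Lemma msupp_varS (l : L) m : l != xv d z1 -> m \in msupp (varS l) -> m x0 = 0%N.
Proof.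
move=> lx; rewrite msuppX inE => /eqP ->.
by rewrite mnm1E (inj_eq enum_rank_inj) (negPf lx).
Qed.

(** Unfolded, [xe i] is the sum of the y_{2,0}^(i-j) x_j, in which only the term [j = 0] involves
    x_0. *)
Lemma top_xe i : (i < e)%N -> top_form x0 (U (y2v e z0) *+ i + U (xv d z1))%MM (xe i).
Proof.
elim: i => [|i IH] ie.
  by rewrite mulm0n add0m /= (xE z1); exact: topX.
rewrite /=; set M := (U (y2v e z0) *+ i.+1 + _)%MM.
have -> : M = (U (y2v e z0) + (U (y2v e z0) *+ i + U (xv d z1)))%MM by rewrite addmA -mulmS.
have := topM (@topX K _ x0 (U (y2v e z0))) (IH (ltnW ie)).
set M' := (_ + (_ + _))%MM; rewrite -/(varS _) => hM m.
rewrite -addrA => /msuppD_le; rewrite mem_cat => /orP[|]; last exact: hM.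
rewrite (xE (Ordinal ie)) => /msupp_varS -> //.
rewrite /M' !mnmDE mulmnE !mnm1E (inj_eq enum_rank_inj) eqxx; by case: eqP => //; lia.
Qed.

Definition last_letter : A := varS (y2v e z0) * xe e.-1.

Lemma rep_last : rep 1 e.+1 (U (y2v e z0) *+ e + U (xv d z1))%MM last_letter.
Proof.
have pe : (e.-1 < e)%N by rewrite prednK.
split; last first.
  have -> : (U (y2v e z0) *+ e + U (xv d z1) = U (y2v e z0) + (U (y2v e z0) *+ e.-1 + U (xv d z1)))%MM.
    by rewrite addmA -mulmS prednK.
  by apply: topM; [exact: topX|exact: top_xe].
pose i := Ordinal pe.
have h : (c0 < rshift d i)%N by rewrite /= ltn_addr.
(* The last entry of the second row is 0, so only the negative product of the minor survives; hence
   the sign. *)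
have ev : eval (- varP (tv h)) = last_letter.
  rewrite rmorphN eval_T0 /erow0 /erow1 (unsplitK (inr i : 'I_d + 'I_e)) /= prednK // ltnn.
  by rewrite sub0r opprK mulrC.
rewrite -ev; apply: (@flex1 (varP (inl (y2v e z0)) * varP (inl (xv d i)))).
- by rewrite ev rmorphM /= eval_x eval_y2 eqxx.
- have := @bihom_pair (inl (y2v e z0)) (inl (xv d i)); by rewrite var_wt_y2 eqxx /= prednK // add1n.
- apply: bihomN; have := @bihom_T0 _ h; by rewrite /= /col_wt ltnNge leq_addr /= addKn prednK.
Qed.

End Letters.

Section Monomials.
Variables (K : fieldType) (d e : nat).
Hypotheses (d0 : (0 < d)%N) (e0 : (0 < e)%N).
Local Notation N := (d + e)%N.
Local Notation L := (Svar d e).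
Local Notation A := (@Sring K d e).
Local Notation varS := (@varS K d e).
Let z0 : 'I_d := Ordinal d0.
Let z1 : 'I_e := Ordinal e0.
Local Notation U v := (U_(enum_rank (v : L))%MM).

Definition letter_mnm (o c : nat -> nat) : 'X_{1..#|L|} :=
  [multinom match enum_val i with
            | inl (inl j) => c j
            | inl (inr j) => o j
            | inr i => c (d + i)%N
            end | i < #|L|].

Variables o c : nat -> nat.
Let j := minn (c d) (o 0 %/ e).

(* The monomial [letter_mnm o c] with y_{2,0}^e x_0 replaced as often as possible
   by the last letter, of which it is the leading term. *)
Definition letter_elt : A :=
  (\prod_(p < d | p != z0) varS (y2v e p) ^+ o p) * (\prod_(p < d | p != z0) varS (y1v e p) ^+ c p)
  * (\prod_(i < e | i != z1) varS (xv d i) ^+ c (d + i)) * varS (y2v e z0) ^+ (o 0 - j * e)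
  * varS (xv d z1) ^+ (c d - j) * @last_letter K d e d0 ^+ j.

Lemma rep_letter_elt : c 0 = 0%N ->
  rep d0 e0 (power d e o c) (letter_wt d e o c) (letter_mnm o c) letter_elt.
Proof.
move=> cz.
have xi (i : 'I_e) : i != z1 -> (0 < i)%N by rewrite -val_eqE /= lt0n.
have h2 := @rep_prod K d e d0 e0 _ (index_enum 'I_d) (fun p => p != z0) _ _ _ _
  (fun p hp => rep_exp (o p) (rep_y2 K e0 hp)).
have h1 := @rep_prod K d e d0 e0 _ (index_enum 'I_d) (fun p => p != z0) _ _ _ _
  (fun p hp => rep_exp (c p) (rep_y1 K e0 hp)).
have hx := @rep_prod K d e d0 e0 _ (index_enum 'I_e) (fun i => i != z1) _ _ _ _
  (fun i hi => rep_exp (c (d + i)) (rep_x K d0 e0 (xi i hi))).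
have := repM (repM (repM (repM (repM h2 h1) hx) (rep_exp (o 0 - j * e) (rep_v K d0 e0)))
  (rep_exp (c d - j) (rep_x0 K d0 e0))) (rep_exp j (rep_last K d0 e0)).
have je : (j * e <= o 0)%N by apply: leq_trans (leq_trunc_div (o 0) e); rewrite leq_mul2r geq_minr orbT.
have jc : (j <= c d)%N by exact: geq_minl.
rewrite -/letter_elt; set k := (_ + _)%N; set w := (_ + _)%N; set M := (_ + _)%MM.
have -> : k = power d e o c.
  rewrite /k /power !muln0 !muln1 !addn0 -/j; congr (_ + _ + _)%N.
  rewrite [X in (_ + X = _)%N]big1 ?addn0; last by move=> *; rewrite muln0.
    by apply: eq_big => [p|p _]; rewrite ?muln1 // -val_eqE /= lt0n.
  by apply: eq_big => [p|p _]; rewrite ?muln1 // -val_eqE /= lt0n.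
have -> : w = letter_wt d e o c.
  have cw i : col_wt d (d + i) = i.+1 by rewrite /col_wt ltnNge leq_addr addKn.
  have cw0 : col_wt d 0 = 0%N by rewrite /col_wt d0.
  have cwp (p : 'I_d) : p != z0 -> col_wt d p = 1%N by rewrite -val_eqE /= /col_wt ltn_ord => ->.
  have -> : letter_wt d e o c = (o 0 + \sum_(p < d | p != z0) o p * 2 + (\sum_(p < d | p != z0) c p * 1
      + (c d + \sum_(i < e | i != z1) c (d + i) * i.+1)))%N.
    rewrite /letter_wt; congr (_ + _)%N.
      rewrite (bigD1 z0) //= cw0 muln1; congr (_ + _)%N.
      by apply: eq_bigr => p /cwp ->.
    rewrite big_split_ord; congr (_ + _)%N.
      rewrite (bigD1 z0) //= cz mul0n add0n.
      by apply: eq_bigr => p /cwp ->.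
    rewrite (bigD1 z1) //= (cw 0%N) addn0 muln1; congr (_ + _)%N.
    by apply: eq_bigr => i _; rewrite cw.
  rewrite /w; move: (\sum_(i | _) _)%N (\sum_(i | _) _)%N (\sum_(i | _) _)%N => s1 s2 s3.
  by move: je jc; move: j (o 0) (c d) => u v t; clear; nia.
suff -> : M = letter_mnm o c by [].
have sumU (I : finType) (Q : pred I) (f : I -> L) (n : I -> nat) u :
    ((\big[mnm_add/0%MM]_(i | Q i) (U (f i) *+ n i))%MM (enum_rank u) = \sum_(i | Q i) (f i == u) * n i)%N.
  by rewrite mnm_sumE; apply: eq_bigr => i _; rewrite mulmnE mnm1E (inj_eq enum_rank_inj).
have pick1 (I : finType) (Q : pred I) (n : I -> nat) i0 : (\sum_(i | Q i) (i == i0) * n i = Q i0 * n i0)%N.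
  case: (boolP (Q i0)) => q; last first.
    by rewrite big1 // => i qi; case: eqP => // E; rewrite -E qi in q.
  by rewrite (bigD1 i0) //= eqxx big1 ?addn0 // => i /andP[_ /negPf->].
have none (I : finType) (Q : pred I) (n : I -> nat) : (\sum_(i | Q i) false * n i = 0)%N by rewrite big1.
apply/mnmP => u; rewrite -(enum_valK u) /M !mnmDE !sumU !mulmnE !mnmDE !mulmnE !mnm1E !(inj_eq enum_rank_inj).
rewrite [RHS]mnmE enum_rankK; case: (enum_val u) => [[p|p]|i].
- rewrite /= !none (eq_bigr (fun q : 'I_d => (q == p) * c q)%N) // pick1 !mul0n !addn0 add0n.
  by case: eqP => [->|]; rewrite ?mul1n ?mul0n //= cz.
- rewrite /= !none (eq_bigr (fun q : 'I_d => (q == p) * o q)%N) // pick1 !mul0n !addn0.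
  rewrite (_ : (y2v e (Ordinal d0) == inl (inr p)) = (z0 == p)) // eq_sym.
  case: (eqVneq p z0) => [->|_] /=; last by rewrite !mul0n mul1n !addn0.
  by rewrite !mul1n mul0n add0n [(e * j)%N]mulnC subnK.
- rewrite /= !none (eq_bigr (fun q : 'I_e => (q == i) * c (d + q))%N) // pick1 !mul0n !addn0 !add0n.
  rewrite (_ : (xv d (Ordinal e0) == inr i) = (z1 == i)) // eq_sym.
  case: (eqVneq i z1) => [->|_] /=; last by rewrite !mul0n mul1n !addn0.
  by rewrite !mul1n mul0n add0n addn0 subnK.
Qed.

End Monomials.

(** * The injection on monomials of fixed T-degree *)

Section Independence.
Variables (K : fieldType) (d e : nat).
Hypotheses (d0 : (0 < d)%N) (e0 : (0 < e)%N).
Local Notation N := (d + e)%N.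
Local Notation V := (Pvar d e).
Local Notation L := (Svar d e).
Local Notation A := (@Sring K d e).
Local Notation P := (@Pring K d e).
Local Notation eval := (@eval K d e d0).
Implicit Type m : 'X_{1..#|V|}.

Let u0 : 'I_#|V| := enum_rank (inl (y1v e (Ordinal d0)) : V).

Definition strip m : 'X_{1..#|V|} := (m - U_(u0) *+ m u0)%MM.

Lemma stripE m : m = (strip m + U_(u0) *+ m u0)%MM.
Proof.
rewrite submK //; apply/mnm_lepP => i; rewrite mulmnE mnm1E.
by case: eqP => [->|_]; rewrite ?mul1n ?mul0n.
Qed.

Lemma strip_u0 m : strip m u0 = 0%N.
Proof. by rewrite mnmBE mulmnE mnm1E eqxx mul1n subnn. Qed.

Lemma strip_le m i : (strip m i <= m i)%N.
Proof. by rewrite mnmBE leq_subr. Qed.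

Lemma strip_other m i : i != u0 -> strip m i = m i.
Proof. by rewrite mnmBE mulmnE mnm1E eq_sym => /negPf ->; rewrite mul0n subn0. Qed.

Lemma grade_strip f m : f (inl (y1v e (Ordinal d0))) = 0%N -> grade f (strip m) = grade f m.
Proof.
move=> f0; rewrite [in RHS](stripE m) gradeD [X in _ = (_ + X)%N](_ : _ = 0%N) ?addn0 //.
elim: (m u0) => [|n IH]; first by rewrite mulm0n /grade big1 // => v _; rewrite mnm0E.
by rewrite mulmS gradeD IH grade_var f0.
Qed.

Lemma eval_strip m : eval 'X_[strip m] = eval 'X_[m].
Proof.
rewrite [in RHS](stripE m) mpolyXD rmorphM /= -mpolyXn rmorphXn /=.
have -> : eval 'X_u0 = 1 by have := @eval_y1 K d e d0 (Ordinal d0); rewrite eqxx.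
by rewrite expr1n mulr1.
Qed.

Lemma standard_le x y : standard d x -> (forall p, fo x p = fo y p) ->
  (forall c, (fc y c <= fc x c)%N) -> (forall a b, arcs x a b = arcs y a b) -> standard d y.
Proof.
move=> [h1 h2 h3 h4 h5 h6] eo ec ea; split.
- by move=> a b g ab bg bd h; rewrite -ea; apply: (h1 _ _ _ ab bg bd); apply: leq_trans h (ec _).
- by move=> a b g ab bg bd h; rewrite -ea; apply: (h2 _ _ _ ab bg bd); apply: leq_trans h (ec _).
- by move=> a b g ab h; rewrite -ea; apply: (h3 _ _ _ ab); rewrite eo.
- by move=> a b g ab bg h; rewrite -ea; apply: (h4 _ _ _ ab bg); apply: leq_trans h (ec _).
- by move=> a b g h; rewrite -!ea; exact: h5.
- by move=> a b g h; rewrite -!ea; exact: h6.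
Qed.

Lemma standard_strip m : standard d (config_of m) -> standard d (config_of (strip m)).
Proof.
move=> h; apply: (standard_le h).
- by move=> p /=; case: insubP => //= j _ _; rewrite strip_other // (inj_eq enum_rank_inj).
- by move=> c /=; case: insubP => //= j _ _; exact: strip_le.
- move=> a b /=; rewrite /arc_of; case: insubP => //= a' _ _; case: insubP => //= b' _ _.
  by case: insubP => //= t _ _; rewrite strip_other // (inj_eq enum_rank_inj).
Qed.

Definition good k m := [/\ standard d (config_of m), m u0 = 0%N & tdeg m = k].

(** The variable y_{1,0} is the only one of weight 0, so excluding it leaves finitely many monomials
    of bounded weight. *)
Lemma mdeg_good k m : good k m -> (mdeg m <= wdeg m)%N.
Proof.
case=> _ h _; rewrite mdegE /wdeg /grade (reindex (@enum_rank V)) /=; last by apply: onW_bij; exact: enum_rank_bij.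
apply: leq_sum => v _; case: v => [[[j|j]|j]|t]; [|by rewrite leq_pmulr..].
have [->|jz] := eqVneq j (Ordinal d0); first by rewrite [X in (X <= _)%N]h.
by rewrite leq_pmulr // (@var_wt_y1 d e d0) jz.
Qed.

Definition img_mnm m := letter_mnm d e (img_o d e (config_of m)) (img_c d e (config_of m)).

Lemma admissible_good k m : good k m -> admissible d e (config_of m).
Proof.
case=> h1 h2 _; split=> //; first exact: supported_config.
by have := fc_config m (lshift e (Ordinal d0)); rewrite /cv (unsplitK (inl _ : 'I_d + 'I_e)) h2.
Qed.

Lemma img_mnm_inj k m1 m2 : good k m1 -> good k m2 -> img_mnm m1 = img_mnm m2 -> m1 = m2.
Proof.
move=> g1 g2 E; have [|||h1 h2 h3] := image_inj d0 e0 (admissible_good g1) (admissible_good g2); last exact: config_inj.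
- by rewrite !tdeg_config; case: g1 => _ _ ->; case: g2.
- move=> p pd; have := congr1 (fun M : 'X_{1..#|L|} => M (enum_rank (y2v e (Ordinal pd) : L))) E.
  by rewrite !mnmE enum_rankK.
move=> c cN; have [cd|dc] := ltnP c d.
  have := congr1 (fun M : 'X_{1..#|L|} => M (enum_rank (y1v e (Ordinal cd) : L))) E.
  by rewrite !mnmE enum_rankK.
have ce : (c - d < e)%N by rewrite ltn_subLR.
have := congr1 (fun M : 'X_{1..#|L|} => M (enum_rank (xv d (Ordinal ce) : L))) E.
by rewrite !mnmE enum_rankK /= subnKC.
Qed.

Definition img_elt m : A := @letter_elt K d e d0 e0 (img_o d e (config_of m)) (img_c d e (config_of m)).

Lemma rep_img k m : good k m -> exists2 k', (k <= k')%N & rep d0 e0 k' (wdeg m) (img_mnm m) (img_elt m).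
Proof.
move=> g; have [s y t] := admissible_good g; exists (power d e (img_o d e (config_of m)) (img_c d e (config_of m))).
  by case: g => _ _ <-; rewrite -tdeg_config; apply: power_img.
rewrite -wdeg_config -weight_img //; apply: rep_letter_elt.
by rewrite /img_c leqNgt d0.
Qed.

End Independence.

Section Free.
Variables (K : fieldType) (d e : nat).
Hypotheses (d0 : (0 < d)%N) (e0 : (0 < e)%N).
Local Notation V := (Pvar d e).
Local Notation P := (@Pring K d e).
Local Notation eval := (@eval K d e d0).
Local Notation good := (@good d e d0).
Local Notation strip := (@strip d e d0).
Implicit Type m : 'X_{1..#|V|}.

Lemma good_strip k m m' : tdeg m = k -> reduced K m' -> preserved m m' ->
  good k (strip m') /\ wdeg (strip m') = wdeg m.
Proof.
move=> tm rm' [_ tm' wm'].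
have om0 : var_wt (inl (y1v e (Ordinal d0))) = 0%N by rewrite (@var_wt_y1 d e d0) eqxx.
split; last by rewrite -wm'; apply: grade_strip.
split; [apply: standard_strip; exact: (standard_config rm')|exact: strip_u0|].
by rewrite -tm -tm'; apply: grade_strip.
Qed.

Lemma good_free k (s : seq 'X_{1..#|V|}) (x : 'X_{1..#|V|} -> K) : uniq s ->
    (forall m, m \in s -> good k m) ->
  \sum_(m <- s) x m *: eval 'X_[m] = 0 -> forall m, m \in s -> x m = 0.
Proof.
move=> us sg xs0.
pose W := (\max_(m <- s) wdeg m)%N.
pose bounded : seq 'X_{1..#|V|} := [seq val u | u <- enum {: 'X_{1..#|V| < W.+1}}].
have [S [uS memS]] := classical_list (fun m => good k m /\ (wdeg m <= W)%N) bounded.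
have {}memS m : m \in S <-> good k m /\ (wdeg m <= W)%N.
  split=> [/memS[]//|[g w]]; apply/memS; split=> //.
  have b : (mdeg m < W.+1)%N by apply: leq_trans (mdeg_good g) _.
  by apply/mapP; exists (BMultinom b); rewrite ?mem_enum.
have sS m : m \in s -> m \in S.
  by move=> ms; apply/memS; split; [exact: sg|rewrite /W; apply: leq_bigmax_seq].
pose Sn (i : 'I_(size S)) := nth 0%MM S i.
have SnS i : Sn i \in S by apply: mem_nth.
have Sninj : injective Sn by move=> i j /eqP; rewrite nth_uniq // => /eqP/val_inj.
pose f i := eval 'X_[Sn i]; pose b i := img_elt K d0 e0 (Sn i).
pose spanned a := exists c : 'I_(size S) -> K, a = \sum_j c j *: f j.
have span0 : spanned 0 by exists (fun=> 0); rewrite big1 // => j _; rewrite scale0r.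
have spanD a1 a2 : spanned a1 -> spanned a2 -> spanned (a1 + a2).
  move=> [c1 ->] [c2 ->]; exists (fun j => c1 j + c2 j); rewrite -big_split.
  by apply: eq_bigr => j _; rewrite scalerDl.
have spanZ y a : spanned a -> spanned (y *: a).
  by move=> [c ->]; exists (fun j => y * c j); rewrite scaler_sumr; apply: eq_bigr => j _; rewrite scalerA.
have spanS m : m \in S -> spanned (eval 'X_[m]).
  move=> mS; have iS : (index m S < size S)%N by rewrite index_mem.
  exists (fun j => (j == Ordinal iS)%:R); rewrite (bigD1 (Ordinal iS)) //= eqxx scale1r big1 ?addr0.
    by rewrite /f /Sn nth_index.
  by move=> j /negPf ->; rewrite scale0r.
have span_sum (I : eqType) (r : seq I) (F : I -> Sring K d e) : (forall i, i \in r -> spanned (F i)) -> spanned (\sum_(i <- r) F i).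
  by move=> h; rewrite big_seq; apply: big_ind => // i; exact: h.
have evalE p : eval p = \sum_(m <- msupp p) p@_m *: eval 'X_[m].
  rewrite {1}(mpolyE p) rmorph_sum; apply: eq_bigr => m _ /=.
  by rewrite -mul_mpolyC rmorphM /= -/(eval _) evalC mul_mpolyC.
(* Of the T-degrees offered by [flex], exactly [k] is taken. Division keeps T-degree and weight, and
   removing y_{1,0} changes neither of them nor the value of [eval], so the result stays in the span
   of the list [S]. *)
have spanb i : spanned (b i).
  have [gi wi] := iffLR (memS _) (SnS i).
  have [k' kk' [fl _]] := rep_img K e0 gi.
  rewrite /b; have [p <- hp] := fl _ kk'.
  rewrite evalE; apply: (span_sum _) => m /hp[tm wm]; apply: (spanZ _).
  have [q <- hq] := reduction (@eval_relation K d e d0 e0) m.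
  rewrite evalE; apply: (span_sum _) => m' /hq[rm' pm']; apply: (spanZ _).
  have [g w] := good_strip tm rm' pm'.
  by rewrite -(eval_strip K d0); apply: (spanS _); apply/memS; rewrite w wm.
have [C hC] := fin_all_exists spanb.
have topb i : top_form (enum_rank (xv d (Ordinal e0) : Svar d e)) (img_mnm (Sn i)) (b i).
  have [gi _] := iffLR (memS _) (SnS i).
  by have [k' _ [_]] := rep_img K e0 gi; apply.
have freeb := top_free _ topb.
have ii : injective (fun i => img_mnm (Sn i)).
  move=> i j h; apply: Sninj; have [gi _] := iffLR (memS _) (SnS i); have [gj _] := iffLR (memS _) (SnS j).
  by apply: (img_mnm_inj e0 gi gj); exact: h.
have fC i : b i = \sum_j (\matrix_(i, j) C i j) i j *: f j.
  by rewrite hC; apply: eq_bigr => j _; rewrite mxE.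
have := free_transfer fC (freeb ii) (x := fun i => if Sn i \in s then x (Sn i) else 0).
have -> : \sum_i (if Sn i \in s then x (Sn i) else 0) *: f i = 0.
  rewrite -[RHS]xs0 -(big_mkord predT (fun i => (if nth 0%MM S i \in s then x (nth 0%MM S i) else 0) *: eval 'X_[nth 0%MM S i])).
  rewrite -(big_nth 0%MM predT (fun m => (if m \in s then x m else 0) *: eval 'X_[m])).
  rewrite (bigID (mem s)) /= [X in _ + X]big1_seq ?addr0 => [|m /andP[/negPf-> _]]; last by rewrite scale0r.
  rewrite -big_filter (perm_big s); last first.
    apply: uniq_perm => //; first exact: filter_uniq.
    by move=> m; rewrite mem_filter; apply/andP/idP => [[]//|ms]; split=> //; exact: sS.
  by rewrite big_seq [RHS]big_seq; apply: eq_bigr => m ->.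
move=> /(_ erefl) h m ms; have iS : (index m S < size S)%N by rewrite index_mem sS.
by have := h (Ordinal iS); rewrite /Sn nth_index ?sS // ms.
Qed.
End Free.

(** * The kernel of the presentation *)

Lemma det_mx2 (R : comNzRingType) (B : 'M[R]_2) : \det B = B 0 0 * B 1 1 - B 0 1 * B 1 0.
Proof.
rewrite (expand_det_row _ 0) big_ord_recl big_ord1 /cofactor !det_mx11 !mxE /= expr0 expr1 mul1r mulN1r mulrN.
by congr (_ * B _ _ - B _ _ * B _ _); apply: val_inj.
Qed.

Section Presentation.
Variables (K : fieldType) (d e : nat).
Local Notation N := (d + e)%N.
Local Notation V := (Pvar d e).
Local Notation L := (Svar d e).
Local Notation P := (@Pring K d e).
Local Notation S := (@Sring K d e).
Local Notation Lmx := (@Lmx K d e).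

Definition piR_rmorph : {rmorphism P -> {poly S}} :=
  mmap (polyC \o @mpolyC #|L| K) (@piR_var K d e \o enum_val).

Lemma minorLE (a b : 'I_N) : minorL K a b = Lmx 0 a * Lmx 1 b - Lmx 0 b * Lmx 1 a.
Proof. by rewrite /minorL det_mx2 ![colsub _ _ _ _]mxE !(tnth_nth a) /=. Qed.

Lemma piR_relation (g : P) : rees_relation g -> piR g = 0.
Proof.
apply: (@relation_kernel K d e _ piR_rmorph (fun c => (Lmx 0 c)%:P) (fun c => (Lmx 1 c)%:P) 'X) => [c|c|a b ab].
- exact: piR_SinP.
- exact: piR_SinP.
- have := piR_T K ab; rewrite -[piR _]/(piR_rmorph _) -T_var => ->.
  by rewrite minorLE -!polyCM -polyCB mul_polyC.
Qed.

End Presentation.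

(* The extra column.  When e = 0 a column x_0 is added as well, since the
   specialization needs both kinds of columns. *)
Section Embedding.
Variables (K : fieldType) (d e : nat).
Local Notation N := (d + e)%N.
Local Notation V := (Pvar d e).
Local Notation L := (Svar d e).
Local Notation P := (@Pring K d e).
Local Notation S := (@Sring K d e).
Local Notation d' := d.+1.
Local Notation e' := (maxn e 1).
Local Notation N' := (d' + e')%N.
Local Notation V' := (Pvar d' e').
Local Notation S' := (@Sring K d' e').
Local Notation eval' := (@eval K d' e' (ltn0Sn d)).
Implicit Type m : 'X_{1..#|V|}.

Let e0 : (0 < e')%N. Proof. by rewrite leq_max orbT. Qed.

Lemma shift_colP (c : 'I_N) : (c.+1 < N')%N.
Proof. by rewrite addSn ltnS; apply: leq_trans (ltn_ord c) _; rewrite leq_add2l leq_maxl. Qed.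
Definition shift_col (c : 'I_N) : 'I_N' := Ordinal (shift_colP c).

Definition shift_y1 (j : 'I_d) : 'I_d' := lift ord0 j.
Definition shift_x (i : 'I_e) : 'I_e' := widen_ord (leq_maxl e 1) i.

Definition shift (v : V) : V' :=
  match v with
  | inl (inl (inl j)) => inl (y1v e' (lift ord0 j))
  | inl (inl (inr j)) => inl (y2v e' (lift ord0 j))
  | inl (inr i) => inl (xv d' (shift_x i))
  | inr t => inr (exist _ (shift_col (val t).1, shift_col (val t).2) (valP t))
  end.

Lemma shift_inj : injective shift.
Proof.
move=> [[[j|j]|j]|[[a b] ab]] [[[k|k]|k]|[[a1 b1] ab1]] //=.
- by case=> /val_inj ->.
- by case=> /val_inj ->.
- by case=> /val_inj ->.
- by case=> /val_inj E1 /val_inj E2; congr (inr _); apply: val_inj; rewrite /= E1 E2.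
Qed.

Definition theta_var (s : L) : S' := eval' (@varP K d' e' (shift (inl s))).

Definition theta : {rmorphism S -> S'} := mmap (@mpolyC _ K) (theta_var \o enum_val).

Lemma theta_varS s : theta (@varS K d e s) = theta_var s.
Proof. by rewrite /theta /= mmapX mmap1U /= enum_rankK. Qed.

Lemma theta_L0 c : theta (@Defs.Lmx K d e 0 c) = @erow0 K d' e' (ltn0Sn d) (shift_col c).
Proof.
rewrite mxE; case: splitP => j E.
  rewrite theta_varS /theta_var eval_varP /=; congr erow0; apply: val_inj; by rewrite /= E.
rewrite /xS add0n valK /= theta_varS /theta_var eval_varP /=; congr erow0; apply: val_inj.
by rewrite /= E addSn.
Qed.

Lemma theta_L1 c : theta (@Defs.Lmx K d e 1 c) = @erow1 K d' e' (ltn0Sn d) (shift_col c).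
Proof.
rewrite mxE; case: splitP => j E.
  rewrite theta_varS /theta_var eval_varP /=; congr erow1; apply: val_inj; by rewrite /= E.
have -> : shift_col c = rshift d' (shift_x j) by apply: val_inj; rewrite /= E addSn.
rewrite /erow1 (unsplitK (inr _ : 'I_d' + 'I_e')) add1n /=.
(* The index [j] witnesses that there is an x column, so none was added and the row ends at the same
   place. *)
have e1 : e' = e by have := ltn_ord j; lia.
have -> : (j.+1 < e')%N = (j.+1 < e)%N by rewrite e1.
rewrite {1}/xS; case: insubP => [i lt ei|/negPf h] /=; last by rewrite h raddf0.
by rewrite lt [LHS]theta_varS /theta_var eval_varP /= /erow0 (unsplitK (inr _ : 'I_d' + 'I_e')) /= ei.
Qed.

Lemma theta_piR v : map_poly theta (@piR_var K d e v) = (eval' (@varP K d' e' (shift v)))%:P * 'X^(is_T v).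
Proof.
case: v => [s|[[a b] ab]] /=; first by rewrite map_polyC /= theta_varS mulr1.
rewrite map_polyZ map_polyX mul_polyC expr1 minorLE rmorphB !rmorphM /= !theta_L0 !theta_L1.
by rewrite eval_varP.
Qed.

Definition shift_mnm m : 'X_{1..#|V'|} := (\big[mnm_add/0%MM]_(v : V) (U_(enum_rank (shift v)) *+ m (enum_rank v)))%MM.

Lemma shift_mnmE m v : shift_mnm m (enum_rank (shift v)) = m (enum_rank v).
Proof.
rewrite /shift_mnm mnm_sumE (bigD1 v) //= mulmnE mnm1E eqxx mul1n big1 ?addn0 // => w wv.
by rewrite mulmnE mnm1E (inj_eq enum_rank_inj) (inj_eq shift_inj) (negPf wv).
Qed.

Lemma shift_mnm_inj : injective shift_mnm.
Proof. by move=> m1 m2 E; apply/mnmP => i; rewrite -(enum_valK i) -!shift_mnmE E. Qed.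

Lemma shift_mnm_gt0 m v' : (0 < shift_mnm m (enum_rank v'))%N -> exists2 v, v' = shift v & (0 < m (enum_rank v))%N.
Proof.
move=> h; have [v /eqP e1|no] := pickP (fun v => shift v == v').
  by exists v => //; rewrite -shift_mnmE e1.
move: h; rewrite /shift_mnm mnm_sumE big1 // => v _.
by rewrite mulmnE mnm1E (inj_eq enum_rank_inj) no.
Qed.

(** Setting tau to 1 loses the T-degree; here the exponent of tau remembers it, so that a relation
    under [piR] splits into relations under [eval'], one for each T-degree. *)
Lemma map_piR m : map_poly theta (piR_rmorph K d e 'X_[m]) = (eval' 'X_[shift_mnm m])%:P * 'X^(tdeg m).
Proof.
rewrite /piR_rmorph /= mmapX /mmap1 rmorph_prod /=.
rewrite (reindex (@enum_rank V)) /=; last by apply: onW_bij; exact: enum_rank_bij.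
rewrite /shift_mnm (big_morph (fun y => 'X_[y]) (@mpolyXD _ K) (@mpolyX0 _ K)) rmorph_prod /= rmorph_prod /tdeg /grade -prodrXr -big_split.
apply: eq_bigr => v _ /=; rewrite enum_rankK.
transitivity (map_poly theta (@piR_var K d e v) ^+ m (enum_rank v)); first exact: rmorphXn.
rewrite theta_piR exprMn -polyC_exp -exprM mulnC; congr (_%:P * _).
by rewrite -mpolyXn; apply/esym; exact: (rmorphXn eval').
Qed.

End Embedding.

(** * Transport of standard monomials to the enlarged matrix *)

Section Shifted.
Variables (K : fieldType) (d e : nat).
Local Notation N := (d + e)%N.
Local Notation V := (Pvar d e).
Local Notation d' := d.+1.
Local Notation e' := (maxn e 1).
Local Notation N' := (d' + e')%N.
Local Notation V' := (Pvar d' e').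
Local Notation eval' := (@eval K d' e' (ltn0Sn d)).
Implicit Type m : 'X_{1..#|V|}.

Lemma shift_cv c : shift (cv c : V) = cv (shift_col c) :> V'.
Proof.
rewrite /cv; case: splitP => j E.
  have -> : shift_col c = lshift e' (shift_y1 j) by apply: val_inj; rewrite /= E.
  by rewrite (unsplitK (inl _ : 'I_d' + 'I_e')).
have -> : shift_col c = rshift d' (shift_x j) by apply: val_inj; rewrite /= E addSn.
by rewrite (unsplitK (inr _ : 'I_d' + 'I_e')).
Qed.

Lemma shift_fo m p : (0 < fo (config_of (shift_mnm m)) p)%N ->
  exists2 q, p = q.+1 & (0 < fo (config_of m) q)%N.
Proof.
move=> /fo_gt0[j -> /shift_mnm_gt0[[[[i|i]|i]|t] //= [->] h]].
by exists i; rewrite ?valK.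
Qed.

Lemma shift_fc m c : (0 < fc (config_of (shift_mnm m)) c)%N ->
  exists2 b, c = b.+1 & (0 < fc (config_of m) b)%N.
Proof.
move=> /fc_gt0[j -> /shift_mnm_gt0[v ev h]].
have [b eb] : exists b : 'I_N, v = cv b.
  have : ~~ is_y2 (cv j) /\ ~~ is_T (cv j) by rewrite /cv; case: splitP.
  rewrite ev; case: v {ev h} => [[[i|i]|i]|t] //= [] // _ _.
    by exists (lshift e i); rewrite /cv (unsplitK (inl _ : 'I_d + 'I_e)).
  by exists (rshift d i); rewrite /cv (unsplitK (inr _ : 'I_d + 'I_e)).
exists b; last by rewrite fc_config -eb.
have : wt1 (cv j) j = wt1 (shift v) j by rewrite ev.
by rewrite eb shift_cv !wt1_cv eqxx; case: eqP => // ->.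
Qed.

Lemma shift_arc m a b : (0 < arcs (config_of (shift_mnm m)) a b)%N ->
  exists a0 b0, [/\ a = a0.+1, b = b0.+1 & (0 < arcs (config_of m) a0 b0)%N].
Proof.
move=> /arc_gt0[a' [b' [ab [-> -> /shift_mnm_gt0[[[[i|i]|i]|[[u v] uv]] //= [-> ->] h]]]]].
by exists u, v; split=> //; rewrite -[arc_of m u v]/(arcs (config_of m) u v) (arc_config _ uv).
Qed.

(** The conditions only compare columns with each other and with d, all of which move by one, and
    the added columns carry no exponent. *)
Lemma shift_standard m : standard d (config_of m) -> standard d' (config_of (shift_mnm m)).
Proof.
move=> [h1 h2 h3 h4 h5 h6].
have zero n (x := n : nat) : ((0 < x)%N -> False) -> x = 0%N by case: x => // n' /(_ isT).
split.
- move=> a b g ab bg bd /shift_fc[b1 eb hb]; apply: zero => /shift_arc[a1 [g1 [ea eg]]]; subst.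
  by rewrite (@h1 a1 b1 g1).
- move=> a b g ab bg db /shift_fc[g1 eg hg]; apply: zero => /shift_arc[a1 [b1 [ea eb]]]; subst.
  by rewrite (@h2 a1 b1 g1).
- move=> a b g ab /shift_fo[a1 ea ha]; apply: zero => /shift_arc[b1 [g1 [eb eg]]]; subst.
  by rewrite (@h3 a1 b1 g1).
- move=> a b g da ab /shift_fc[a1 ea ha]; apply: zero => /shift_arc[b1 [g1 [eb eg]]]; subst.
  case: ea ha => <- ha; case: a da ab ha => // a da ab ha; by rewrite (@h4 a b1 g1).
- move=> a b g h ab bg gh /shift_arc[a1 [g1 [ea eg h7]]]; apply: zero => /shift_arc[b1 [i1 [eb ei]]]; subst.
  by rewrite (@h5 a1 b1 g1 i1).
- move=> a b g h da bg gh /shift_arc[a1 [b1 [ea eb h7]]]; apply: zero => /shift_arc[g1 [i1 [eg ei]]]; subst.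
  by rewrite (@h6 a1 b1 g1 i1).
Qed.

Lemma shift_tdeg m : tdeg (shift_mnm m) = tdeg m.
Proof.
rewrite /tdeg {2}/grade /shift_mnm.
have g0 f : grade f (0%MM : 'X_{1..#|V'|}) = 0%N by rewrite /grade big1 // => v _; rewrite mnm0E.
rewrite (big_morph _ (gradeD _) (g0 _)); apply: eq_bigr => v _.
have -> : is_T v = is_T (shift v) by case: v => [[[]|]|].
elim: (m _) => [|n IH]; first by rewrite mulm0n g0.
by rewrite mulmS gradeD IH grade_var mulSn.
Qed.

Lemma shift_good m : standard d (config_of m) -> good (ltn0Sn d) (tdeg m) (shift_mnm m).
Proof.
move=> sm; split; [exact: shift_standard|apply/eqP; rewrite -leqn0 leqNgt|exact: shift_tdeg].
by apply/negP => /shift_mnm_gt0[[[[i|i]|i]|t] //= /eqP].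
Qed.

Definition unshift (m' : 'X_{1..#|V'|}) : 'X_{1..#|V|} :=
  [multinom m' (enum_rank (shift (enum_val i))) | i < #|V|].

Lemma shift_mnmK : cancel (@shift_mnm d e) unshift.
Proof. by move=> m; apply/mnmP => i; rewrite mnmE shift_mnmE enum_valK. Qed.

Lemma map_piRZ c m : map_poly (@theta K d e) (piR_rmorph K d e (c *: 'X_[m])) =
  (c *: eval' 'X_[shift_mnm m])%:P * 'X^(tdeg m).
Proof.
rewrite -!mul_mpolyC rmorphM [X in X * _](mmapC _ _ c) rmorphM /= map_polyC /= polyCM -mulrA; congr (_%:P * _).
  exact: mmapC.
exact: map_piR.
Qed.

Lemma map_piR0 (p : @Pring K d e) : piR p = 0 -> map_poly (@theta K d e) (piR_rmorph K d e p) = 0.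
Proof. by move=> p0; rewrite [piR_rmorph _ _ _ _]p0 map_poly0. Qed.

Lemma coef_map_piR (p : @Pring K d e) k : (map_poly (@theta K d e) (piR_rmorph K d e p))`_k =
  \sum_(m <- msupp p | tdeg m == k) p@_m *: eval' 'X_[shift_mnm m].
Proof.
have -> : map_poly (@theta K d e) (piR_rmorph K d e p) =
    \sum_(m <- msupp p) map_poly (@theta K d e) (piR_rmorph K d e (p@_m *: 'X_[m])).
  transitivity (map_poly (@theta K d e) (\sum_(m <- msupp p) piR_rmorph K d e (p@_m *: 'X_[m]))); last exact: raddf_sum.
  congr (map_poly _ _); transitivity (piR_rmorph K d e (\sum_(m <- msupp p) p@_m *: 'X_[m])); last exact: raddf_sum.
  by congr (piR_rmorph _ _ _ _); exact: mpolyE.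
rewrite coef_sum [RHS]big_mkcond; apply: eq_bigr => m _; rewrite map_piRZ coefCM coefXn eq_sym.
by case: eqP => _; rewrite ?mulr1 ?mulr0.
Qed.

Lemma standard_kernel (p : @Pring K d e) :
    (forall m, m \in msupp p -> standard d (config_of m)) -> piR p = 0 -> p = 0.
Proof.
move=> sp p0; apply/mpolyP => m0; rewrite mcoeff0; apply: memN_msupp_eq0; apply/negP => m0p.
have e0 : (0 < e')%N by rewrite leq_max orbT.
pose s := [seq m <- msupp p | tdeg m == tdeg m0].
have sum0 : \sum_(m <- s) p@_m *: eval' 'X_[shift_mnm m] = 0.
  by rewrite big_filter -coef_map_piR map_piR0 // coef0.
have h := @good_free K d' e' (ltn0Sn d) e0 (tdeg m0) [seq shift_mnm m | m <- s] (fun y => p@_(unshift y)).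
suff: p@_m0 = 0 by apply/eqP; rewrite -mcoeff_msupp.
rewrite -(shift_mnmK m0); apply: h.
- by rewrite (map_inj_uniq (@shift_mnm_inj d e)) filter_uniq // msupp_uniq.
- move=> y /mapP[m]; rewrite mem_filter => /andP[/eqP <- mp] ->; apply: shift_good; exact: sp.
- by rewrite big_map -[RHS]sum0; apply: eq_bigr => m _; rewrite shift_mnmK.
- by apply: map_f; rewrite mem_filter eqxx.
Qed.

End Shifted.

Lemma ideal_gen_sub n (K : fieldType) (A B : {mpoly K[n]} -> Prop) :
  (forall q, A q -> ideal_gen B q) -> forall p, ideal_gen A p -> ideal_gen B p.
Proof.
move=> AB p [s [hs ->]]; elim: s hs => [|[a q] s IH] hs.
  by exists [::]; split=> //; rewrite !big_nil.
have [t [ht et]] := IH (fun qa qs => hs qa (mem_behead (s := _ :: _) qs)).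
have [u [hu eu]] := AB _ (hs _ (mem_head _ _)).
exists ([seq (a * i.1, i.2) | i <- u] ++ t); split.
  by move=> i; rewrite mem_cat => /orP[/mapP[j /hu ju ->]|/ht].
rewrite big_cons big_cat big_map -et /= [X in _ * X]eu mulr_sumr; congr (_ + _).
by apply: eq_bigr => i _; rewrite mulrA.
Qed.

(** * From independence to the Gröbner basis *)

Section Main.
Variables (K : fieldType) (d e : nat).
Local Notation V := (Pvar d e).
Local Notation P := (@Pring K d e).
Local Notation lt := (@mono_lt d e).
Implicit Type m : 'X_{1..#|V|}.

Let irr : irreflexive lt. Proof. by have [] := mono_lt_monomial_order d e. Qed.
Let tr : transitive lt. Proof. by have [] := mono_lt_monomial_order d e. Qed.

Lemma lead_pair_lead (v w : V) : lead_pair K v w ->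
  exists2 g : P, rees_relation g & is_lead lt g (pair_mnm v w).
Proof.
move=> [g [c [s [rg c0 eg hs]]]]; exists g => //.
have low m : m \in msupp (\sum_(i <- s) i.1 *: 'X_[pair_mnm i.2.1 i.2.2] : P) -> lt m (pair_mnm v w).
  move=> /msupp_sum_le /flattenP[/= ms] /mapP[i]; rewrite filter_predT => is_ -> /msuppZ_le.
  by rewrite msuppX inE => /eqP ->; have [] := hs i is_.
split.
  rewrite mcoeff_msupp eg mcoeffD mcoeffZ mcoeffX eqxx mulr1 memN_msupp_eq0 ?addr0 //.
  by apply/negP => /low; rewrite irr.
move=> m; rewrite eg => /msuppD_le; rewrite mem_cat => /orP[/msuppZ_le|/low //].
by rewrite msuppX inE => ->.
Qed.

Lemma piRD (p q : P) : piR (p + q) = piR p + piR q.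
Proof. exact: (rmorphD (piR_rmorph K d e)). Qed.

Lemma piRZ c (p : P) : piR (c *: p) = (c%:MP)%:P * piR p.
Proof.
rewrite -mul_mpolyC; transitivity (piR c%:MP * piR p); first exact: (rmorphM (piR_rmorph K d e)).
by congr (_ * _); exact: mmapC.
Qed.

Lemma reduce_below m0 (s : seq 'X_{1..#|V|}) (c : 'X_{1..#|V|} -> K) : (forall m, m \in s -> lt m m0) ->
  exists2 q : P, piR q = piR (\sum_(m <- s) c m *: 'X_[m]) &
    forall m, m \in msupp q -> reduced K m /\ lt m m0.
Proof.
elim: s => [|m s IH] hs; first by exists 0; rewrite ?big_nil // => m; rewrite msupp0.
have [q eq hq] := IH (fun m' h => hs m' (mem_behead (s := _ :: _) h)).
have [r er hr] : exists2 r : P, piR r = piR 'X_[m] &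
    forall m', m' \in msupp r -> reduced K m' /\ preserved m m'.
  exact: (reduction (phi := piR_rmorph K d e) (@piR_relation K d e) m).
exists (c m *: r + q); first by rewrite big_cons !piRD !piRZ er eq.
move=> m' /msuppD_le; rewrite mem_cat => /orP[/msuppZ_le/hr[rm [le _ _]]|]; last exact: hq.
split; first exact: rm.
have lm := hs m (mem_head _ _); by case/orP: le => [/eqP ->|h]; [exact: lm|exact: tr h lm].
Qed.

(** If no leading pair divided [m], dividing only the lower terms of [f] would give a kernel element
    supported on standard monomials, hence zero by [standard_kernel]; but its coefficient at [m] is
    still that of [f]. *)
Lemma lead_divisible (f : P) m : ker_piR f -> is_lead lt f m ->
  exists v w, lead_pair K v w /\ (pair_mnm v w <= m)%MM.
Proof.
move=> kf [mf lead]; apply: NNPP => rm.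
have [|q eq hq] := @reduce_below m (rem m (msupp f)) (fun m' => f@_m').
  by move=> m'; rewrite (mem_rem_uniq _ (msupp_uniq f)) inE => /andP[h /lead]; apply.
have ef : f = f@_m *: 'X_[m] + \sum_(m' <- rem m (msupp f)) f@_m' *: 'X_[m'].
  by rewrite {1}(mpolyE f) (perm_big _ (perm_to_rem mf)) big_cons.
have z : f@_m *: 'X_[m] + q = 0.
  apply: standard_kernel.
    move=> m' /msuppD_le; rewrite mem_cat => /orP[/msuppZ_le|/hq[h _]]; last exact: (standard_config h).
    by rewrite msuppX inE => /eqP ->; exact: (standard_config rm).
  by rewrite piRD eq -piRD -ef.
have q0 : q@_m = 0.
  by apply: memN_msupp_eq0; apply/negP => /hq[_]; rewrite irr.
move: mf; rewrite mcoeff_msupp => /eqP; apply.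
have := congr1 (fun p : P => p@_m) z; rewrite mcoeff0 mcoeffD mcoeffZ mcoeffX eqxx mulr1.
by rewrite q0 addr0.
Qed.
End Main.

Theorem theorem7p1 (K : fieldType) (d e : nat) (hde : (3 <= d + e)%N) :
  groebner_basis (@mono_lt d e) (@rees_relation K d e) (@ker_piR K d e).
Proof.
split; first exact: piR_relation.
move=> p; split; apply: ideal_gen_sub => {p} _ [f [m [kf lead ->]]].
  have [v [w [/lead_pair_lead[g rg lg] le]]] := lead_divisible kf lead.
  exists [:: ('X_[m - pair_mnm v w], 'X_[pair_mnm v w])]; split.
    by move=> i; rewrite inE => /eqP -> /=; exists g, (pair_mnm v w).
  by rewrite big_seq1 /= -mpolyXD submK.
exists [:: (1, 'X_[m])]; split; last by rewrite big_seq1 mul1r.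
move=> i; rewrite inE => /eqP -> /=; exists f, m; split=> //; exact: piR_relation.
Qed.
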